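(* Let $X\sim\mathcal N(\theta,I_p)$ with $\theta\in\mathbb R^p$ unknown. Let $m$ be a nonnegative function on $\mathbb R^p$ which is superharmonic (respectively subharmonic) on $\mathbb R^p$ and such that $\nabla m/m\in W^{1,1}_{\mathrm{loc}}(\mathbb R^p)$. Let $\xi$ be a real-valued function which is strictly positive and strictly subharmonic (respectively strictly superharmonic) on $\mathbb R^p$ and such that, for every $\theta$, $$E_\theta\left[\left(\frac{\Delta\xi(X)}{\xi(X)}\right)^2\right]<\infty .$$ Assume also that there exists a constant $K>0$ such that, for every $x\in\mathbb R^p$, $$m(x)>K\,\frac{\xi^2(x)}{|\Delta\xi(x)|},$$ and let $K_0=\inf_{x\in\mathbb R^p} m(x)\,\dfrac{|\Delta\xi(x)|}{\xi^2(x)}$. Put $g=\nabla m/m$, $\varphi(X)=X+g(X)$, and let $\delta_0(X)=p+2\operatorname{div}g(X)+\|g(X)\|^2$ be the unbiased estimator of the loss $\|\varphi(X)-\theta\|^2$. Let $0<\alpha<2K_0$ and, for $x$ with $m(x)\neq0$, $$\gamma(x)=-\alpha\,\operatorname{sgn}(\Delta\xi(x))\,\frac{\xi(x)}{m(x)} .$$ Assume the standing regularity conditions: $E_\theta[\|g(X)\|^2]<\infty$ for all $\theta$; $\delta_0$ has finite risk $\mathcal R(\theta,\varphi,\delta_0)$ for all $\theta$; $\gamma$ is twice weakly differentiable; and, for all $\theta$, the random variables $(X-\theta)^t\nabla\gamma(X)$, $\Delta\gamma(X)$, $\gamma(X)(X-\theta)^tg(X)$, $\gamma(X)\operatorname{div}g(X)$,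 $\nabla\gamma(X)^tg(X)$ are integrable. Then $\delta_0$ is dominated by $\delta=\delta_0-\gamma$, i.e. $\mathcal R(\theta,\varphi,\delta)\le\mathcal R(\theta,\varphi,\delta_0)$ for all $\theta\in\mathbb R^p$, with strict inequality for some $\theta$.
   Context: $E_\theta$ is expectation under $X\sim\mathcal N(\theta,I_p)$. The estimator $\varphi(X)$ of $\theta$ has loss $\|\varphi(X)-\theta\|^2$; a loss estimator $\delta(X)$ of this loss is evaluated by the risk $\mathcal R(\theta,\varphi,\delta)=E_\theta[(\delta(X)-\|\varphi(X)-\theta\|^2)^2]$. Derivatives ($\nabla$, $\operatorname{div}$, $\Delta$) are understood in the weak sense: a locally integrable $\gamma:\mathbb R^p\to\mathbb R$ is weakly differentiable if there are locally integrable $h_1,\dots,h_p$ with $\int\gamma\,\partial_i\phi\,dx=-\int h_i\phi\,dx$ for all smooth compactly supported $\phi$; then $\partial_i\gamma:=h_i$. It is twice weakly differentiable ($\gamma\in W^{2,1}_{\mathrm{loc}}$) if all its weak partial derivatives are weakly differentiable. A vector-valued function is weakly differentiable (in $W^{1,1}_{\mathrm{loc}}$) if each component is. Strictly subharmonic (superharmonic) means $\Delta\xi>0$ ($\Delta\xi<0$). $\operatorname{sgn}$ is the sign function. *)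

(* Defs.v *)
From HB Require Import structures.
From mathcomp Require Import all_boot all_order all_algebra.
From mathcomp Require Import all_classical all_reals all_analysis.
From mathcomp Require Import measurable_realfun.

Set Implicit Arguments.
Unset Strict Implicit.
Unset Printing Implicit Defensive.

Import Order.TTheory GRing.Theory Num.Theory.
Import numFieldNormedType.Exports.

Local Open Scope classical_set_scope.
Local Open Scope ring_scope.

Definition rV_display : measure_display.
Proof. exact: default_measure_display. Qed.

Section rV_measurable.
Context {R : realType} {n : nat}.

Let coord (i : 'I_n) (x : 'rV[R]_n) : measurableTypeR R := x 0 i.

Let rV_set0 : g_sigma_preimage coord set0.
Proof. exact: sigma_algebra0. Qed.

Let rV_setC A : g_sigma_preimage coord A -> g_sigma_preimage coord (~` A).
Proof. exact: sigma_algebraC. Qed.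

Let rV_bigcup (F : (set 'rV[R]_n)^nat) :
  (forall i, g_sigma_preimage coord (F i)) ->
  g_sigma_preimage coord (\bigcup_i (F i)).
Proof. exact: sigma_algebra_bigcup. Qed.

HB.instance Definition _ := @isMeasurable.Build rV_display
  'rV[R]_n (g_sigma_preimage coord) rV_set0 rV_setC rV_bigcup.

Lemma measurable_coord (i : 'I_n) :
  measurable_fun [set: 'rV[R]_n] (fun x : 'rV[R]_n => x 0 i).
Proof.
move=> _ Y mY; rewrite setTI; apply: sub_sigma_algebra => /=.
rewrite -bigcup_seq/=; exists i => /=; first by rewrite mem_index_enum.
by exists Y => //; rewrite setTI.
Qed.

Lemma measurable_fun_rVP d (T : measurableType d) (f : T -> 'rV[R]_n) :
  (forall i, measurable_fun [set: T] (fun t => f t 0 i)) ->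
  measurable_fun [set: T] f.
Proof.
move=> mf _ A mA; rewrite setTI.
suff H : g_sigma_preimage coord `<=` [set A | measurable (f @^-1` A)] by exact: H.
apply: smallest_sub.
  split => /=.
  - by rewrite preimage_set0.
  - by move=> B mB; rewrite setTD preimage_setC; exact: measurableC.
  - by move=> F mF; rewrite preimage_bigcup; exact: bigcupT_measurable.
rewrite -bigcup_seq; apply: bigcup_sub => i _ B [C mC <-] /=.
by have := mf i measurableT C mC; rewrite !setTI.
Qed.

End rV_measurable.

Section rV_cons.
Context {R : realType} {n : nat}.

Definition rV_cons (z : measurableTypeR R * 'rV[R]_n) : 'rV[R]_n.+1 :=
  row_mx (z.1 : R)%:M z.2.

Lemma rV_cons0 z : rV_cons z 0 0 = z.1.
Proof.
have -> : (0 : 'I_n.+1) = lshift n (0 : 'I_1) by exact: val_inj.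
by rewrite [LHS]row_mxEl mxE eqxx.
Qed.

Lemma rV_consS z i : rV_cons z 0 (lift 0 i) = z.2 0 i.
Proof.
have -> : lift 0 i = rshift 1 i by exact: val_inj.
by rewrite [LHS]row_mxEr.
Qed.

Lemma measurable_rV_cons : measurable_fun [set: _] rV_cons.
Proof.
apply: measurable_fun_rVP => i; have [j ->|->] := unliftP 0 i.
- under eq_fun do rewrite rV_consS.
  exact: (measurableT_comp (measurable_coord j) measurable_snd).
- by under eq_fun do rewrite rV_cons0; exact: measurable_fst.
Qed.

Variable mu : {sigma_finite_measure set 'rV[R]_n -> \bar R}.

Definition rV_cons_measure : set 'rV[R]_n.+1 -> \bar R :=
  pushforward ((@lebesgue_measure R) \x mu)%E rV_cons.

Let mcons := measurable_rV_cons.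

Let rV_cons_measure0 : rV_cons_measure set0 = 0%E.
Proof. exact: measure0. Qed.

Let rV_cons_measure_ge0 A : (0 <= rV_cons_measure A)%E.
Proof. exact: measure_ge0. Qed.

Let rV_cons_measure_sigma_additive : semi_sigma_additive rV_cons_measure.
Proof. exact: measure_semi_sigma_additive. Qed.

HB.instance Definition _ := isMeasure.Build _ _ _ rV_cons_measure
  rV_cons_measure0 rV_cons_measure_ge0 rV_cons_measure_sigma_additive.

Let split_fun (x : 'rV[R]_n.+1) : measurableTypeR R * 'rV[R]_n :=
  (x 0 0, \row_i x 0 (lift 0 i)).

Let measurable_split : measurable_fun [set: _] split_fun.
Proof.
apply: measurable_fun_pair; first exact: measurable_coord.
apply: measurable_fun_rVP => i; under eq_fun do rewrite mxE.
exact: measurable_coord.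
Qed.

Let rV_consK : cancel rV_cons split_fun.
Proof.
move=> z; rewrite /split_fun rV_cons0 [RHS]surjective_pairing; congr pair.
by apply/rowP => i; rewrite mxE rV_consS.
Qed.

Let rV_cons_sigma_finite : sigma_finite setT rV_cons_measure.
Proof.
have /sigma_finiteP[F [TF ndF Foo]] := sigma_finiteT (@lebesgue_measure R).
have /sigma_finiteP[G [TG ndG Goo]] := sigma_finiteT mu.
exists (fun k => split_fun @^-1` (F k `*` G k)).
  rewrite -preimage_bigcup (_ : \bigcup_k _ = setT) ?preimage_setT//.
  apply/seteqP; split => // -[x y] _.
  have [i _ Fix] : (\bigcup_k F k) x by rewrite -TF.
  have [j _ Gjy] : (\bigcup_k G k) y by rewrite -TG.
  exists (maxn i j) => //; split => /=.
  - by move: x Fix; exact/subsetPset/ndF/leq_maxl.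
  - by move: y Gjy; exact/subsetPset/ndG/leq_maxr.
move=> k; have [mF Fk] := Foo k; have [mG Gk] := Goo k; split.
  by rewrite -[X in measurable X]setTI; apply: measurable_split => //;
    exact: measurableX.
rewrite /rV_cons_measure /pushforward -comp_preimage.
rewrite (_ : _ \o _ = id); last by apply/funext => z; exact: rV_consK.
by rewrite preimage_id product_measure1E// lte_mul_pinfty// ge0_fin_numE.
Qed.

HB.instance Definition _ := Measure_isSigmaFinite.Build _ _ _ rV_cons_measure
  rV_cons_sigma_finite.

Lemma ge0_integral_rV_cons (f : 'rV[R]_n.+1 -> \bar R) :
  measurable_fun [set: 'rV[R]_n.+1] f -> (forall x, 0 <= f x)%E ->
  (\int[rV_cons_measure]_x f x =
   \int[@lebesgue_measure R]_t \int[mu]_v f (rV_cons (t, v)))%E.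
Proof.
move=> mf f0.
rewrite [LHS](ge0_integral_pushforward measurable_rV_cons)//.
rewrite preimage_setT fubini_tonelli1//; last by move=> z; exact: f0.
exact: measurableT_comp mf measurable_rV_cons.
Qed.

End rV_cons.

Fixpoint lebesgue_rV {R : realType} (n : nat) :
    {sigma_finite_measure set 'rV[R]_n -> \bar R} :=
  match n with
  | 0 => \d_ (0 : 'rV[R]_0)
  | n'.+1 => rV_cons_measure (lebesgue_rV n')
  end.

Lemma ge0_integral_lebesgue_rV (R : realType) n (f : 'rV[R]_n.+1 -> \bar R) :
  measurable_fun [set: 'rV[R]_n.+1] f -> (forall x, 0 <= f x)%E ->
  (\int[lebesgue_rV n.+1]_x f x =
   \int[@lebesgue_measure R]_t \int[lebesgue_rV n]_v f (rV_cons (t, v)))%E.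
Proof. exact: ge0_integral_rV_cons. Qed.

Lemma lebesgue_rV_box (R : realType) n (A : 'I_n -> set (measurableTypeR R)) :
  (forall i, measurable (A i)) ->
  lebesgue_rV n [set x : 'rV[R]_n | forall i, A i (x 0 i)] =
  (\prod_(i < n) (@lebesgue_measure R) (A i))%E.
Proof.
elim: n A => [|n IH] A mA.
  by rewrite big_ord0/= diracE mem_set//= => -[].
have mB : measurable [set x : 'rV[R]_n | forall i, A (lift 0 i) (x 0 i)].
  rewrite [X in measurable X](_ : _ = \bigcap_(i in [set: 'I_n])
     ((fun x : 'rV[R]_n => x 0 i) @^-1` (A (lift 0 i)))); last first.
    by apply/seteqP; split => [x /= H i _|x /= H i]; [exact: H|exact: (H i I)].
  apply: fin_bigcap_measurable => // i _.
  rewrite -[X in measurable X]setTI; apply: (measurable_coord i measurableT).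
  exact: mA.
rewrite big_ord_recl -IH// -product_measure1E//=.
rewrite /rV_cons_measure /pushforward; congr (_ _).
apply/seteqP; split => -[t v] /=.
  by move=> H; split => [|i]; [have := H 0|have := H (lift 0 i)];
    rewrite ?rV_cons0 ?rV_consS.
move=> [At Av] i; have [j ->|->] := unliftP 0 i.
  by rewrite rV_consS.
by rewrite rV_cons0.
Qed.

Section mvnormal.
Context {R : realType} {p : nat}.
Implicit Types theta x : 'rV[R]_p.

Definition mvnormal_pdf theta x : R := \prod_i normal_pdf (theta 0 i) 1 (x 0 i).

Lemma mvnormal_pdf_ge0 theta x : 0 <= mvnormal_pdf theta x.
Proof. by apply: prodr_ge0 => i _; exact: normal_pdf_ge0. Qed.

Lemma measurable_mvnormal_pdf theta : measurable_fun setT (mvnormal_pdf theta).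
Proof.
apply: measurable_prod => i _; apply: measurableT_comp.
  exact: measurable_normal_pdf.
exact: measurable_coord.
Qed.

Lemma measurable_EFin_mvnormal_pdf theta :
  measurable_fun [set: 'rV[R]_p] (fun x => (mvnormal_pdf theta x)%:E).
Proof.
by apply/measurable_EFinP; exact: measurable_mvnormal_pdf.
Qed.

Definition mvnormal_prob theta : set 'rV[R]_p -> \bar R :=
  fun V => (\int[lebesgue_rV p]_(x in V) (mvnormal_pdf theta x)%:E)%E.
End mvnormal.

Lemma integral_mvnormal_pdf (R : realType) p (theta : 'rV[R]_p) :
  (\int[lebesgue_rV p]_x (mvnormal_pdf theta x)%:E = 1)%E.
Proof.
elim: p theta => [|p IH] theta.
  rewrite /= integral_dirac//; first by rewrite diracT mul1e /mvnormal_pdf big_ord0.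
  exact: measurable_EFin_mvnormal_pdf.
transitivity (\int[@lebesgue_measure R]_t \int[lebesgue_rV p]_v
    (mvnormal_pdf theta (rV_cons (t, v)))%:E)%E.
  apply: (ge0_integral_lebesgue_rV
    (f := fun x => (mvnormal_pdf theta x)%:E)) => [|x].
  - exact: measurable_EFin_mvnormal_pdf.
  - by rewrite lee_fin mvnormal_pdf_ge0.
pose th := \row_i theta 0 (lift 0 i).
have pdfE t v : mvnormal_pdf theta (rV_cons (t, v)) =
    normal_pdf (theta 0 0) 1 t * mvnormal_pdf th v.
  rewrite /mvnormal_pdf big_ord_recl rV_cons0; congr (_ * _).
  by apply: eq_bigr => i _; rewrite rV_consS mxE.
rewrite -[RHS](integral_normal_pdf (theta 0 0) 1).
apply: eq_integral => t _.
under eq_integral do rewrite pdfE EFinM.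
rewrite ge0_integralZl ?IH ?mule1//.
- exact: measurable_EFin_mvnormal_pdf.
- by move=> v _; rewrite lee_fin mvnormal_pdf_ge0.
- by rewrite lee_fin normal_pdf_ge0.
Qed.

Section mvnormal_probability.
Context {R : realType} {p : nat}.
Variable theta : 'rV[R]_p.

Lemma integrable_mvnormal_pdf :
  (lebesgue_rV p).-integrable setT (EFin \o mvnormal_pdf theta).
Proof.
apply/integrableP; split.
  exact: measurable_EFin_mvnormal_pdf.
under eq_integral do rewrite /= ger0_norm ?mvnormal_pdf_ge0//.
by rewrite integral_mvnormal_pdf ltry.
Qed.

Let mvnormal0 : mvnormal_prob theta set0 = 0%E.
Proof. by rewrite /mvnormal_prob integral_set0. Qed.

Let mvnormal_ge0 A : (0 <= mvnormal_prob theta A)%E.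
Proof.
by apply: integral_ge0 => x _; rewrite lee_fin mvnormal_pdf_ge0.
Qed.

Let mvnormal_sigma_additive : semi_sigma_additive (mvnormal_prob theta).
Proof.
move=> /= A mA tA mUA.
rewrite /mvnormal_prob/= integral_bigcup//=; last first.
  by apply: (integrableS _ _ (subsetT _)) => //; exact: integrable_mvnormal_pdf.
apply: is_cvg_ereal_nneg_natsum_cond => n _ _.
by apply: integral_ge0 => /= x _; rewrite lee_fin mvnormal_pdf_ge0.
Qed.

HB.instance Definition _ := isMeasure.Build _ _ _ (mvnormal_prob theta)
  mvnormal0 mvnormal_ge0 mvnormal_sigma_additive.

Let mvnormal_setT : mvnormal_prob theta setT = 1%E.
Proof. exact: integral_mvnormal_pdf. Qed.

HB.instance Definition _ := @Measure_isProbability.Build _ _ R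
  (mvnormal_prob theta) mvnormal_setT.

End mvnormal_probability.

(* The norm [`|x|] of the library on ['rV[R]_p] is the max norm, hence a
   separate definition of the Euclidean one. *)
Definition dotV {R : realType} {p : nat} (u v : 'rV[R]_p) : R :=
  \sum_i u 0 i * v 0 i.

Definition sqnorm {R : realType} {p : nat} (u : 'rV[R]_p) : R := dotV u u.

Section weak_derivatives.
Context {R : realType} {p : nat}.
Implicit Types (u h phi : 'rV[R]_p -> R).

Definition partial (i : 'I_p) phi : 'rV[R]_p -> R := 'D_(delta_mx 0 i) phi.

Fixpoint Ck (k : nat) phi : Prop :=
  continuous phi /\
  match k with
  | 0 => True
  | k'.+1 => forall i, (forall x, derivable phi x (delta_mx 0 i)) /\
                       Ck k' (partial i phi)
  end.

Definition test_function phi : Prop :=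
  (forall k, Ck k phi) /\ compact (closure [set x | phi x != 0]).

Definition loc_integrable u : Prop :=
  measurable_fun [set: 'rV[R]_p] u /\
  forall K : set 'rV[R]_p, compact K ->
    (\int[lebesgue_rV p]_(x in K) `|u x|%:E < +oo)%E.

(* A weak derivative is only determined almost everywhere, so it is handled as
   a relation between a function and a representative of its derivative. *)
Definition weak_partial (i : 'I_p) u h : Prop :=
  [/\ loc_integrable u, loc_integrable h &
      forall phi, test_function phi ->
        (\int[lebesgue_rV p]_x (u x * partial i phi x)%:E =
         - \int[lebesgue_rV p]_x (h x * phi x)%:E)%E].

Definition weak_gradient u (G : 'rV[R]_p -> 'rV[R]_p) : Prop :=
  forall i, weak_partial i u (fun x => G x 0 i).

(* [J x j i] is the [i]-th weak partial derivative of the [j]-th component of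
   [g]; thus [\tr (J x)] is the weak divergence of [g]. *)
Definition weak_jacobian (g : 'rV[R]_p -> 'rV[R]_p) (J : 'rV[R]_p -> 'M[R]_p)
  : Prop :=
  forall j i, weak_partial i (fun x => g x 0 j) (fun x => J x j i).

(* [u] is twice weakly differentiable; [\tr (H x)] is its weak Laplacian. *)
Definition weak_hessian u (G : 'rV[R]_p -> 'rV[R]_p) (H : 'rV[R]_p -> 'M[R]_p)
  : Prop :=
  weak_gradient u G /\ weak_jacobian G H.

Definition laplacian phi : 'rV[R]_p -> R :=
  fun x => \sum_i partial i (partial i phi) x.

(* [Delta u <= 0] (resp. [Delta u >= 0]) in the weak sense. The weak Laplacian
   is not required to be a function: it may be singular, as for the
   superharmonic function [|x|^(2-p)]. *)
Definition weakly_superharmonic u : Prop :=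
  loc_integrable u /\
  forall phi, test_function phi -> (forall x, 0 <= phi x) ->
    (\int[lebesgue_rV p]_x (u x * laplacian phi x)%:E <= 0)%E.

Definition weakly_subharmonic u : Prop :=
  loc_integrable u /\
  forall phi, test_function phi -> (forall x, 0 <= phi x) ->
    (0 <= \int[lebesgue_rV p]_x (u x * laplacian phi x)%:E)%E.

End weak_derivatives.

Section loss_estimation.
Context {R : realType} {p : nat}.
Implicit Types (theta : 'rV[R]_p) (phi g : 'rV[R]_p -> 'rV[R]_p).
Implicit Types (delta Y : 'rV[R]_p -> R).

Definition normal_integrable theta Y : Prop :=
  (mvnormal_prob theta).-integrable [set: 'rV[R]_p] (EFin \o Y).

Definition risk theta phi delta : \bar R :=
  ('E_(mvnormal_prob theta)
    [fun x => ((delta x - sqnorm (phi x - theta)) ^+ 2)%R])%E.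

Definition unbiased_loss g (Jg : 'rV[R]_p -> 'M[R]_p) : 'rV[R]_p -> R :=
  fun x => p%:R + 2 * \tr (Jg x) + sqnorm (g x).

Definition loss_dominates phi delta delta0 : Prop :=
  (forall theta, (risk theta phi delta <= risk theta phi delta0)%E) /\
  (exists theta, (risk theta phi delta < risk theta phi delta0)%E).

End loss_estimation.

(* Main.v *)
Require Import Defs.
From HB Require Import structures.
From mathcomp Require Import all_boot all_order all_algebra.
From mathcomp Require Import all_classical all_reals all_analysis.
From mathcomp Require Import measurable_realfun.
From mathcomp Require Import ring lra.

Set Implicit Arguments.
Unset Strict Implicit.
Unset Printing Implicit Defensive.

Import Order.TTheory GRing.Theory Num.Theory.
Import numFieldNormedType.Exports.

Local Open Scope classical_set_scope.
Local Open Scope ring_scope.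

(** Since [gamma m = - alpha s xi] with [s] the constant sign of the Laplacian
    of [xi], differentiating twice gives almost everywhere

      [Delta gamma + 2 Dgamma . g + gamma (div g + |g|^2)
         = - alpha |Delta xi| / m <= - (K0 / alpha) gamma^2],

    and formally [div g + |g|^2 = Delta m / m], so that the last term on the left
    has the sign of [gamma Delta m >= 0] and can be dropped.  Integrating the
    remaining inequality against the Gaussian density (by parts) bounds
    [E (gamma D0)] from below by [(K0 / alpha) E gamma^2], where [D0] is the error
    of the unbiased estimator; hence the risk changes by
    [E gamma^2 - 2 E (gamma D0) <= (1 - 2 K0 / alpha) E gamma^2 < 0].

    The Laplacian of [m] is only a distribution and products such as [gamma g] need
    not be weakly differentiable.  The pointwise identity is therefore obtained
    from difference quotients along a common sequence of steps.  The sign of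
    [div g + |g|^2] comes from mollification: if [m] is superharmonic then
    [exp (- l m)] is subharmonic, and its gradient is [- l m exp (- l m) g]; if
    [m] is subharmonic then it is bounded by its means, hence locally bounded.  Each
    integration by parts first truncates [g] and then lets the truncation tend
    to the identity. *)

(** * Real-valued integrals *)

Notation itg mu f := (mu.-integrable [set: _] (fun x => (f x)%:E)).
Notation rint mu f := (\int[mu]_x (f x : _))%R (only parsing).

Section real_integral.
Context d (T : measurableType d) (R : realType).
Variable mu : {measure set T -> \bar R}.
Implicit Types f g : T -> R.

Lemma itg_measurable f : itg mu f -> measurable_fun setT f.
Proof. by move=> /integrableP[/measurable_EFinP]. Qed.

Lemma itg_le f g : measurable_fun setT f -> (forall x, `|f x| <= g x) ->
  itg mu g -> itg mu f.
Proof.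
move=> mf fg; apply: le_integrable => //; first exact/measurable_EFinP.
by move=> x _ /=; rewrite lee_fin (le_trans (fg x))// ler_norm.
Qed.

Lemma itgD f g : itg mu f -> itg mu g -> itg mu (fun x => f x + g x).
Proof. by move=> f1 g1; exact: (integrableD measurableT f1 g1). Qed.

Lemma itgN f : itg mu f -> itg mu (fun x => - f x).
Proof. by move=> f1; exact: (integrableN f1). Qed.

Lemma itgB f g : itg mu f -> itg mu g -> itg mu (fun x => f x - g x).
Proof. by move=> f1 g1; apply: itgD => //; exact: itgN. Qed.

Lemma itgZ k f : itg mu f -> itg mu (fun x => k * f x).
Proof. by move=> f1; exact: (integrableZl measurableT k f1). Qed.

Lemma itg0 : itg mu (fun=> 0).
Proof. exact: integrable0. Qed.

Lemma itg_norm f : itg mu f -> itg mu (fun x => `|f x|).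
Proof. exact: integrable_norm. Qed.

Lemma itg_sum (I : finType) (F : I -> T -> R) :
  (forall i, itg mu (F i)) -> itg mu (fun x => \sum_i F i x).
Proof.
move=> iF; under eq_fun do rewrite -sumEFin.
by apply: integrable_sum => // i _; exact: iF.
Qed.

Lemma itg_bounded f g C : itg mu f -> measurable_fun setT g ->
  (forall x, `|g x| <= C) -> itg mu (fun x => f x * g x).
Proof.
move=> If mg gC; apply: (@itg_le _ (fun x => C * `|f x|)).
- by apply: measurable_funM => //; exact: itg_measurable.
- by move=> x; rewrite normrM mulrC ler_wpM2r.
- exact/itgZ/itg_norm.
Qed.

Lemma eq_itg f g : f =1 g -> itg mu f -> itg mu g.
Proof. by move=> /funext->. Qed.

Lemma EFin_rint f : itg mu f -> (rint mu f)%:E = (\int[mu]_x (f x)%:E)%E.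
Proof. by move=> f1; rewrite /Rintegral fineK// integrable_fin_num. Qed.

Lemma rintD f g : itg mu f -> itg mu g ->
  rint mu (fun x => f x + g x) = rint mu f + rint mu g.
Proof. by move=> f1 g1; exact: RintegralD. Qed.

Lemma rintB f g : itg mu f -> itg mu g ->
  rint mu (fun x => f x - g x) = rint mu f - rint mu g.
Proof. by move=> f1 g1; exact: RintegralB. Qed.

Lemma rintZ k f : itg mu f -> rint mu (fun x => k * f x) = k * rint mu f.
Proof. by move=> f1; exact: RintegralZl. Qed.

Lemma rint0 : rint mu (fun=> 0 : R) = 0.
Proof. by rewrite /Rintegral integral0. Qed.

(* [Rintegral] takes the junk value 0 on infinite integrals. *)
Lemma rint_nonintegrable f : measurable_fun setT f -> ~ itg mu f -> rint mu f = 0.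
Proof.
move=> mf nf; have mf' : measurable_fun setT (EFin \o f) by exact/measurable_EFinP.
have p0 : (0 <= \int[mu]_x (EFin \o f)^\+%E x)%E by exact: integral_ge0.
have n0 : (0 <= \int[mu]_x (EFin \o f)^\-%E x)%E by exact: integral_ge0.
have : (\int[mu]_x (EFin \o f)^\+%E x + \int[mu]_x (EFin \o f)^\-%E x = +oo)%E.
  apply: contrapT => noo; apply: nf; apply/integrableP; split => //.
  rewrite ltey; apply/eqP => foo; apply: noo.
  rewrite -ge0_integralD//; [|exact: measurable_funepos|exact: measurable_funeneg].
  rewrite -foo; apply: eq_integral => x _.
  by have /funeqP/(_ x) := fune_abse (EFin \o f).
rewrite /Rintegral [X in fine X]integralE.
move: p0 n0; set P := (\int[mu]_x (EFin \o f)^\+ x)%E.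
set N := (\int[mu]_x (EFin \o f)^\- x)%E.
by case: P => [a| |]; case: N => [b| |].
Qed.

Lemma rintZ_measurable k f : measurable_fun setT f ->
  rint mu (fun x => k * f x) = k * rint mu f.
Proof.
move=> mf; have [->|k0] := eqVneq k 0.
  by under eq_Rintegral do rewrite mul0r; rewrite rint0 mul0r.
have [If|nIf] := pselect (itg mu f); first exact: rintZ.
rewrite (rint_nonintegrable mf nIf) mulr0; apply: rint_nonintegrable.
  exact: measurable_funM.
move=> Ikf; apply: nIf; apply: eq_itg (itgZ k^-1 Ikf) => x.
by rewrite mulKf.
Qed.

Lemma rintN f : itg mu f -> rint mu (fun x => - f x) = - rint mu f.
Proof.
by move=> f1; under eq_Rintegral do rewrite -mulN1r; rewrite rintZ// mulN1r.
Qed.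

Lemma rint_sum (I : finType) (F : I -> T -> R) :
  (forall i, itg mu (F i)) ->
  rint mu (fun x => \sum_i F i x) = \sum_i rint mu (F i).
Proof.
move=> iF.
suff H (s : seq I) : itg mu (fun x => \sum_(i <- s) F i x) /\
   rint mu (fun x => \sum_(i <- s) F i x) = \sum_(i <- s) rint mu (F i).
  exact: (H _).2.
elim: s => [|a s [IH1 IH2]].
  under eq_fun do rewrite big_nil; split; first exact: itg0.
  by under eq_Rintegral do rewrite big_nil; rewrite rint0 big_nil.
split.
  under eq_fun do rewrite big_cons; exact: itgD.
by under eq_Rintegral do rewrite big_cons; rewrite rintD// big_cons IH2.
Qed.

Lemma eq_rint f g : f =1 g -> rint mu f = rint mu g.
Proof. by move=> /funext->. Qed.

Lemma rint_ge0 f : (forall x, 0 <= f x) -> 0 <= rint mu f.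
Proof. by move=> f0; exact: Rintegral_ge0. Qed.

Lemma rint_le f g : itg mu f -> itg mu g -> (forall x, f x <= g x) ->
  rint mu f <= rint mu g.
Proof. by move=> f1 g1 fg; exact: le_Rintegral. Qed.

Lemma rint_norm f : itg mu f -> `|rint mu f| <= rint mu (fun x => `|f x|).
Proof. by move=> f1; exact: le_normr_Rintegral. Qed.

Lemma rint_ae f g : measurable_fun setT f -> measurable_fun setT g ->
  {ae mu, forall x, f x = g x} -> rint mu f = rint mu g.
Proof.
move=> mf mg fg; rewrite /Rintegral; congr fine.
apply: ae_eq_integral => //; [exact/measurable_EFinP|exact/measurable_EFinP|].
by apply: filterS fg => x /= -> _.
Qed.

Lemma rint_ae_ge0 f : itg mu f -> {ae mu, forall x, 0 <= f x} -> 0 <= rint mu f.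
Proof.
move=> f1 f0; rewrite (@rint_ae _ (fun x => `|f x|)).
- exact: rint_ge0.
- exact: itg_measurable.
- by apply: measurableT_comp => //; exact: itg_measurable.
- by apply: filterS f0 => x fx; rewrite ger0_norm.
Qed.

Lemma rint_ae_le f g : itg mu f -> itg mu g -> {ae mu, forall x, f x <= g x} ->
  rint mu f <= rint mu g.
Proof.
move=> f1 g1 fg; rewrite -subr_ge0 -rintB//; apply: rint_ae_ge0.
  exact: itgB.
by apply: filterS fg => x; rewrite subr_ge0.
Qed.

Lemma itg_ae f g : measurable_fun setT g -> {ae mu, forall x, f x = g x} ->
  itg mu f -> itg mu g.
Proof.
move=> mg fg f1; apply/integrableP; split; first exact/measurable_EFinP.
have := integrableP _ _ _ f1 => -[mf]; congr (_ < _)%E.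
apply: ae_eq_integral => //.
- by apply: measurableT_comp.
- by apply: measurableT_comp => //; exact/measurable_EFinP.
- by apply: filterS fg => x /= -> _.
Qed.

Lemma rint_dct (F : nat -> T -> R) f g :
  (forall n, measurable_fun setT (F n)) -> measurable_fun setT f ->
  itg mu g -> (forall n x, `|F n x| <= g x) ->
  {ae mu, forall x, F n x @[n --> \oo] --> f x} ->
  itg mu f /\ rint mu (F n) @[n --> \oo] --> rint mu f.
Proof.
move=> mF mf ig Fg cF.
have [] := @dominated_convergence _ _ _ mu setT measurableT
  (fun n x => (F n x)%:E) (fun x => (f x)%:E) (fun x => (g x)%:E).
- by move=> n; exact/measurable_EFinP.
- exact/measurable_EFinP.
- by apply: filterS cF => x Fx _; by apply: cvg_EFin => //; exact: nearW.
- exact: ig.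
- by apply: aeW => x n _; rewrite lee_fin.
move=> f1 _ Ff; split => //.
apply: fine_cvg; rewrite EFin_rint//.
Qed.

End real_integral.

Section real_fubini.
Context d1 d2 (T1 : measurableType d1) (T2 : measurableType d2) (R : realType).
Variables (m1 : {sigma_finite_measure set T1 -> \bar R})
  (m2 : {sigma_finite_measure set T2 -> \bar R}).

Lemma itg_prod (f : T1 -> R) (g : T2 -> R) : itg m1 f -> itg m2 g ->
  itg (m1 \x m2)%E (fun z => f z.1 * g z.2).
Proof.
move=> f1 g1; apply/integrable12ltyP.
  apply/measurable_EFinP; apply: measurable_funM.
    by apply: measurableT_comp => //; exact: itg_measurable f1.
  by apply: measurableT_comp => //; exact: itg_measurable g1.
under eq_integral => x _.
  under eq_integral do rewrite /= normrM EFinM.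
  rewrite ge0_integralZl//; last first.
    by apply/measurable_EFinP; apply: measurableT_comp => //; exact: itg_measurable g1.
  over.
rewrite /=.
have /integrableP[_ g2] := g1; have /integrableP[_ f2] := f1.
rewrite ge0_integralZr//.
- by rewrite lte_mul_pinfty// ?integral_ge0// ge0_fin_numE// integral_ge0.
- by apply/measurable_EFinP; apply: measurableT_comp => //; exact: itg_measurable f1.
- exact: integral_ge0.
Qed.

Lemma rint_fubini_itg (f : T1 * T2 -> R) : itg (m1 \x m2)%E f ->
  itg m1 (fun x => rint m2 (fun y => f (x, y))).
Proof.
move=> f1; apply/integrableP; split.
  apply/measurable_EFinP; apply: measurableT_comp; first by [].
  exact: measurable_fubini_F f1.
have := integrable_fubini_F f1 => /integrableP[_]; apply: le_lt_trans.
apply: ge0_le_integral => //.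
- apply: measurableT_comp => //; apply/measurable_EFinP.
  by apply: measurableT_comp; [by []|exact: measurable_fubini_F f1].
- by apply: measurableT_comp => //; exact: measurable_fubini_F f1.
- move=> x _; rewrite /fubini_F /Rintegral.
  by case: (X in fine X) => //= *; rewrite ?normr0 ?leey.
Qed.

Lemma integral_fine d (T : measurableType d) (mu : {measure set T -> \bar R})
    (F : T -> \bar R) :
  mu.-integrable setT F -> (\int[mu]_x F x = \int[mu]_x (fine (F x))%:E)%E.
Proof.
move=> iF; apply: ae_eq_integral => //; first exact: measurable_int iF.
  apply/measurable_EFinP; apply: measurableT_comp; first by [].
  exact: measurable_int iF.
by apply: filterS (integrable_ae measurableT iF) => x /(_ I) + _; move=> /fineK ->.
Qed.

End real_fubini.

Section real_fubini_swap.
Context d1 d2 (T1 : measurableType d1) (T2 : measurableType d2) (R : realType).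
Variables (m1 : {sigma_finite_measure set T1 -> \bar R})
  (m2 : {sigma_finite_measure set T2 -> \bar R}).

Lemma itg_swap (f : T1 * T2 -> R) : itg (m1 \x m2)%E f ->
  itg (m2 \x m1)%E (fun z => f (z.2, z.1)).
Proof.
move=> f1; have mf := itg_measurable f1.
apply/integrable12ltyP.
  by apply/measurable_EFinP; apply: (measurableT_comp mf); exact: measurable_swap.
by rewrite /=; apply/(integrable21ltyP m1 m2 (measurable_int _ f1)).
Qed.

Lemma rint_fubini (f : T1 * T2 -> R) : itg (m1 \x m2)%E f ->
  rint m1 (fun x => rint m2 (fun y => f (x, y))) =
  rint m2 (fun y => rint m1 (fun x => f (x, y))).
Proof.
move=> f1; have f2 := itg_swap f1; rewrite /Rintegral; congr fine.
transitivity (\int[m1]_x fubini_F m2 (EFin \o f) x)%E.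
  rewrite [RHS]integral_fine//; exact: integrable_fubini_F.
transitivity (\int[m2]_x fubini_G m1 (EFin \o f) x)%E.
  exact: Fubini.
rewrite [LHS]integral_fine//.
exact: (integrable_fubini_F f2).
Qed.

End real_fubini_swap.

(** * Translations and cubes *)

Section translation_invariance.
Context {R : realType}.
Notation lambda := (@lebesgue_measure R).

Let shift1 (c : R) (t : measurableTypeR R) : measurableTypeR R := t + c.

Let measurable_shift1 (c : R) : measurable_fun setT (shift1 c).
Proof. exact: measurable_funD. Qed.

HB.instance Definition _ c :=
  @isMeasurableFun.Build _ _ _ _ (shift1 c) (measurable_shift1 c).

Lemma ge0_integral_shift (c : R) (f : measurableTypeR R -> \bar R) :
  measurable_fun setT f -> (forall t, 0 <= f t)%E ->
  (\int[lambda]_t f (t + c)%R = \int[lambda]_t f t)%E.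
Proof.
move=> mf f0.
have H A : measurable A -> lambda A = pushforward lambda (shift1 c) A.
  move=> mA; apply: lebesgue_measure_unique => //= _ [[a b] _ <-] /=.
  rewrite /pushforward (_ : _ @^-1` _ = `]a - c, b - c]%classic).
    by rewrite !lebesgue_measure_itv/= !lte_fin ltrD2r -!EFinB opprB addrA subrK.
  by apply/seteqP; split => t /=; rewrite !in_itv/= ltrBlDr lerBrDr.
rewrite [RHS](eq_measure_integral (pushforward lambda (shift1 c))).
  by rewrite (ge0_integral_pushforward (measurable_shift1 c))// => t _.
by move=> A mA _; exact: H.
Qed.

Lemma measurable_rV_add p d (T : measurableType d) (f g : T -> 'rV[R]_p) :
  measurable_fun setT f -> measurable_fun setT g ->
  measurable_fun setT (fun x => f x + g x).
Proof.
move=> mf mg; apply: measurable_fun_rVP => i; under eq_fun do rewrite mxE.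
by apply: measurable_funD; exact: (measurableT_comp (measurable_coord i)).
Qed.

Lemma measurable_rV_scale p d (T : measurableType d) (k : T -> R) (f : T -> 'rV[R]_p) :
  measurable_fun setT k -> measurable_fun setT f ->
  measurable_fun setT (fun x => k x *: f x).
Proof.
move=> mf mg; apply: measurable_fun_rVP => i; under eq_fun do rewrite mxE.
by apply: measurable_funM => //; exact: (measurableT_comp (measurable_coord i)).
Qed.

Lemma measurable_rV_opp p d (T : measurableType d) (f : T -> 'rV[R]_p) :
  measurable_fun setT f -> measurable_fun setT (fun x => - f x).
Proof.
move=> mf; apply: measurable_fun_rVP => i; under eq_fun do rewrite mxE.
by apply: measurableT_comp => //; exact: (measurableT_comp (measurable_coord i)).
Qed.

Lemma ge0_integral_rV_shift p (z : 'rV[R]_p) (f : 'rV[R]_p -> \bar R) :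
  measurable_fun setT f -> (forall x, 0 <= f x)%E ->
  (\int[lebesgue_rV p]_x f (x + z)%R = \int[lebesgue_rV p]_x f x)%E.
Proof.
elim: p z f => [|p IH] z f mf f0.
  by apply: eq_integral => x _; congr f; apply/rowP => -[].
have mfz : measurable_fun setT (fun x : 'rV[R]_p.+1 => f (x + z)).
  by apply: (measurableT_comp mf); apply: measurable_rV_add.
rewrite [RHS]ge0_integral_lebesgue_rV//.
transitivity (\int[lambda]_t \int[lebesgue_rV p]_v f (rV_cons (t, v) + z)%R)%E.
  exact: (ge0_integral_lebesgue_rV mfz).
pose z' : 'rV[R]_p := \row_i z 0 (lift 0 i).
have E t v : rV_cons (t, v) + z = rV_cons (t + z 0 0, v + z').
  apply/rowP => i; rewrite mxE; have [j ->|->] := unliftP 0 i.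
    by rewrite !rV_consS/= !mxE.
  by rewrite !rV_cons0.
have mc t : measurable_fun setT (fun v : 'rV[R]_p => f (rV_cons (t, v))).
  apply: (measurableT_comp mf); apply: (measurableT_comp measurable_rV_cons).
  exact: pair1_measurable.
transitivity (\int[lambda]_t \int[lebesgue_rV p]_v f (rV_cons ((t + z 0 0)%R : measurableTypeR R, v)))%E.
  apply: eq_integral => t _; under eq_integral do rewrite E.
  by rewrite (IH z' (fun v => f (rV_cons ((t + z 0 0)%R : measurableTypeR R, v)))).
rewrite (ge0_integral_shift (z 0 0)
  (f := fun t => (\int[lebesgue_rV p]_v f (rV_cons (t, v)))%E))//.
  apply: (measurable_fun_fubini_tonelli_F (fun w => f (rV_cons w))) => //.
  by apply: (measurableT_comp mf); exact: measurable_rV_cons.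
by move=> t; apply: integral_ge0.
Qed.

Variable p : nat.
Notation E := 'rV[R]_p.
Notation mu := (@lebesgue_rV R p).
Implicit Types f : E -> R.

Lemma measurable_shift z : measurable_fun setT (fun x : E => x + z).
Proof. exact: measurable_rV_add. Qed.

Lemma itg_shift z f : itg mu f -> itg mu (fun x => f (x + z)).
Proof.
move=> f1; apply/integrableP; split.
  apply/measurable_EFinP; apply: measurableT_comp; last exact: measurable_shift.
  exact: itg_measurable f1.
rewrite (ge0_integral_rV_shift z (f := fun x => `|(f x)%:E|%E))//.
  by have /integrableP[] := f1.
by apply: measurableT_comp => //; exact: measurable_int f1.
Qed.

Lemma rint_shift z f : measurable_fun setT f ->
  rint mu (fun x => f (x + z)) = rint mu f.
Proof.
move=> mf; have mf' : measurable_fun setT (EFin \o f) by exact/measurable_EFinP.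
rewrite /Rintegral; congr fine.
rewrite [LHS]integralE [RHS]integralE; congr (_ - _)%E.
  rewrite -[RHS](ge0_integral_rV_shift z (f := (EFin \o f)^\+%E))//.
    by apply: eq_integral => x _; rewrite !funeposE.
  exact: measurable_funepos.
rewrite -[RHS](ge0_integral_rV_shift z (f := (EFin \o f)^\-%E))//.
  by apply: eq_integral => x _; rewrite !funenegE.
exact: measurable_funeneg.
Qed.

Lemma ae_shift z (P : E -> Prop) :
  {ae mu, forall x, P x} -> {ae mu, forall x, P (x + z)}.
Proof.
move=> [N [mN N0 PN]]; exists ((fun x => x + z) @^-1` N); split.
- by rewrite -[X in measurable X]setTI; exact: measurable_shift.
- have muE A : measurable A -> mu A = (\int[mu]_x (\1_A x)%:E)%E.
    by move=> mA; rewrite integral_indic// setIT.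
  rewrite muE; last by rewrite -[X in measurable X]setTI; exact: measurable_shift.
  rewrite (ge0_integral_rV_shift z (f := fun x => (\1_N x)%:E))//; first by rewrite -muE.
  by apply/measurable_EFinP; exact: measurable_indic.
- by move=> x /= nP; apply: PN.
Qed.

Section shear.
Context d (S : measurableType d) (nu : {sigma_finite_measure set S -> \bar R}).
Variable c : S -> E.
Hypothesis mc : measurable_fun setT c.

Let measurable_shear : measurable_fun setT (fun w : E * S => (w.1 + c w.2, w.2)).
Proof.
apply: measurable_fun_pair => //=; apply: measurable_rV_add => //.
exact: measurableT_comp.
Qed.

Lemma itg_shear (F : E * S -> R) : itg (mu \x nu)%E F ->
  itg (mu \x nu)%E (fun w => F (w.1 + c w.2, w.2)).
Proof.
move=> F1; have mF := itg_measurable F1.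
have mFs : measurable_fun setT (fun w : E * S => F (w.1 + c w.2, w.2)).
  exact: (measurableT_comp mF).
apply/integrable21ltyP; first exact/measurable_EFinP.
have /integrable21ltyP := F1; move=> /(_ (measurable_int _ F1)).
suff -> : (\int[nu]_s \int[mu]_x `|(F (x, s))%:E| =
  \int[nu]_s \int[mu]_x `|(F ((x + c s)%R, s))%:E|)%E by [].
apply: eq_integral => s _ /=.
rewrite (ge0_integral_rV_shift (c s) (f := fun x => (`|F (x, s)|)%:E))//.
apply/measurable_EFinP; apply: measurableT_comp => //.
by apply: (measurableT_comp mF); exact: pair2_measurable.
Qed.

Lemma rint_shear (F : E * S -> R) : itg (mu \x nu)%E F ->
  rint mu (fun x => rint nu (fun s => F (x + c s, s))) =
  rint nu (fun s => rint mu (fun x => F (x, s))).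
Proof.
move=> F1; rewrite (rint_fubini (itg_shear F1))/=; apply: eq_rint => s.
rewrite (rint_shift (c s) (f := fun x => F (x, s)))//.
by apply: (measurableT_comp (itg_measurable F1)); exact: pair2_measurable.
Qed.

End shear.
End translation_invariance.

Section cubes.
Context {R : realType} {p : nat}.
Notation E := 'rV[R]_p.
Notation mu := (@lebesgue_rV R p).
Implicit Types (f : E -> R) (x : E).

Definition cube (r : R) : set E := [set x | forall i, `|x 0 i| <= r].

Lemma normr_coord x i : `|x 0 i| <= `|x|.
Proof.
rewrite [leRHS]/Num.norm /= mx_normrE; apply/bigmax_geP; right => /=.
by exists (0, i).
Qed.

Lemma le_normr_rV x (r : R) : 0 <= r -> (forall i, `|x 0 i| <= r) -> `|x| <= r.
Proof.
move=> r0 H; rewrite [leLHS]/Num.norm /= mx_normrE; apply/bigmax_leP; split => //.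
by move=> [j i] _ /=; rewrite (ord1 j).
Qed.

Lemma cube_normr x : cube `|x| x.
Proof. by move=> i; exact: normr_coord. Qed.

Lemma le_cube r s : r <= s -> cube r `<=` cube s.
Proof. by move=> rs x H i; exact: le_trans rs. Qed.

Lemma cubeD r s x y : cube r x -> cube s y -> cube (r + s) (x + y).
Proof.
by move=> xr ys i; rewrite mxE (le_trans (ler_normD _ _))// lerD.
Qed.

Lemma cubeN r x : cube r x -> cube r (- x).
Proof. by move=> xr i; rewrite mxE normrN. Qed.

Lemma cube_setE r : cube r = [set x | forall i, `[- r, r]%classic (x 0 i)].
Proof.
by apply/seteqP; split => x H i; have := H i; rewrite /= in_itv/= ler_norml.
Qed.

Lemma measurable_cube r : measurable (cube r).
Proof.
rewrite [X in measurable X](_ : _ = \bigcap_(i in [set: 'I_p])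
     ((fun x : E => x 0 i) @^-1` `[- r, r])).
  apply: fin_bigcap_measurable => // i _.
  rewrite -[X in measurable X]setTI; apply: (measurable_coord i measurableT).
  exact: measurable_itv.
rewrite cube_setE.
by apply/seteqP; split => [x /= H i _|x /= H i]; [exact: H|exact: (H i I)].
Qed.

Lemma cube_lty r : (mu (cube r) < +oo)%E.
Proof.
rewrite cube_setE (lebesgue_rV_box (A := fun=> `[- r, r]%classic)); last first.
  by move=> i; exact: measurable_itv.
elim/big_rec : _ => [|i x _ xoo]; first exact: ltry.
rewrite lebesgue_measure_itv/=; case: ifPn; last by rewrite mul0e ltry.
by rewrite lte_fin => rr; rewrite -EFinB; apply: lte_mul_pinfty => //; rewrite lee_fin; lra.
Qed.

Lemma compact_cube r : compact (cube r).
Proof.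
rewrite cube_setE; apply: (@rV_compact R p (fun=> `[- r, r]%classic)) => i.
exact: segment_compact.
Qed.

Lemma compact_sub_cube (K : set E) : compact K -> exists n : nat, K `<=` cube n%:R.
Proof.
move=> /compact_bounded[M [_ MK]].
have [n Mn] : exists n : nat, M + 1 <= n%:R.
  by exists (Num.truncn `|M + 1|).+1; rewrite (le_trans (ler_norm _))// ltW// truncnS_gt.
exists n => x Kx i; apply: le_trans (normr_coord x i) _.
by apply: le_trans Mn; apply: MK => //; rewrite ltrDl.
Qed.

Lemma itg_cube r : itg mu (\1_(cube r) : E -> R).
Proof.
apply/integrableP; split.
  by apply/measurable_EFinP; apply: measurable_indic; exact: measurable_cube.
under eq_integral do rewrite /= ger0_norm//.
by rewrite integral_indic ?setIT ?cube_lty//; exact: measurable_cube.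
Qed.

Lemma measurable_open (U : set E) : open U -> measurable U.
Proof.
move=> oU.
pose box (a : 'rV[rat]_p * nat) : set E :=
  [set x | forall i, `|x 0 i - ratr (a.1 0 i)| < a.2.+1%:R^-1].
have mbox a : measurable (box a).
  rewrite [X in measurable X](_ : _ = \bigcap_(i in [set: 'I_p])
     ((fun x : E => x 0 i) @^-1` [set t | `|t - ratr (a.1 0 i)| < a.2.+1%:R^-1])).
    apply: fin_bigcap_measurable => // i _.
    rewrite -[X in measurable X]setTI; apply: (measurable_coord i measurableT).
    rewrite (_ : [set t | _] = `]ratr (a.1 0 i) - a.2.+1%:R^-1,
      ratr (a.1 0 i) + a.2.+1%:R^-1[%classic); first exact: measurable_itv.
    by apply/seteqP; split => t /=; rewrite in_itv/= ltr_distl.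
  by apply/seteqP; split => [x /= H i _|x /= H i]; [exact: H|exact: (H i I)].
rewrite (_ : U = \bigcup_(a in [set a | box a `<=` U]) box a).
  rewrite bigcup_mkcond; apply: countable_bigcupT_measurable => [|a].
    exact: countableP.
  by case: ifP.
apply/seteqP; split => [x Ux|x [a /= aU /aU//]].
have /nbhs_ballP[e /= e0 eU] : nbhs x U by exact: open_nbhs_nbhs.
have [n ne] : exists n : nat, n.+1%:R^-1 < e / 2.
  have e2 : 0 < e / 2 by rewrite divr_gt0.
  exists (Num.truncn (e / 2)^-1).
  by rewrite invf_plt ?posrE// truncnS_gt.
have /choice[a Ha] i : exists q : rat, `|x 0 i - ratr q| < n.+1%:R^-1.
  have [q] := @rat_in_itvoo R (x 0 i - n.+1%:R^-1) (x 0 i + n.+1%:R^-1)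
     ltac:(by rewrite ltrD2l -subr_gt0 opprK addr_gt0).
  by rewrite in_itv/= => qx; exists q; rewrite distrC ltr_distl.
exists (\row_i a i, n); last by move=> i /=; rewrite mxE.
move=> y /= Hy; apply: eU; rewrite -ball_normE /=.
apply: (@le_lt_trans _ _ (n.+1%:R^-1 + n.+1%:R^-1)); last first.
  by rewrite [e]splitr ltrD.
apply: le_normr_rV => [|i]; first by rewrite addr_ge0.
have := Hy i; rewrite !mxE => Hyi; rewrite -[x 0 i - _](subrKA (ratr (a i))).
by rewrite (le_trans (ler_normD _ _))// lerD// ltW// distrC.
Qed.

Lemma measurable_continuous f : continuous f -> measurable_fun setT f.
Proof.
move=> /continuousP cf; apply: (measurability _ (RGenOInfty.measurableE R)).
move=> _ [_ [r ->] <-]; rewrite setTI; apply: measurable_open.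
exact: (cf _ (interval_open _ _)).
Qed.

Lemma loc_integrableP f : loc_integrable f <->
  measurable_fun setT f /\ forall n : nat, itg mu (fun x => f x * \1_(cube n%:R) x).
Proof.
have H (K : set E) : (\int[mu]_(x in K) `|f x|%:E =
            \int[mu]_x `|(f x * \1_K x)%:E|)%E.
  rewrite integral_mkcond; apply: eq_integral => x _.
  by rewrite patchE indicE; case: ifP => _; rewrite ?mulr1//= mulr0 normr0.
split=> -[mf If]; split=> //.
  move=> n; apply/integrableP; split.
    apply/measurable_EFinP/measurable_funM => //.
    by apply: measurable_indic; exact: measurable_cube.
  by rewrite -H; apply: If; exact: compact_cube.
move=> K cK; have [n Kn] := compact_sub_cube cK.
have mK : measurable K.
  rewrite -[K]setCK; apply: measurableC; apply: measurable_open.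
  by apply: closed_openC; apply: compact_closed => //; exact: norm_hausdorff.
have /integrableP[_] := If n; rewrite -H; apply: le_lt_trans.
apply: ge0_subset_integral => //; first exact: measurable_cube.
by apply/measurable_EFinP/measurable_funTS; exact: measurableT_comp.
Qed.

End cubes.

(** * Continuity of translations in L1 *)

Section translation_continuity.
Context {R : realType} {p : nat}.
Notation E := 'rV[R]_p.
Notation mu := (@lebesgue_rV R p).
Implicit Types (f g : E -> R) (x : E).

Variable z : nat -> E.
Hypothesis z0 : z n @[n --> \oo] --> (0 : E).

Let M : exists M : R, forall n, cube M (z n).
Proof.
have /cvg_ex : exists l, z n @[n --> \oo] --> (l : E) by exists 0.
move=> /cvg_seq_bounded[M [_ MP]]; exists (M + 1) => n i.
apply: le_trans (normr_coord _ _) _.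
by apply: MP => //; rewrite ltrDl.
Qed.

Lemma null_hyperplane (i : 'I_p) (c : R) : {ae mu, forall x, x 0 i != c}.
Proof.
pose A (j : 'I_p) : set (measurableTypeR R) := if j == i then [set c] else setT.
have mA j : measurable (A j) by rewrite /A; case: eqP => _.
exists [set x : E | forall j, A j (x 0 j)]; split.
- rewrite [X in measurable X](_ : _ = \bigcap_(j in [set: 'I_p])
     ((fun x : E => x 0 j) @^-1` (A j))).
    apply: fin_bigcap_measurable => // j _.
    rewrite -[X in measurable X]setTI; apply: (measurable_coord j measurableT).
    exact: mA.
  by apply/seteqP; split => [x /= H j _|x /= H j]; [exact: H|exact: (H j I)].
- rewrite lebesgue_rV_box// (bigD1 i)//= /A eqxx.
  by rewrite lebesgue_measure_set1 mul0e.
- move=> x /= /negP; rewrite negbK => /eqP xc j.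
  by rewrite /A; case: eqP => // ->.
Qed.

(* The sets whose truncated indicator is continuous under translation in L1 are
   shown to form a sigma-algebra; half-spaces belong to it because almost no point
   lies on a given hyperplane. *)
Definition translation_cvg f := itg mu f /\
  rint mu (fun x => `|f (x + z n) - f x|) @[n --> \oo] --> 0.

Let itg_diff f n : itg mu f -> itg mu (fun x => `|f (x + z n) - f x|).
Proof. by move=> f1; apply/itg_norm/itgB => //; exact: itg_shift. Qed.

Lemma cvg0_le (u v : nat -> R) : (forall n, 0 <= u n <= v n) ->
  v n @[n --> \oo] --> (0 : R) -> u n @[n --> \oo] --> (0 : R).
Proof.
move=> uv v0; apply: (@squeeze_cvgr _ _ _ _ (fun=> 0) v) => //.
  exact: nearW.
exact: cvg_cst.
Qed.

Lemma translation_cvgD f g : translation_cvg f -> translation_cvg g ->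
  translation_cvg (fun x => f x + g x).
Proof.
move=> [f1 cf] [g1 cg]; split; first exact: itgD.
apply: (cvg0_le (v := fun n => rint mu (fun x => `|f (x + z n) - f x|) +
   rint mu (fun x => `|g (x + z n) - g x|))); last first.
  by rewrite -[X in _ --> X]addr0; exact: cvgD.
move=> n; apply/andP; split; first exact: rint_ge0.
rewrite -rintD; [|exact: itg_diff..].
apply: rint_le => [||x]; first by apply: itg_diff; exact: itgD.
  by apply: itgD; exact: itg_diff.
by rewrite (_ : _ - _ = (f (x + z n) - f x) + (g (x + z n) - g x)) ?ler_normD//; ring.
Qed.

Lemma translation_cvgZ k f : translation_cvg f ->
  translation_cvg (fun x => k * f x).
Proof.
move=> [f1 cf]; split; first exact: itgZ.
rewrite (_ : (fun n => _) =
    fun n => `|k| * rint mu (fun x => `|f (x + z n) - f x|)); last first.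
  apply/funext => n; rewrite -rintZ; last exact: itg_diff.
  by apply: eq_rint => x; rewrite -mulrBr normrM.
by rewrite -[X in _ --> X](mulr0 `|k|); apply: cvgM => //; exact: cvg_cst.
Qed.

Lemma translation_cvgM f g : (forall x, `|f x| <= 1) -> (forall x, `|g x| <= 1) ->
  translation_cvg f -> translation_cvg g -> translation_cvg (fun x => f x * g x).
Proof.
move=> f_le g_le [f1 cf] [g1 cg].
have fg1 : itg mu (fun x => f x * g x).
  by apply: (itg_bounded f1) g_le; exact: itg_measurable g1.
split => //.
apply: (cvg0_le (v := fun n => rint mu (fun x => `|f (x + z n) - f x|) +
   rint mu (fun x => `|g (x + z n) - g x|))); last first.
  by rewrite -[X in _ --> X]addr0; exact: cvgD.
move=> n; apply/andP; split; first exact: rint_ge0.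
rewrite -rintD; [|exact: itg_diff..].
apply: rint_le => [||x]; first by exact: itg_diff fg1.
  by apply: itgD; exact: itg_diff.
rewrite (_ : _ - _ = (f (x + z n) - f x) * g (x + z n) +
  f x * (g (x + z n) - g x)); last by ring.
rewrite (le_trans (ler_normD _ _))// !normrM lerD//.
  by rewrite ler_piMr.
by rewrite ler_piMl.
Qed.

Lemma translation_cvg_lim (F : nat -> E -> R) f : itg mu f ->
  (forall k, translation_cvg (F k)) ->
  rint mu (fun x => `|F k x - f x|) @[k --> \oo] --> 0 -> translation_cvg f.
Proof.
move=> f1 cF Ff; split => //.
apply/cvgr0Pnorm_lt => e e0.
have e3 : 0 < e / 3 by rewrite divr_gt0.
have [k Hk] : exists k, rint mu (fun x => `|F k x - f x|) < e / 3.
  have /cvgr0Pnorm_lt/(_ _ e3)[k _ /(_ k (leqnn k))] := Ff.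
  by exists k; rewrite (le_lt_trans (ler_norm _)).
have [Fk1 cFk] := cF k.
near=> n.
have Hn : rint mu (fun x => `|F k (x + z n) - F k x|) < e / 3.
  rewrite (le_lt_trans (ler_norm _))//; near: n.
  by apply: cvgr0_norm_lt.
have Dk : itg mu (fun x => `|F k x - f x|) by apply/itg_norm/itgB.
have Dkz : itg mu (fun x => `|F k (x + z n) - f (x + z n)|).
  exact: (itg_shift (z n) Dk).
rewrite ger0_norm ?rint_ge0//.
apply: (@le_lt_trans _ _ (rint mu (fun x => `|F k (x + z n) - f (x + z n)| +
   (`|F k (x + z n) - F k x| + `|F k x - f x|)))).
  apply: rint_le => [||x]; first exact: itg_diff.
    by apply: itgD => //; apply: itgD => //; exact: itg_diff.
  rewrite (_ : f (x + z n) - f x = - (F k (x + z n) - f (x + z n)) +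
    ((F k (x + z n) - F k x) + (F k x - f x))); last by ring.
  rewrite (le_trans (ler_normD _ _))// normrN lerD2l.
  exact: ler_normD.
rewrite rintD//; last by apply: itgD => //; exact: itg_diff.
rewrite rintD//; last exact: itg_diff.
rewrite (rint_shift (z n) (f := fun x => `|F k x - f x|)); last first.
  exact: itg_measurable Dk.
by rewrite (_ : e = e / 3 + (e / 3 + e / 3)); [rewrite !ltrD|field].
Unshelve. all: by end_near. Qed.

Lemma translation_cvg_pointwise f g : itg mu f -> itg mu g ->
  (forall n x, `|f (x + z n)| <= g x) ->
  {ae mu, forall x, f (x + z n) @[n --> \oo] --> f x} -> translation_cvg f.
Proof.
move=> f1 g1 fg cf; split=> //.
have [] := @rint_dct _ _ _ mu (fun n x => `|f (x + z n) - f x|) (fun=> 0)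
  (fun x => g x + `|f x|).
- by move=> n; apply: itg_measurable; exact: itg_diff.
- exact: measurable_cst.
- by apply: itgD => //; exact: itg_norm.
- by move=> n x; rewrite normr_id (le_trans (ler_normB _ _))// lerD2r.
- apply: filterS cf => x cx; apply/norm_cvg0P.
  by rewrite -(subrr (f x)); apply: cvgB => //; exact: cvg_cst.
by move=> _; rewrite rint0.
Qed.

Section sets.
Variable r : R.

Let D : set (set E) :=
  [set A | measurable A /\ translation_cvg (\1_(A `&` cube r) : E -> R)].

Let indic_le1 A x : `|\1_A x| <= 1 :> R.
Proof. by rewrite indicE; case: (_ \in _); rewrite ?normr1 ?normr0. Qed.

Let ev (A : set E) :=
  {ae mu, forall x, \forall n \near \oo, (x + z n \in A) = (x \in A)}.

Let cz j x : (x + z n) 0 j @[n --> \oo] --> x 0 j.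
Proof.
rewrite -[X in _ --> X]addr0; under eq_fun do rewrite mxE.
apply: cvgD; first exact: cvg_cst.
have -> : 0 = (0 : E) 0 j by rewrite mxE.
apply: (@cvg_comp _ _ _ z (fun w : E => w 0 j) _ (nbhs (0 : E))) => //.
exact: coord_continuous.
Qed.

Let ev_half i (a : R) : ev ((fun x => x 0 i) @^-1` `]a, +oo[).
Proof.
apply: filterS (null_hyperplane i a) => x xa.
have [xia|xia] := boolP (a < x 0 i).
  have K1 : \forall n \near \oo, a < (x + z n) 0 i.
    by apply: cvgr_gt; [exact: cz|exact: xia].
  by apply: filterS K1 => n a1; rewrite !mem_set//= in_itv/= andbT.
have K1 : \forall n \near \oo, (x + z n) 0 i < a.
  apply: cvgr_lt; first exact: cz.
  by rewrite lt_neqAle xa leNgt.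
apply: filterS K1 => n a1; rewrite !memNset//= in_itv/= andbT.
  by move=> a2; have := lt_trans a1 a2; rewrite ltxx.
exact/negP.
Qed.

Let ev_cube : ev (cube r).
Proof.
have H2 : {ae mu, forall x : E, forall j, x 0 j != r}.
  by apply: filter_forall => j; exact: null_hyperplane.
have H3 : {ae mu, forall x : E, forall j, x 0 j != - r}.
  by apply: filter_forall => j; exact: null_hyperplane.
apply: filterS2 H2 H3 => x xr xr'.
have [xc|xc] := pselect (cube r x).
  have K2 : \forall n \near \oo, forall j, `|(x + z n) 0 j| < r.
    apply: filter_forall => j; apply: cvgr_norm_lt; first exact: cz.
    rewrite lt_neqAle xc andbT; apply/negP => /eqP xjr.
    have [x0|x0] := leP 0 (x 0 j).
      by have := xr j; rewrite -xjr ger0_norm// eqxx.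
    by have := xr' j; rewrite -xjr ltr0_norm// opprK eqxx.
  by apply: filterS K2 => n a2; rewrite !mem_set//= => j; exact: ltW.
have /existsNP[j /negP xj] := xc.
have K1 : \forall n \near \oo, r < `|(x + z n) 0 j|.
  by apply: cvgr_norm_gt; [exact: cz|rewrite ltNge].
by apply: filterS K1 => n a1; rewrite !memNset//= => /(_ j); rewrite leNgt a1.
Qed.

Let D_ev A : measurable A -> ev A -> D A.
Proof.
move=> mA evA.
split => //; have [m Hm] := M.
have mAc : measurable (A `&` cube r).
  by apply: measurableI => //; exact: measurable_cube.
apply: (@translation_cvg_pointwise _ (\1_(cube (r + m)))).
- apply: itg_le (itg_cube r); first exact: measurable_indic.
  move=> x; rewrite !indicE; case: (boolP (x \in _)) => [|_]; last by rewrite normr0.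
  by rewrite in_setI => /andP[_ ->]; rewrite normr1.
- exact: itg_cube.
- move=> n x; rewrite !indicE; case: (boolP (x + z n \in _)) => [|_]; last by rewrite normr0.
  rewrite inE => -[_ xc]; rewrite mem_set ?normr1// -(addrK (z n) x).
  by apply: cubeD => //; exact: cubeN.
have h2 := ev_cube; rewrite /ev in evA h2.
apply: filterS2 evA h2 => x h1 h2; apply: cvg_near_cst.
by apply: filterS2 h1 h2 => n h1 h2; rewrite !indicE !in_setI h1 h2.
Qed.

Let DC A : D A -> D (~` A).
Proof.
move=> [mA cA]; split; first exact: measurableC.
have [_ cT] : D setT by apply: D_ev => //; apply: aeW => x; exact: nearW.
rewrite (_ : \1_(~` A `&` cube r) =
  (fun x => \1_(setT `&` cube r) x + -1 * \1_(A `&` cube r) x) :> (E -> R)).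
  by apply: translation_cvgD => //; exact: translation_cvgZ.
apply/funext => x; rewrite !indicE !in_setI in_setC in_setT/=.
by case: (x \in A); case: (x \in cube r) => /=; ring.
Qed.

Let DI A B : D A -> D B -> D (A `&` B).
Proof.
move=> [mA cA] [mB cB]; split; first exact: measurableI.
rewrite (_ : \1_(A `&` B `&` cube r) =
  (fun x => \1_(A `&` cube r) x * \1_(B `&` cube r) x) :> (E -> R)).
  by apply: translation_cvgM.
apply/funext => x; rewrite !indicE !in_setI.
by case: (x \in A); case: (x \in B); case: (x \in cube r) => /=; ring.
Qed.

Let D_bigcup (F : (set E)^nat) : (forall i, D (F i)) -> D (\bigcup_i F i).
Proof.
move=> DF; have mF : measurable (\bigcup_i F i).
  by apply: bigcupT_measurable => i; have [] := DF i.
split => //.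
pose G n : set E := \bigcap_(i < n) ~` F i.
have DG n : D (~` G n).
  apply: DC; elim: n => [|n IH].
    rewrite /G bigcap_mkord big_ord0.
    by apply: D_ev => //; apply: aeW => x; exact: nearW.
  rewrite (_ : G n.+1 = G n `&` ~` F n); first by apply: DI => //; exact: DC.
  apply/seteqP; split => [x Gx|x [Gx Fx] i /=]; first by split => [i /= ni|]; apply: Gx => //=; exact: ltnW.
  by rewrite ltnS leq_eqVlt => /orP[/eqP ->//|]; exact: Gx.
have mFc : measurable_fun setT (\1_(\bigcup_i F i `&` cube r) : E -> R).
  by apply: measurable_indic; apply: measurableI => //; exact: measurable_cube.
have mGc n : measurable_fun setT (\1_(~` G n `&` cube r) : E -> R).
  apply: measurable_indic; apply: measurableI; last exact: measurable_cube.
  by have [] := DG n.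
apply: (@translation_cvg_lim (fun n => \1_(~` G n `&` cube r))).
- apply: itg_le (itg_cube r) => // x; rewrite !indicE in_setI.
  by case: (x \in _); case: (x \in cube r); rewrite /= ?normr0 ?normr1.
- by move=> n; have [] := DG n.
have [] := @rint_dct _ _ _ mu
  (fun n x => `|\1_(~` G n `&` cube r) x - \1_(\bigcup_i F i `&` cube r) x|)
  (fun=> 0) (\1_(cube r)).
- by move=> n; apply: measurableT_comp => //; exact: measurable_funB.
- exact: measurable_cst.
- exact: itg_cube.
- move=> n x; rewrite normr_id !indicE !in_setI.
  by case: (x \in ~` _); case: (x \in \bigcup_i _); case: (x \in cube r); rewrite /= ?subr0 ?sub0r ?normrN ?subrr ?normr0 ?normr1//.
- apply: aeW => x; have [[i _ Fx]|nF] := pselect ((\bigcup_i F i) x).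
    apply: cvg_near_cst; exists i.+1 => // n /= ni.
    rewrite !indicE !in_setI (mem_set (A := \bigcup_i F i)); last by exists i.
    by rewrite (mem_set (A := ~` G n)) ?subrr ?normr0// => /(_ i ni).
  apply: cvg_near_cst; apply: nearW => n.
  rewrite !indicE !in_setI (memNset (A := \bigcup_i F i))//.
  rewrite (memNset (A := ~` G n)) ?subrr ?normr0//= => H.
  by apply: H => i ni Fi; apply: nF; exists i.
by move=> _; rewrite rint0.
Qed.

Lemma translation_cvg_indic (A : set E) : measurable A ->
  translation_cvg (\1_(A `&` cube r) : E -> R).
Proof.
move=> mA; suff [//] : D A.
apply: (smallest_sub _ _ mA) => [|B].
  split => /=.
  - rewrite -setCT; apply: DC; apply: D_ev => //; apply: aeW => x; exact: nearW.
  - by move=> B DB; rewrite setTD; exact: DC.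
  - exact: D_bigcup.
rewrite -bigcup_seq => -[i _ [C mC <-]] /=; rewrite setTI.
suff : [set C | D ((fun x : E => x 0 i) @^-1` C)] C by [].
have mC' : (@RGenOInfty.G R).-sigma.-measurable C by rewrite -RGenOInfty.measurableE.
apply: (smallest_sub _ _ mC') => [|_ [a ->]/=].
  split => /=.
  - rewrite preimage_set0 -setCT; apply: DC; apply: D_ev => //.
    by apply: aeW => x; exact: nearW.
  - by move=> ? DB; rewrite setTD preimage_setC; exact: DC.
  - by move=> F DF; rewrite preimage_bigcup; exact: D_bigcup.
apply: D_ev (ev_half i a).
by rewrite -[X in measurable X]setTI; exact: (measurable_coord i measurableT).
Qed.

End sets.

Import HBSimple.

Let translation_cvg_sfun (r : R) (h : {sfun E >-> R}) :
  translation_cvg (fun x => h x * \1_(cube r) x).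
Proof.
have -> : (fun x => h x * \1_(cube r) x) =
  (fun x => \sum_(y <- finmap.enum_fset (fset_set (range h))) y * \1_(h @^-1` [set y] `&` cube r) x).
  apply/funext => x; rewrite {1}fimfunE fsbig_finite//= mulr_suml.
  apply: eq_bigr => y _; rewrite !indicE in_setI -mulrA; congr (_ * _).
  by case: (_ \in _) => /=; rewrite ?mul1r ?mul0r.
elim: (finmap.enum_fset _) => [|y s IH].
  under eq_fun do rewrite big_nil.
  split; first exact: itg0.
  under eq_fun do under eq_Rintegral do rewrite subrr normr0.
  by under eq_fun do rewrite rint0; exact: cvg_cst.
under eq_fun do rewrite big_cons.
apply: translation_cvgD => //; apply: translation_cvgZ.
exact: translation_cvg_indic.
Qed.

Lemma translation_continuity f : itg mu f ->
  rint mu (fun x => `|f (x + z n) - f x|) @[n --> \oo] --> 0.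
Proof.
move=> f1; have mf := itg_measurable f1.
have mc r : measurable_fun setT (\1_(cube r) : E -> R).
  by apply: measurable_indic; exact: measurable_cube.
have mfc r : itg mu (fun x => f x * \1_(cube r) x).
  by apply: (itg_bounded (C := 1) f1) => // x; rewrite indicE; case: (_ \in _); rewrite ?normr1 ?normr0.
suff [//] : translation_cvg f.
apply: (@translation_cvg_lim (fun n x => f x * \1_(cube n%:R) x)) => //; last first.
  have [] := @rint_dct _ _ _ mu (fun n x => `|f x * \1_(cube n%:R) x - f x|)
     (fun=> 0) (fun x => `|f x|).
  - by move=> n; apply: measurableT_comp => //; apply: measurable_funB => //;
      apply: measurable_funM.
  - exact: measurable_cst.
  - exact: itg_norm.
  - move=> n x; rewrite normr_id indicE; case: (_ \in _) => /=.
      by rewrite mulr1 subrr normr0.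
    by rewrite mulr0 sub0r normrN.
  - apply: aeW => x; apply: cvg_near_cst.
    exists (Num.truncn `|x|).+1 => // n /= ni; rewrite indicE mem_set ?mulr1 ?subrr ?normr0//.
    apply: (le_cube _ (@cube_normr _ _ x)).
    by rewrite (le_trans (ltW (truncnS_gt _)))// ler_nat.
  by move=> _; rewrite rint0.
move=> k.
have [h [h1 _ hf]] := approximation_sfun_integrable (measurable_cube k%:R)
  (integrableS measurableT (measurable_cube k%:R) (@subsetT _ _) f1).
apply: (@translation_cvg_lim (fun n x => h n x * \1_(cube k%:R) x)) => //.
have -> : (fun n => rint mu (fun x =>
     `|h n x * \1_(cube k%:R) x - f x * \1_(cube k%:R) x|)) =
  (fun n => fine (\int[mu]_(x in cube k%:R) `|(f x)%:E - (h n x)%:E|)%E).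
  apply/funext => n; rewrite /Rintegral [in RHS]integral_mkcond; congr fine.
  apply: eq_integral => x _; rewrite patchE indicE; case: (_ \in _) => /=.
    by rewrite !mulr1 distrC.
  by rewrite !mulr0 subrr normr0.
by apply: fine_cvg; exact: hf.
Qed.

End translation_continuity.

(** * Smooth functions of one variable *)

Section smooth_1d.
Context {R : realType}.
Implicit Types f g : R -> R.

Fixpoint C1 (k : nat) f : Prop :=
  continuous f /\
  match k with
  | 0 => True
  | k'.+1 => (forall x, derivable f x 1) /\ C1 k' (derive1 f)
  end.

Definition smooth f := forall k, C1 k f.

Lemma derive1_is_derive f (df : R -> R) :
  (forall x : R, is_derive x (1 : R) f (df x)) -> (derive1 f) = df.
Proof. by move=> H; apply/funext => x; rewrite derive1E derive_val. Qed.

Lemma is_derive_continuous f (df : R -> R) :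
  (forall x : R, is_derive x (1 : R) f (df x)) -> continuous f.
Proof.
move=> H x; apply: differentiable_continuous; apply/derivable1_diffP.
by have [] := H x.
Qed.

Lemma C1_intro k f (df : R -> R) :
  (forall x : R, is_derive x (1 : R) f (df x)) -> C1 k df -> C1 k.+1 f.
Proof.
move=> H Cdf; split; first exact: is_derive_continuous H.
by split=> [x|]; [have [] := H x|rewrite (derive1_is_derive H)].
Qed.

Lemma C1_continuous k f : C1 k f -> continuous f.
Proof. by case: k => [|k] []. Qed.

Lemma C1S k f : C1 k.+1 f -> C1 k f.
Proof.
elim: k f => [|k IH] f; first by case.
by move=> [cf [df]] H; split => //; split => //; exact: IH.
Qed.

Lemma C1_is_derive k f x : C1 k.+1 f -> is_derive x (1 : R) f ((derive1 f) x).
Proof. by move=> [_ [df _]]; rewrite derive1E; exact: derivableP. Qed.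

Lemma C1_cst k (c : R) : C1 k (fun=> c).
Proof.
elim: k c => [|k IH] c; first by split => //; exact: cst_continuous.
by apply: (@C1_intro _ _ (fun=> 0)).
Qed.

Lemma C1D k f g : C1 k f -> C1 k g -> C1 k (fun x => f x + g x).
Proof.
elim: k f g => [|k IH] f g Cf Cg.
  by split => // x; apply: continuousD; [exact: (C1_continuous Cf)|exact: (C1_continuous Cg)].
apply: (@C1_intro _ _ (fun x => (derive1 f) x + (derive1 g) x)).
  move=> x; have Df := C1_is_derive x Cf; have Dg := C1_is_derive x Cg.
  exact: (is_deriveD Df Dg).
by apply: IH; [case: Cf => _ []|case: Cg => _ []].
Qed.

Lemma C1M k f g : C1 k f -> C1 k g -> C1 k (fun x => f x * g x).
Proof.
elim: k f g => [|k IH] f g Cf Cg.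
  by split => // x; apply: continuousM; [exact: (C1_continuous Cf)|exact: (C1_continuous Cg)].
apply: (@C1_intro _ _ (fun x => f x * (derive1 g) x + g x * (derive1 f) x)).
  move=> x; have Df := C1_is_derive x Cf; have Dg := C1_is_derive x Cg.
  exact: (is_deriveM Df Dg).
by apply: C1D; apply: IH; [exact: C1S|case: Cg => _ []|exact: C1S|case: Cf => _ []].
Qed.

Lemma C1_affine k f (a b : R) : C1 k f -> C1 k (fun x => f (a * x + b)).
Proof.
elim: k f => [|k IH] f Cf.
  split => // x; apply: continuous_comp; last exact: (C1_continuous Cf).
  by apply: continuousD; [apply: continuousM; [exact: cst_continuous|]|exact: cst_continuous].
apply: (@C1_intro _ _ (fun x => a * (derive1 f) (a * x + b))).
  move=> x; have Da : is_derive x (1 : R) (fun x => a * x + b) a.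
    have D1 := is_deriveZ a (is_derive_id x (1 : R)).
    have := is_deriveD D1 (is_derive_cst b x (1 : R)).
    by rewrite addr0 /GRing.scale/= mulr1.
  have Df := C1_is_derive (a * x + b) Cf.
  rewrite mulrC.
  exact: (@is_derive1_comp _ f (fun x => a * x + b) x _ _ Df Da).
by apply: C1M; [exact: C1_cst|apply: IH; case: Cf => _ []].
Qed.

Lemma smooth_expR : smooth expR.
Proof.
elim=> [|k IH]; first by split => //; exact: continuous_expR.
by apply: (@C1_intro _ _ expR).
Qed.

Lemma smooth_derive f : smooth f -> smooth (derive1 f).
Proof. by move=> sf k; case: (sf k.+1) => _ []. Qed.

(* The powers of [t^-1] make the family closed under derivation. *)
Definition flat (k : nat) (t : R) : R :=
  if 0 < t then t ^- k * expR (- t^-1) else 0.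

Lemma flat_ge0 k t : 0 <= flat k t.
Proof.
rewrite /flat; case: ifPn => // t0.
by rewrite mulr_ge0// ?expR_ge0// invr_ge0 exprn_ge0// ltW.
Qed.

Lemma flat_gt0 k t : 0 < t -> 0 < flat k t.
Proof.
by move=> t0; rewrite /flat t0 mulr_gt0// ?expR_gt0// invr_gt0 exprn_gt0.
Qed.

Lemma flat_le0 k t : t <= 0 -> flat k t = 0.
Proof. by rewrite /flat ltNge => ->. Qed.

Lemma flat_le_sqr k t : flat k t <= (k.+2)`!%:R * t ^+ 2.
Proof.
rewrite /flat; case: ifPn => [t0|_]; last by rewrite mulr_ge0// sqr_ge0.
rewrite expRN -lter_pdivlMr ?invr_gt0 ?expR_gt0// invrK.
have ti0 : 0 <= t^-1 by rewrite invr_ge0 ltW.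
have := expR_ge1Dxn k.+1 ti0.
rewrite -exprVn => H.
have H2 : t^-1 ^+ k.+2 / k.+2`!%:R <= expR t^-1 by apply: le_trans H; rewrite lerDr.
have f0 : 0 < k.+2`!%:R :> R by rewrite ltr0n fact_gt0.
have -> : t^-1 ^+ k = k.+2`!%:R * t ^+ 2 * (t^-1 ^+ k.+2 / k.+2`!%:R).
  by rewrite !exprS; field; rewrite gt_eqF//= gt_eqF.
by rewrite ler_pM2l// mulr_gt0// exprn_gt0.
Qed.

Lemma is_derive_flat k (t : R) :
  is_derive t (1 : R) (flat k) (flat k.+2 t - k%:R * flat k.+1 t).
Proof.
have [t0|t0|->] := ltrgtP t 0.
- rewrite !flat_le0 ?ltW// mulr0 subr0.
  apply: (@near_eq_is_derive _ _ _ (cst 0)).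
  by near=> u; rewrite flat_le0// ltW//; near: u; exact: lt_nbhsl.
- have tn0 : t != 0 by rewrite gt_eqF.
  have D1 : is_derive t (1 : R) (fun u : R => u^-1) (- t ^- 2).
    have := is_deriveV tn0 (is_derive_id t (1 : R)).
    by rewrite /GRing.scale/= mulr1.
  have D2 : is_derive t (1 : R) (fun u : R => expR (- u^-1)) (expR (- t^-1) * t ^- 2).
    have D3 : is_derive t (1 : R) (fun u : R => - u^-1) (t ^- 2).
      by have := is_deriveN D1; rewrite opprK.
    exact: (@is_derive1_comp _ expR (fun u => - u^-1) t _ _ (is_derive_expR _) D3).
  have D4 : is_derive t (1 : R) (fun u : R => u^-1 ^+ k) (- (k%:R * t ^- k.+1)).
    have := is_deriveX k D1; rewrite exprfctE => D5; apply: (is_derive_eq D5).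
    rewrite /GRing.scale/=; case: (k) => [|j]; first by rewrite !mul0r oppr0.
    by rewrite /= mulrN -mulrA -!exprVn -exprD addn2.
  have H : is_derive t (1 : R) (fun u : R => u^-1 ^+ k * expR (- u^-1))
      (flat k.+2 t - k%:R * flat k.+1 t).
    apply: (is_derive_eq (is_deriveM D4 D2)).
    by rewrite /flat t0 /GRing.scale/= -!exprVn !exprS; ring.
  apply: near_eq_is_derive H.
  by near=> u; rewrite /flat ifT ?exprVn//; near: u; exact: lt_nbhsr.
rewrite !flat_le0// mulr0 subr0.
have H : h^-1 *: (flat k (h *: 1 + 0) - flat k 0) @[h --> (0 : R)^'] --> (0 : R).
  rewrite flat_le0//.
  have K : k.+2`!%:R * `|h| @[h --> (0 : R)^'] --> (0 : R).
    rewrite -[X in _ --> X](mulr0 (k.+2`!%:R : R)).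
    apply: cvgM; first exact: cvg_cst.
    rewrite -[X in _ --> X](normr0 R).
    by apply: cvg_norm; exact: cvg_within.
  apply: (@squeeze_cvgr _ _ _ _ (fun h => - (k.+2`!%:R * `|h|)) (fun h => k.+2`!%:R * `|h|)).
  - near=> h; rewrite -ler_norml subr0 addr0 /GRing.scale/= mulr1 normrM normfV.
    have h0 : h != 0 by near: h; exact: nbhs_dnbhs_neq.
    rewrite (ger0_norm (flat_ge0 _ _)) mulrC ler_pdivrMr ?normr_gt0//.
    by rewrite -mulrA -expr2 real_normK ?num_real// flat_le_sqr.
  - by rewrite -[X in _ --> X]oppr0; exact: cvgN.
  - exact: K.
split; first by apply/cvg_ex; exists 0.
exact: cvg_lim H.
Unshelve. all: by end_near. Qed.

Lemma smooth_flat k : smooth (flat k).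
Proof.
move=> n; elim: n k => [|n IH] k.
  by split => //; apply: is_derive_continuous; exact: is_derive_flat.
apply: (C1_intro (is_derive_flat k)); apply: C1D => //.
rewrite (_ : (fun x => _) = (fun x => - k%:R * flat k.+1 x)); last by apply/funext => x; rewrite mulNr.
by apply: C1M; [exact: C1_cst|exact: IH].
Qed.

End smooth_1d.

(** * Test functions *)

Section smooth_rV.
Context {R : realType} {p : nat}.
Notation E := 'rV[R]_p.
Notation mu := (@lebesgue_rV R p).
Implicit Types (phi psi : E -> R) (x v a : E).

Lemma is_derive_lineP (V : normedModType R) (phi : V -> R) (x v : V) (l : R) :
  is_derive x v phi l <-> is_derive (0 : R) (1 : R) (fun t : R => phi (t *: v + x)) l.
Proof.
have H : (fun h : R => h^-1 *: ((phi \o shift x) (h *: v) - phi x)) =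
   (fun h : R => h^-1 *: (((fun t : R => phi (t *: v + x)) \o shift (0 : R)) (h *: (1 : R)) -
       phi ((0 : R) *: v + x))).
  by apply/funext => h /=; rewrite scale0r add0r addr0 /GRing.scale/= mulr1.
by split=> -[d1 d2]; split; move: d1 d2; rewrite /derivable /derive H.
Qed.

Lemma is_derive_comp_rV (f : R -> R) phi x v (df dphi : R) :
  is_derive (phi x) (1 : R) f df -> is_derive x v phi dphi ->
  is_derive x v (fun y => f (phi y)) (df * dphi).
Proof.
move=> Df /is_derive_lineP Dphi; apply/is_derive_lineP.
apply: (@is_derive1_comp _ f (fun t => phi (t *: v + x)) 0 _ _ _ Dphi).
by rewrite scale0r add0r.
Qed.

Lemma Ck_intro k phi (d : 'I_p -> E -> R) : continuous phi ->
  (forall i x, is_derive x (delta_mx 0 i : E) phi (d i x)) ->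
  (forall i, Ck k (d i)) -> Ck k.+1 phi.
Proof.
move=> cphi Dphi Cd; split => // i; split => [x|]; first by have [] := Dphi i x.
rewrite (_ : partial i phi = d i)//; apply/funext => x.
by have [_ <-] := Dphi i x.
Qed.

Lemma Ck_continuous k phi : Ck k phi -> continuous phi.
Proof. by case: k => [|k] []. Qed.

Lemma CkS k phi : Ck k.+1 phi -> Ck k phi.
Proof.
elim: k phi => [|k IH] phi; first by case.
by move=> [cf H]; split => // i; have [? ?] := H i; split => //; exact: IH.
Qed.

Lemma Ck_is_derive k phi i x : Ck k.+1 phi ->
  is_derive x (delta_mx 0 i : E) phi (partial i phi x).
Proof. by move=> [_ /(_ i)[df _]]; exact: derivableP. Qed.

Lemma Ck_partial k phi i : Ck k.+1 phi -> Ck k (partial i phi).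
Proof. by move=> [_ /(_ i)[]]. Qed.

Lemma Ck_cst k (c : R) : Ck k (fun _ : E => c).
Proof.
elim: k c => [|k IH] c; first by split => //; exact: cst_continuous.
by apply: (@Ck_intro _ _ (fun _ _ => 0)) => //; exact: cst_continuous.
Qed.

Lemma CkD k phi psi : Ck k phi -> Ck k psi -> Ck k (fun x => phi x + psi x).
Proof.
elim: k phi psi => [|k IH] f g Cf Cg.
  by split => // x; apply: continuousD; [exact: (Ck_continuous Cf)|exact: (Ck_continuous Cg)].
apply: (@Ck_intro _ _ (fun i x => partial i f x + partial i g x)).
- by move=> x; apply: continuousD; [exact: (Ck_continuous Cf)|exact: (Ck_continuous Cg)].
- move=> i x; exact: (is_deriveD (Ck_is_derive i x Cf) (Ck_is_derive i x Cg)).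
- by move=> i; apply: IH; exact: Ck_partial.
Qed.

Lemma CkM k phi psi : Ck k phi -> Ck k psi -> Ck k (fun x => phi x * psi x).
Proof.
elim: k phi psi => [|k IH] f g Cf Cg.
  by split => // x; apply: continuousM; [exact: (Ck_continuous Cf)|exact: (Ck_continuous Cg)].
apply: (@Ck_intro _ _ (fun i x => f x * partial i g x + g x * partial i f x)).
- by move=> x; apply: continuousM; [exact: (Ck_continuous Cf)|exact: (Ck_continuous Cg)].
- move=> i x; exact: (is_deriveM (Ck_is_derive i x Cf) (Ck_is_derive i x Cg)).
- by move=> i; apply: CkD; apply: IH; (exact: Ck_partial || exact: CkS).
Qed.

Lemma Ck_sum k (F : 'I_p -> E -> R) : (forall i, Ck k (F i)) ->
  Ck k (fun x => \sum_i F i x).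
Proof.
move=> CF; elim: (index_enum _) => [|i s IH].
  by under eq_fun do rewrite big_nil; exact: Ck_cst.
by under eq_fun do rewrite big_cons; exact: CkD.
Qed.

Lemma Ck_comp k (f : R -> R) phi : C1 k f -> Ck k phi -> Ck k (fun x => f (phi x)).
Proof.
elim: k f => [|k IH] f Cf Cphi.
  split => // x; apply: continuous_comp; first exact: (Ck_continuous Cphi).
  exact: (C1_continuous Cf).
apply: (@Ck_intro _ _ (fun i x => derive1 f (phi x) * partial i phi x)).
- move=> x; apply: continuous_comp; first exact: (Ck_continuous Cphi).
  exact: (C1_continuous Cf).
- move=> i x; apply: is_derive_comp_rV; last exact: Ck_is_derive Cphi.
  exact: C1_is_derive Cf.
- move=> i; apply: CkM; last exact: Ck_partial.
  by apply: IH; [case: Cf => _ []|exact: CkS].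
Qed.

Lemma is_derive_coord (j : 'I_p) x v : is_derive x v (fun y : E => y 0 j) (v 0 j).
Proof.
apply/is_derive_lineP; under eq_fun do rewrite !mxE.
have D := is_deriveD (is_deriveZ (v 0 j) (is_derive_id (0 : R) (1 : R)))
  (is_derive_cst (x 0 j) (0 : R) (1 : R)).
rewrite addr0 /GRing.scale/= mulr1 in D.
by under eq_fun do rewrite mulrC.
Qed.

Lemma Ck_coord k (j : 'I_p) : Ck k (fun x : E => x 0 j).
Proof.
case: k => [|k]; first by split => //; exact: coord_continuous.
apply: (@Ck_intro _ _ (fun i _ => (delta_mx 0 i : E) 0 j)).
- exact: coord_continuous.
- by move=> i x; exact: is_derive_coord.
- by move=> i; exact: Ck_cst.
Qed.

Definition sqd a x : R := sqnorm (x - a).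

Lemma sqdE a x : sqd a x = \sum_i (x 0 i - a 0 i) ^+ 2.
Proof. by apply: eq_bigr => i _; rewrite !mxE expr2. Qed.

Lemma sqd_ge0 a x : 0 <= sqd a x.
Proof. by rewrite sqdE; apply: sumr_ge0 => i _; exact: sqr_ge0. Qed.

Lemma le_sqd a x i : (x 0 i - a 0 i) ^+ 2 <= sqd a x.
Proof.
rewrite sqdE (bigD1 i)//= lerDl; apply: sumr_ge0 => j _; exact: sqr_ge0.
Qed.

Lemma Ck_sqd k a : Ck k (sqd a).
Proof.
rewrite (_ : sqd a = fun x => \sum_i (x 0 i - a 0 i) * (x 0 i - a 0 i)).
  apply: Ck_sum => i; apply: CkM; apply: CkD; (exact: Ck_coord || exact: Ck_cst).
by apply/funext => x; rewrite sqdE; apply: eq_bigr => i _; rewrite expr2.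
Qed.

Lemma is_derive_sqd a x v : is_derive x v (sqd a) (2 * dotV (x - a) v).
Proof.
have D i : is_derive x v (fun y : E => (y 0 i - a 0 i) * (y 0 i - a 0 i))
    (2 * ((x 0 i - a 0 i) * v 0 i)).
  have D1 : is_derive x v (fun y : E => y 0 i - a 0 i) (v 0 i).
    have := is_deriveB (is_derive_coord i x v) (is_derive_cst (a 0 i) x v).
    by rewrite subr0.
  apply: (is_derive_eq (is_deriveM D1 D1)).
  by rewrite /GRing.scale/=; ring.
rewrite (_ : sqd a = \sum_i (fun y : E => (y 0 i - a 0 i) * (y 0 i - a 0 i))).
  apply: (is_derive_eq (is_derive_sum D)).
  by rewrite /dotV mulr_sumr; apply: eq_bigr => i _; rewrite !mxE.
apply/funext => y; rewrite sqdE fct_sumE; apply: eq_bigr => i _.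
by rewrite expr2.
Qed.

Definition radial (F : R -> R) a : E -> R := fun x => F (sqd a x).

Lemma Ck_radial k F a : smooth F -> Ck k (radial F a).
Proof. by move=> sF; apply: Ck_comp; [exact: sF|exact: Ck_sqd]. Qed.

Lemma is_derive_radial F a x v : smooth F ->
  is_derive x v (radial F a) (2 * derive1 F (sqd a x) * dotV (x - a) v).
Proof.
move=> sF; have DF := C1_is_derive (sqd a x) (sF 1%N).
apply: (is_derive_eq (is_derive_comp_rV DF (is_derive_sqd a x v))).
by ring.
Qed.

Lemma dotV_delta (u : E) i : dotV u (delta_mx 0 i) = u 0 i.
Proof.
rewrite /dotV (bigD1 i)//= mxE !eqxx mulr1 big1 ?addr0// => j ji.
by rewrite mxE (negbTE ji) andbF mulr0.
Qed.

Lemma partial_radial F a i x : smooth F ->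
  partial i (radial F a) x = 2 * derive1 F (sqd a x) * (x 0 i - a 0 i).
Proof.
move=> sF; have [_] := is_derive_radial a x (delta_mx 0 i) sF.
by rewrite dotV_delta !mxE.
Qed.

Lemma laplacian_radial F a x : smooth F ->
  laplacian (radial F a) x =
  2 * p%:R * derive1 F (sqd a x) + 4 * sqd a x * derive1 (derive1 F) (sqd a x).
Proof.
move=> sF; have sF1 := smooth_derive sF.
rewrite /laplacian (eq_bigr (fun i => 2 * derive1 F (sqd a x) +
   4 * derive1 (derive1 F) (sqd a x) * (x 0 i - a 0 i) ^+ 2)).
  rewrite big_split/= sumr_const card_ord -mulr_natr -mulr_sumr -sqdE; ring.
move=> i _.
have -> : partial i (radial F a) = (fun y => radial (derive1 F) a y * (2 * (y 0 i - a 0 i))).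
  by apply/funext => y; rewrite partial_radial// /radial; ring.
have D1 := is_derive_radial a x (delta_mx 0 i) sF1.
have D2 : is_derive x (delta_mx 0 i : E) (fun y : E => 2 * (y 0 i - a 0 i)) 2.
  have D3 := is_deriveB (is_derive_coord i x (delta_mx 0 i)) (is_derive_cst (a 0 i) x (delta_mx 0 i : E)).
  apply: (is_derive_eq (is_deriveZ 2 D3)).
  by rewrite mxE !eqxx subr0 /GRing.scale/= mulr1.
have [_] := is_deriveM D1 D2.
rewrite /partial => ->; rewrite dotV_delta !mxE /radial /GRing.scale/=; ring.
Qed.

Lemma test_intro phi (r : R) : (forall k, Ck k phi) ->
  (forall x, phi x != 0 -> cube r x) -> test_function phi.
Proof.
move=> Cphi sphi; split => //.
have cc := @compact_cube R p r.
apply: (subclosed_compact _ cc); first exact: closed_closure.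
have ccl : closed (cube r : set E) by apply: compact_closed => //; exact: norm_hausdorff.
by rewrite [X in _ `<=` X](closure_id _).1//; apply: closureS => x /=; exact: sphi.
Qed.

Lemma test_supp phi : test_function phi -> exists n : nat,
  forall x, closure [set x | phi x != 0] x -> cube n%:R x.
Proof. by move=> [_ /compact_sub_cube]. Qed.

Lemma test_continuous phi : test_function phi -> continuous phi.
Proof. by move=> [/(_ 0%N)[]]. Qed.

Lemma test_measurable phi : test_function phi -> measurable_fun setT phi.
Proof. by move=> /test_continuous; exact: measurable_continuous. Qed.

Lemma test_dom phi : test_function phi -> exists C, exists n : nat,
  0 <= C /\ forall x, `|phi x| <= C * \1_(cube n%:R) x.
Proof.
move=> tphi; have [n Hn] := test_supp tphi.
have /compact_bounded[M [_ HM]] : compact (phi @` cube n%:R).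
  apply: continuous_compact; last exact: compact_cube.
  by apply: continuous_subspaceT; exact: test_continuous.
exists (`|M| + 1), n; split => [|x]; first by rewrite addr_ge0.
rewrite indicE; case: (boolP (x \in _)); rewrite ?inE => xn.
  rewrite mulr1; apply: HM; last by exists x.
  by rewrite (le_lt_trans (ler_norm M))// ltrDl.
rewrite mulr0; have [->|px] := eqVneq (phi x) 0; first by rewrite normr0.
by exfalso; apply: (negP xn); rewrite inE; apply: Hn; exact: subset_closure.
Qed.

Lemma itg_test u phi : loc_integrable u -> test_function phi ->
  itg mu (fun x => u x * phi x).
Proof.
move=> /loc_integrableP[mu_ Iu] tphi; have [C [n [C0 HC]]] := test_dom tphi.
apply: (itg_le (g := fun x => C * `|u x * \1_(cube n%:R) x|)).
- by apply: measurable_funM => //; exact: test_measurable.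
- move=> x; rewrite !normrM mulrCA (le_trans (ler_wpM2l _ (HC x)))//.
  by rewrite [`|\1__ _|]ger0_norm// indicE.
- exact/itgZ/itg_norm.
Qed.

Lemma test_partial phi i : test_function phi -> test_function (partial i phi).
Proof.
move=> tphi; have [n Hn] := test_supp tphi.
apply: (@test_intro _ n%:R); first by move=> k; apply: Ck_partial; have [] := tphi.
move=> x; apply: contraNP => xn; apply/eqP.
have /existsNP[B /not_implyP[nB AB]] : ~ closure [set x | phi x != 0] x by move=> /Hn.
rewrite /partial (@near_eq_derive _ _ _ _ (cst 0)) ?derive_cst//.
apply: filterS nB => y By; apply/eqP; apply: contrapT => /negP py.
by apply: AB; exists y.
Qed.

Lemma test_shift phi z : test_function phi -> test_function (fun x => phi (x + z)).
Proof.
move=> tphi; have [n Hn] := test_supp tphi.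
apply: (@test_intro _ (n%:R + `|z|)); last first.
  move=> x px; rewrite -(addrK z x); apply: cubeD; last exact/cubeN/cube_normr.
  by apply: Hn; exact: subset_closure.
have [Cphi _] := tphi => k; move: (Cphi k).
elim: k phi {tphi Hn Cphi} => [|k IH] phi Cphi.
  split => // x; apply: (@continuous_comp _ _ _ (fun x => x + z)).
    by apply: continuousD => //; exact: cst_continuous.
  exact: (Ck_continuous Cphi).
apply: (@Ck_intro _ _ (fun i x => partial i phi (x + z))).
- move=> x; apply: (@continuous_comp _ _ _ (fun x => x + z)).
    by apply: continuousD => //; exact: cst_continuous.
  exact: (Ck_continuous Cphi).
- move=> i x; have /is_derive_lineP D := Ck_is_derive i (x + z) Cphi.
  by apply/is_derive_lineP; under eq_fun do rewrite -addrA.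
- by move=> i; apply: (IH (partial i phi)); exact: Ck_partial.
Qed.

Lemma partial_shift phi z i x : partial i (fun y => phi (y + z)) x = partial i phi (x + z).
Proof.
rewrite /partial /derive.
have -> // : (fun h : R => h^-1 *: (((fun y => phi (y + z)) \o shift x) (h *: delta_mx 0 i) -
    phi (x + z))) =
  (fun h : R => h^-1 *: ((phi \o shift (x + z)) (h *: delta_mx 0 i) - phi (x + z))).
by apply/funext => h /=; rewrite addrA.
Qed.

Lemma test_radial F a (r : R) : smooth F -> (forall s, r <= s -> F s = 0) ->
  test_function (radial F a).
Proof.
move=> sF F0; apply: (@test_intro _ (`|a| + (1 + `|r|))) => [k|x].
  exact: Ck_radial.
rewrite /radial => H; have {H} : sqd a x < r.
  by rewrite ltNge; apply: contraNN H => /F0 ->.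
move=> xr; rewrite -(subrKC a x); apply: cubeD; first exact: cube_normr.
move=> i; rewrite !mxE; have := le_lt_trans (le_sqd a x i) xr.
rewrite -real_normK ?num_real//; set t := `| _ |; have t0 : 0 <= t by exact: normr_ge0.
have r0 := ler_norm r; have rn := normr_ge0 r; move=> tr.
have [//|t1] := leP t (1 + `|r|); nra.
Qed.

Notation lambda := (@lebesgue_measure R).
Definition unit_itv (s : measurableTypeR R) : R := \1_`[(0 : R), 1]%classic s.

Lemma measurable_unit_itv : measurable_fun setT unit_itv.
Proof. by apply: measurable_indic; exact: measurable_itv. Qed.

Lemma unit_itv_ge0 s : 0 <= unit_itv s.
Proof. by rewrite /unit_itv indicE. Qed.

Lemma rint_unit_itv (g dg : R -> R) :
  (forall t : R, is_derive t (1 : R) g (dg t)) -> continuous dg ->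
  itg lambda (fun s => unit_itv s * dg s) /\
  rint lambda (fun s => unit_itv s * dg s) = g 1 - g 0.
Proof.
move=> Dg cdg; have cg := is_derive_continuous Dg.
have E : (fun s => unit_itv s * dg s) = dg \_ `[(0 : R), 1]%classic.
  by apply/funext => s; rewrite patchE /unit_itv indicE; case: (_ \in _); rewrite ?mul1r ?mul0r.
have I01 : lambda.-integrable `[(0 : R), 1] (EFin \o dg).
  apply: continuous_compact_integrable; first exact: segment_compact.
  exact: continuous_subspaceT.
split.
  apply/integrableP; split.
    apply/measurable_EFinP/measurable_funM; last exact: continuous_measurable_fun.
    exact: measurable_unit_itv.
  have /integrableP[_] := I01; rewrite integral_mkcond.
  suff -> : (\int[lambda]_s (((fun s => `|(EFin \o dg) s|) \_ `[(0%R : R), 1%R]) s) =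
    \int[lambda]_s `|(unit_itv s * dg s)%:E|)%E by [].
  apply: eq_integral => s _; rewrite patchE /unit_itv indicE /=.
  by case: (_ \in _); rewrite ?mul1r// mul0r normr0.
transitivity (\int[lambda]_s (dg \_ `[(0 : R), 1]%classic) s).
  apply: eq_rint => s; rewrite patchE /unit_itv indicE.
  by case: (_ \in _); rewrite ?mul1r// mul0r.
rewrite -Rintegral_mkcond /Rintegral (@continuous_FTC2 _ dg g 0 1)//.
- exact: continuous_subspaceT.
- split => [t _|//|]; first by have [] := Dg t.
  + by apply: cvg_at_right_filter; exact: cg.
  + by apply: cvg_at_left_filter; exact: cg.
- by move=> t _; rewrite derive1E derive_val.
Qed.

Lemma test_FTC phi i x (t : R) : test_function phi ->
  itg lambda (fun s => unit_itv s * (t * partial i phi (x + (t * s) *: delta_mx 0 i))) /\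
  rint lambda (fun s => unit_itv s * (t * partial i phi (x + (t * s) *: delta_mx 0 i)))
  = phi (x + t *: delta_mx 0 i) - phi x.
Proof.
move=> tphi; have [Cphi _] := tphi.
pose g (s : R) := phi (x + (t * s) *: delta_mx 0 i).
have cl : continuous (fun s : R => x + (t * s) *: (delta_mx 0 i : E)).
  move=> s; apply: cvgD; first exact: cvg_cst.
  by apply: cvgZr_tmp; apply: cvgM; [exact: cvg_cst|exact: cvg_id].
have Dg s : is_derive s (1 : R) g (t * partial i phi (x + (t * s) *: delta_mx 0 i)).
  have /is_derive_lineP D := Ck_is_derive i (x + (t * s) *: delta_mx 0 i) (Cphi 1%N).
  apply/is_derive_lineP.
  have DA : is_derive (0 : R) (1 : R) (fun u : R => t * u) t.
    have := is_deriveZ t (is_derive_id (0 : R) (1 : R)).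
    by rewrite /GRing.scale/= mulr1.
  rewrite [t * partial i phi _]mulrC.
  rewrite (_ : (fun u : R => g (u *: (1 : R) + s)) =
    (fun u => phi ((t * u) *: delta_mx 0 i + (x + (t * s) *: delta_mx 0 i)))); last first.
    apply/funext => u; rewrite /g; congr phi.
    have -> : u%:A = u :> R by rewrite /GRing.scale/= mulr1.
    by rewrite mulrDr scalerDl addrCA.
  apply: (@is_derive1_comp _ (fun u : R => phi (u *: delta_mx 0 i + (x + (t * s) *: delta_mx 0 i)))
    (fun u => t * u) 0 _ _ _ DA).
  by rewrite mulr0.
have cdg : continuous (fun s => t * partial i phi (x + (t * s) *: delta_mx 0 i)).
  move=> s; apply: cvgM; first exact: cvg_cst.
  apply: continuous_cvg; last exact: cl.
  exact: (Ck_continuous (Ck_partial i (Cphi 1%N))).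
have [I1 ->] := rint_unit_itv Dg cdg; split=> //.
by rewrite /g mulr1 mulr0 scale0r addr0.
Qed.

Lemma weak_partialP i u h phi : weak_partial i u h -> test_function phi ->
  rint mu (fun x => u x * partial i phi x) = - rint mu (fun x => h x * phi x).
Proof.
move=> [Lu Lh H] tphi; have tp := test_partial i tphi.
apply: EFin_inj; rewrite EFinN !EFin_rint ?H//; exact: itg_test.
Qed.

Lemma weak_partial_intro i u h : loc_integrable u -> loc_integrable h ->
  (forall phi, test_function phi ->
  rint mu (fun x => u x * partial i phi x) = - rint mu (fun x => h x * phi x)) ->
  weak_partial i u h.
Proof.
move=> Lu Lh H; split => // phi tphi; have tp := test_partial i tphi.
by rewrite -!EFin_rint ?H ?EFinN//; exact: itg_test.
Qed.

End smooth_rV.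

(** * The fundamental lemma *)

Section fundamental_lemma.
Context {R : realType} {p : nat}.
Notation E := 'rV[R]_p.
Notation mu := (@lebesgue_rV R p).
Implicit Types (f u h : E -> R) (x y z a : E).

Lemma measurable_indic_cube (r : R) : measurable_fun setT (\1_(cube r) : E -> R).
Proof. by apply: measurable_indic; exact: measurable_cube. Qed.

Lemma indic_cube_ge0 (r : R) x : 0 <= \1_(cube r) x :> R.
Proof. by rewrite indicE. Qed.

Lemma le_indic_cube (r s : R) (x y : E) : (cube r x -> cube s y) ->
  \1_(cube r) x <= \1_(cube s) y :> R.
Proof.
move=> H; rewrite !indicE; case: (boolP (x \in _)); rewrite ?inE => xr.
  by rewrite mem_set//; exact: H.
by case: (_ \in _).
Qed.

Lemma indic_cube1 (r : R) x : cube r x -> \1_(cube r) x = 1 :> R.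
Proof. by move=> xr; rewrite indicE mem_set. Qed.

Lemma ge_nat (r : R) : exists n : nat, r <= n%:R.
Proof.
exists (Num.truncn `|r|).+1; rewrite (le_trans (ler_norm _))//.
by rewrite ltW// truncnS_gt.
Qed.

Lemma loc_integrable_cube f (r : R) : loc_integrable f ->
  itg mu (fun x => f x * \1_(cube r) x).
Proof.
move=> /loc_integrableP[mf If]; have [n rn] := ge_nat r.
apply: itg_le (itg_norm (If n)).
  by apply: measurable_funM => //; exact: measurable_indic_cube.
move=> x; rewrite !normrM ler_wpM2l// !ger0_norm// ?indic_cube_ge0//.
by apply: le_indic_cube; exact: le_cube.
Qed.

Lemma loc_integrable_measurable f : loc_integrable f -> measurable_fun setT f.
Proof. by case. Qed.

Lemma translation_continuity_eps f (e : R) : itg mu f -> 0 < e ->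
  exists2 d : R, 0 < d & forall z, cube d z ->
    rint mu (fun x => `|f (x + z) - f x|) < e.
Proof.
move=> f1 e0; apply: contrapT => /forall2NP H.
have /choice[z Hz] (n : nat) : exists z, cube n.+1%:R^-1 z /\
    e <= rint mu (fun x => `|f (x + z) - f x|).
  have [] := H n.+1%:R^-1; first by rewrite invr_gt0 ltr0n.
  move=> /existsNP[z /not_implyP[zn /negP]]; rewrite -leNgt => ez.
  by exists z.
have z0 : z n @[n --> \oo] --> (0 : E).
  apply/cvgr0Pnorm_le => d d0; near=> n.
  apply: le_normr_rV => [|i]; first exact: ltW.
  apply: le_trans ((Hz n).1 i) _; near: n.
  exists (Num.truncn d^-1) => // m /= dm.
rewrite invf_ple ?posrE//; apply: le_trans (ltW (truncnS_gt _)) _.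
by rewrite ler_nat ltnS.
have := translation_continuity z0 f1 => /cvgr0Pnorm_lt/(_ _ e0)[n _ /(_ n (leqnn n))].
by rewrite /= ger0_norm ?rint_ge0// ltNge (Hz n).2.
Unshelve. all: by end_near. Qed.

Lemma loc_translation_continuity f (r e : R) : loc_integrable f -> 0 < e ->
  exists2 d : R, 0 < d <= 1 & forall z, cube d z ->
    itg mu (fun x => `|f (x + z) - f x| * \1_(cube r) x) /\
    rint mu (fun x => `|f (x + z) - f x| * \1_(cube r) x) < e.
Proof.
move=> Lf e0; have If := loc_integrable_cube (r + 1) Lf.
have [d d0 Hd] := translation_continuity_eps If e0.
have mf := loc_integrable_measurable Lf.
exists (Num.min d 1); first by rewrite lt_min d0 ltr01 ge_min lexx orbT.
move=> z zd.
have zd1 : cube d z by apply: le_cube zd; rewrite ge_min lexx.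
have z1 : cube 1 z by apply: le_cube zd; rewrite ge_min lexx orbT.
have I1 : itg mu (fun x => `|f (x + z) * \1_(cube (r + 1)) (x + z) - f x * \1_(cube (r + 1)) x|).
  by apply/itg_norm/itgB => //; exact: (itg_shift z If).
have L x : `|f (x + z) - f x| * \1_(cube r) x <=
    `|f (x + z) * \1_(cube (r + 1)) (x + z) - f x * \1_(cube (r + 1)) x|.
  rewrite [X in _ * X]indicE; case: (boolP (x \in _)); rewrite ?inE => xr; last by rewrite mulr0.
  rewrite mulr1 !indic_cube1 ?mulr1//; last exact: cubeD.
  by apply: le_cube xr; rewrite lerDl.
have I2 : itg mu (fun x => `|f (x + z) - f x| * \1_(cube r) x).
  apply: itg_le I1.
    apply: measurable_funM; last exact: measurable_indic_cube.
    apply: measurableT_comp => //; apply: measurable_funB => //.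
    by apply: (measurableT_comp mf); exact: measurable_shift.
  by move=> x; rewrite ger0_norm// mulr_ge0// indic_cube_ge0.
split=> //; apply: le_lt_trans (Hd z zd1).
exact: rint_le.
Qed.

Definition bumpf (r : R) (s : R) : R := flat 0 (r - s).

Lemma smooth_bump r : smooth (bumpf r).
Proof.
move=> k; have := C1_affine (-1) r (smooth_flat 0 k).
by congr C1; apply/funext => s; rewrite /bumpf mulN1r addrC.
Qed.

Lemma bump_ge0 r s : 0 <= bumpf r s.
Proof. exact: flat_ge0. Qed.

Lemma bump_eq0 r s : r <= s -> bumpf r s = 0.
Proof. by move=> rs; rewrite /bumpf flat_le0// subr_le0. Qed.

Lemma test_bump r a : test_function (radial (bumpf r) a).
Proof. exact: test_radial (smooth_bump r) (@bump_eq0 r). Qed.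

Lemma itg_test1 (phi : E -> R) : test_function phi -> itg mu phi.
Proof.
move=> tphi; have [C [n [C0 HC]]] := test_dom tphi.
apply: (itg_le (g := fun x => C * \1_(cube n%:R) x)) => //.
  exact: test_measurable.
exact/itgZ/itg_cube.
Qed.

Lemma cube_gt0 (d : R) : 0 < d -> (0 < mu (cube d))%E.
Proof.
move=> d0; rewrite cube_setE (lebesgue_rV_box (A := fun=> `[- d, d]%classic)); last first.
  by move=> i; exact: measurable_itv.
elim/big_rec : _ => [|i x _ x0]; first by rewrite lte01.
rewrite lebesgue_measure_itv/= lte_fin ifT; last by lra.
by rewrite -EFinB mule_gt0// lte_fin; lra.
Qed.

Lemma rint_bump_gt0 r : 0 < r -> 0 < rint mu (radial (bumpf r) 0).
Proof.
move=> r0; have tb := test_bump r 0.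
have /cvgr_gt/(_ (bumpf r 0 / 2)) : {for (0 : E), continuous (radial (bumpf r) 0)}.
  exact: (test_continuous tb).
have b0 : 0 < bumpf r 0 by rewrite /bumpf subr0 flat_gt0.
have E0 : radial (bumpf r) 0 (0 : E) = bumpf r 0.
  by rewrite /radial /sqd subrr /sqnorm /dotV big1// => i _; rewrite mxE mul0r.
rewrite E0 => /(_ ltac:(by rewrite ltr_pdivrMr// ltr_pMr// ltr1n)).
move=> /nbhs_ballP[d /= d0 Hd].
have d2 : 0 < d / 2 by rewrite divr_gt0.
apply: (@lt_le_trans _ _ (rint mu (fun x => bumpf r 0 / 2 * \1_(cube (d / 2)) x))).
  rewrite rintZ; last exact: itg_cube.
  rewrite mulr_gt0 ?divr_gt0// /Rintegral integral_indic//; last exact: measurable_cube.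
  rewrite setIT; apply: fine_gt0; apply/andP; split; first exact: cube_gt0.
  exact: cube_lty.
apply: rint_le => [||x]; first exact/itgZ/itg_cube.
  exact: itg_test1.
rewrite indicE; case: (boolP (x \in _)); rewrite ?inE => xd; last first.
  by rewrite mulr0; exact: bump_ge0.
rewrite mulr1 ltW//; apply: Hd; rewrite -ball_normE /= sub0r normrN.
apply: (@le_lt_trans _ _ (d / 2)); last by rewrite ltr_pdivrMr// ltr_pMr// ltr1n.
by apply: le_normr_rV => //; exact: ltW.
Qed.

Lemma bump_cube (d : R) x : 0 < d -> radial (bumpf (d ^+ 2)) 0 x != 0 -> cube d x.
Proof.
move=> d0 H i; have {H} : sqd 0 x < d ^+ 2.
  by rewrite ltNge; apply: contraNN H => /bump_eq0; rewrite /radial => ->.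
move=> H; have := le_lt_trans (le_sqd 0 x i) H; rewrite mxE subr0 => H2.
by rewrite -(@ler_pXn2r _ 2)// ?nnegrE ?ltW// real_normK ?num_real.
Qed.

(* Mollification: integrating the hypothesis over the centers in [A] and
   letting the bumps shrink gives a nonnegative integral over [A]. *)
Lemma rint_ge0_of_bumps f (A : set E) (k : R) : loc_integrable f ->
  measurable A -> A `<=` cube k ->
  (forall a r, 0 < r -> 0 <= rint mu (fun x => f x * radial (bumpf r) a x)) ->
  0 <= rint mu (fun x => f x * \1_A x).
Proof.
move=> Lf mA Ak H; rewrite leNgt; apply/negP => neg.
set I0 := rint mu (fun x => f x * \1_A x) in neg.
have [d /andP[d0 d1] Hd] := loc_translation_continuity k Lf (e := - I0 / 2) ltac:(by rewrite divr_gt0// oppr_gt0).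
pose B := radial (bumpf (d ^+ 2)) (0 : E).
have d20 : 0 < d ^+ 2 by rewrite exprn_gt0.
have tB : test_function B by exact: test_bump.
have B0 x : 0 <= B x by exact: bump_ge0.
have IB : itg mu B by exact: itg_test1.
have mf := loc_integrable_measurable Lf.
have mB := test_measurable tB.
have mIA : measurable_fun setT (\1_A : E -> R) by exact: measurable_indic.
have IA_le x : `|\1_A x| <= \1_(cube k) x :> R.
  rewrite !indicE; case: (boolP (x \in A)); rewrite ?inE => xA; last by rewrite normr0.
  by rewrite normr1 mem_set//; exact: Ak.
pose G (w : E * E) := f w.1 * \1_A (w.1 + - w.2) * B w.2.
have IG : itg (mu \x mu)%E G.
  apply: (itg_le (g := fun w => `|f w.1 * \1_(cube (k + d)) w.1| * B w.2)).
  - apply: measurable_funM; last exact: measurableT_comp.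
    apply: measurable_funM; first exact: measurableT_comp.
    apply: measurableT_comp => //; apply: measurable_rV_add => //.
    by apply: measurable_rV_opp.
  - move=> [x z]; rewrite /G /= !normrM [`|B z|]ger0_norm//.
    have [->|Bz] := eqVneq (B z) 0; first by rewrite !mulr0.
    rewrite ler_wpM2r// ler_wpM2l// (le_trans (IA_le _))//.
    rewrite ger0_norm ?indic_cube_ge0//; apply: le_indic_cube => xz.
    by rewrite -(subrK z x); apply: cubeD => //; exact: bump_cube Bz.
  - apply: (itg_prod (f := fun x => `|f x * \1_(cube (k + d)) x|)) => //.
    exact/itg_norm/loc_integrable_cube.
have S := rint_shear (c := fun z => z) (@measurable_id _ _ setT) IG.
have IGs := itg_shear (c := fun z => z) (@measurable_id _ _ setT) IG.
have LHS_ge0 : 0 <= rint mu (fun x => rint mu (fun z => G (x + z, z))).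
  apply: rint_ge0 => a; rewrite /G /=.
  under eq_Rintegral do rewrite addrK.
  case: (boolP (a \in A)) => aA; last first.
    have -> : \1_A a = 0 :> R by rewrite indicE (negbTE aA).
    by under eq_Rintegral do rewrite mulr0 mul0r; rewrite rint0.
  have := H a _ d20; rewrite -(rint_shift a).
    suff -> : rint mu (fun x => f (x + a) * radial (bumpf (d ^+ 2)) a (x + a)) =
      rint mu (fun z => f (a + z) * \1_A a * B z) by [].
    by apply: eq_rint => z; rewrite indicE aA mulr1 /B /radial /sqd addrK subr0 [a + z]addrC.
  apply: measurable_funM; first exact: mf.
  exact: (test_measurable (test_bump _ _)).
move: LHS_ge0; rewrite S leNgt => /negP; apply.
clear H S IGs.
pose hA z := rint mu (fun x => f (x + z) * \1_A x).
have E1 z : rint mu (fun x => G (x, z)) = B z * hA z.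
  have mG : measurable_fun setT (fun x => G (x, z)).
    by apply: (measurableT_comp (itg_measurable IG)); exact: pair2_measurable.
  rewrite -(rint_shift z mG) /G /=.
  have -> : (fun x => f (x + z) * \1_A (x + z + - z) * B z) =
            (fun x => B z * (f (x + z) * \1_A x)).
    by apply/funext => x; rewrite addrK mulrC.
  have [->|Bz] := eqVneq (B z) 0.
    by under eq_Rintegral do rewrite mul0r; rewrite rint0 mul0r.
  apply: rintZ.
  apply: itg_le (itg_norm (itg_shift z (loc_integrable_cube (k + d) Lf))).
    by apply: measurable_funM => //; apply: (measurableT_comp mf); exact: measurable_shift.
  move=> x; rewrite !normrM ler_wpM2l// (le_trans (IA_le _))//.
  rewrite ger0_norm ?indic_cube_ge0//; apply: le_indic_cube => xz.
  by apply: cubeD => //; exact: bump_cube Bz.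
have [_ IGf] := (rint_fubini_itg IG, rint_fubini_itg (itg_swap IG)).
have IGz : itg mu (fun z => B z * hA z).
  by apply: eq_itg IGf => z /=; rewrite E1.
have -> : rint mu (fun z => rint mu (fun x => G (x, z))) = rint mu (fun z => B z * hA z).
  by apply: eq_rint => z; exact: E1.
apply: (@le_lt_trans _ _ (rint mu (fun z => I0 / 2 * B z))); last first.
  by rewrite rintZ// nmulr_rlt0 ?rint_bump_gt0//; lra.
apply: rint_le => [//||z]; first exact: itgZ.
have [->|Bz] := eqVneq (B z) 0; first by rewrite mul0r mulr0.
rewrite mulrC ler_wpM2r//.
have [I1 H1] := Hd z (bump_cube d0 Bz).
have If : itg mu (fun x => f x * \1_A x).
  apply: itg_le (itg_norm (loc_integrable_cube k Lf)); first exact: measurable_funM.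
  move=> x; rewrite !normrM ler_wpM2l// (le_trans (IA_le _))//.
  exact: ler_norm.
have Ifz : itg mu (fun x => f (x + z) * \1_A x).
  apply: itg_le (itgD I1 (itg_norm If)).
    by apply: measurable_funM => //; apply: (measurableT_comp mf); exact: measurable_shift.
  move=> x; rewrite (_ : f (x + z) * \1_A x = (f (x + z) - f x) * \1_A x + f x * \1_A x); last by ring.
  rewrite (le_trans (ler_normD _ _))// lerD2r normrM ler_wpM2l//.
have : hA z - I0 <= - I0 / 2.
  rewrite -rintB// (le_trans _ (ltW H1))//; apply: rint_le => // [|x]; first exact: itgB.
  rewrite -mulrBl (le_trans (ler_norm _))// normrM ler_wpM2l//.
by lra.
Qed.

Lemma ae_ge0_of_bumps f : loc_integrable f ->
  (forall a r, 0 < r -> 0 <= rint mu (fun x => f x * radial (bumpf r) a x)) ->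
  {ae mu, forall x, 0 <= f x}.
Proof.
move=> Lf H; have mf := loc_integrable_measurable Lf.
suff Hk (k : nat) : {ae mu, forall x, cube k%:R x -> 0 <= f x}.
  have := ae_foralln Hk.
  apply: filterS => x Hx; have [n xn] := ge_nat `|x|.
  by apply: (Hx n); apply: le_cube xn _ _; exact: cube_normr.
pose A : set E := cube k%:R `&` [set x | f x < 0].
have mA : measurable A.
  apply: measurableI; first exact: measurable_cube.
  rewrite (_ : [set x | f x < 0] = f @^-1` `]-oo, 0[).
    by rewrite -[X in measurable X]setTI; apply: mf => //; exact: measurable_itv.
  by apply/seteqP; split => x; rewrite /= in_itv.
have I0 := rint_ge0_of_bumps Lf mA (@subIsetl _ _ _) H.
have If : itg mu (fun x => f x * \1_A x).
  apply: itg_le (itg_norm (loc_integrable_cube k%:R Lf)).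
    by apply: measurable_funM => //; exact: measurable_indic.
  move=> x; rewrite !normrM ler_wpM2l// !indicE.
  case: (boolP (x \in A)); rewrite ?inE => xA; last by rewrite normr0.
  by case: xA => xA _; rewrite mem_set.
have N x : `|f x * \1_A x| = - (f x * \1_A x).
  rewrite indicE; case: (boolP (x \in A)); rewrite ?inE => xA.
    by rewrite mulr1 ltr0_norm//; case: xA.
  by rewrite mulr0 normr0 oppr0.
have : (\int[mu]_x `|(f x * \1_A x)%:E| = 0)%E.
  apply/eqP; rewrite eq_le integral_ge0// andbT.
  under eq_integral do rewrite /= N EFinN.
  by rewrite -EFin_rint//; last exact: itgN; rewrite rintN// lee_fin oppr_le0.
move=> /(ae_eq_integral_abs mu measurableT (measurable_int _ If)).
apply: filterS => x /(_ I)[] fx xk; rewrite leNgt; apply/negP => neg.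
move: fx; rewrite indicE mem_set ?mulr1; last by split.
by move=> fx; rewrite fx ltxx in neg.
Qed.

Lemma ae_eq0_of_bumps f : loc_integrable f ->
  (forall a r, 0 < r -> rint mu (fun x => f x * radial (bumpf r) a x) = 0) ->
  {ae mu, forall x, f x = 0}.
Proof.
move=> Lf H.
have LN : loc_integrable (fun x => - f x).
  have /loc_integrableP[mf If] := Lf; apply/loc_integrableP; split.
    exact: measurableT_comp.
  by move=> n; under eq_fun do rewrite mulNr; exact: itgN.
have H1 : {ae mu, forall x, 0 <= f x} by apply: ae_ge0_of_bumps => // a r r0; rewrite H.
have H2 : {ae mu, forall x, 0 <= - f x}.
  apply: ae_ge0_of_bumps => // a r r0.
  under eq_Rintegral do rewrite mulNr.
  by rewrite rintN ?H ?oppr0//; exact: itg_test (test_bump _ _).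
by apply: filterS2 H1 H2 => x x1 x2; apply/eqP; rewrite eq_le x1 andbT -oppr_ge0.
Qed.

End fundamental_lemma.

(** * Difference quotients of weakly differentiable functions *)

Section difference_quotients.
Context {R : realType} {p : nat}.
Notation E := 'rV[R]_p.
Notation mu := (@lebesgue_rV R p).
Notation lambda := (@lebesgue_measure R).
Notation unit_itv := (@unit_itv R).
Implicit Types (f g u h v : E -> R) (x y z a : E) (i : 'I_p).

Lemma loc_integrable_intro f :
  (forall k : nat, itg mu (fun x => f x * \1_(cube k%:R) x)) -> loc_integrable f.
Proof.
move=> H; apply/loc_integrableP; split => //.
apply: (@measurable_fun_cvg _ _ _ _ (fun (k : nat) x => f x * \1_(cube k%:R) x)).
  by move=> k; exact: itg_measurable (H k).
move=> x _; apply: cvg_near_cst; have [n xn] := ge_nat `|x|.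
exists n => // k /= nk; rewrite indic_cube1 ?mulr1//.
by apply: le_cube (@cube_normr _ _ x); rewrite (le_trans xn)// ler_nat.
Qed.

Lemma loc_integrableD f g : loc_integrable f -> loc_integrable g ->
  loc_integrable (fun x => f x + g x).
Proof.
move=> Lf Lg; apply: loc_integrable_intro => k.
under eq_fun do rewrite mulrDl.
by apply: itgD; exact: loc_integrable_cube.
Qed.

Lemma loc_integrableZ (k : R) f : loc_integrable f -> loc_integrable (fun x => k * f x).
Proof.
move=> Lf; apply: loc_integrable_intro => n.
under eq_fun do rewrite -mulrA.
by apply: itgZ; exact: loc_integrable_cube.
Qed.

Lemma loc_integrableB f g : loc_integrable f -> loc_integrable g ->
  loc_integrable (fun x => f x - g x).
Proof.
move=> Lf Lg; apply: loc_integrable_intro => k.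
under eq_fun do rewrite mulrBl.
by apply: itgB; exact: loc_integrable_cube.
Qed.

Lemma loc_integrable_norm f : loc_integrable f -> loc_integrable (fun x => `|f x|).
Proof.
move=> Lf; apply: loc_integrable_intro => k.
apply: eq_itg (itg_norm (loc_integrable_cube k%:R Lf)) => x.
by rewrite normrM [X in _ * X]ger0_norm// indic_cube_ge0.
Qed.

Lemma loc_integrable_sum (I : finType) (F : I -> E -> R) :
  (forall j, loc_integrable (F j)) -> loc_integrable (fun x => \sum_j F j x).
Proof.
move=> LF; apply: loc_integrable_intro => k.
under eq_fun do rewrite mulr_suml.
by apply: itg_sum => j; exact: loc_integrable_cube.
Qed.

Lemma loc_integrable_le f g : measurable_fun setT f -> (forall x, `|f x| <= g x) ->
  loc_integrable g -> loc_integrable f.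
Proof.
move=> mf fg Lg; apply: loc_integrable_intro => k.
apply: itg_le (loc_integrable_cube k%:R Lg).
  by apply: measurable_funM => //; exact: measurable_indic_cube.
move=> x; rewrite normrM [X in _ * X]ger0_norm ?indic_cube_ge0//.
by rewrite ler_wpM2r// indic_cube_ge0.
Qed.

Lemma loc_integrable_bounded f (C : R) : measurable_fun setT f ->
  (forall x, `|f x| <= C) -> loc_integrable f.
Proof.
move=> mf fC; apply: (@loc_integrable_le _ (fun=> C)) => //.
apply: loc_integrable_intro => k; apply: itgZ; exact: itg_cube.
Qed.

Lemma loc_integrable_shift f z : loc_integrable f -> loc_integrable (fun x => f (x + z)).
Proof.
move=> Lf; apply: loc_integrable_intro => k.
have mf := loc_integrable_measurable Lf.
apply: itg_le (itg_norm (itg_shift z (loc_integrable_cube (k%:R + `|z|) Lf))).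
  apply: measurable_funM; last exact: measurable_indic_cube.
  by apply: (measurableT_comp mf); exact: measurable_shift.
move=> x; rewrite !normrM ler_wpM2l// !ger0_norm ?indic_cube_ge0//.
by apply: le_indic_cube => xk; apply: cubeD => //; exact: cube_normr.
Qed.

Lemma itg_unit_itv : itg lambda unit_itv.
Proof.
have c1 : continuous (fun _ : R => 1 : R) by move=> ?; exact: cvg_cst.
have [+ _] := @rint_unit_itv R id (fun=> 1) (fun t => is_derive_id t (1 : R)) c1.
by under eq_fun do rewrite mulr1.
Qed.

Lemma rint_unit_itv1 : rint lambda unit_itv = 1.
Proof.
have c1 : continuous (fun _ : R => 1 : R) by move=> ?; exact: cvg_cst.
have [_] := @rint_unit_itv R id (fun=> 1) (fun t => is_derive_id t (1 : R)) c1.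
by under eq_Rintegral do rewrite mulr1; rewrite subr0.
Qed.

Section line.
Variables (i : 'I_p) (t : R).
Definition seg (s : measurableTypeR R) : E := (t * s) *: delta_mx 0 i.
Notation c := seg.

Lemma measurable_seg : measurable_fun setT seg.
Proof. by apply: measurable_rV_scale => //; exact: measurable_funM. Qed.

Lemma cube_seg s : unit_itv s != 0 -> cube `|t| (c s).
Proof.
rewrite (_ : unit_itv s = \1_`[(0 : R), 1]%classic s)// indicE; case: (boolP (s \in _)) => [|_]; last by rewrite eqxx.
rewrite inE/= in_itv/= => /andP[s0 s1] _ j.
rewrite /c !mxE !normrM eqxx/= (ger0_norm s0).
rewrite -[leRHS]mulr1 -mulrA ler_wpM2l// -[leRHS]mulr1 ler_pM//.
by case: (j == i); rewrite ?normr1 ?normr0.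
Qed.

Lemma itg_line v (Psi : E -> R) (C r : R) : loc_integrable v ->
  measurable_fun setT Psi -> (forall x, `|Psi x| <= C * \1_(cube r) x) ->
  itg (mu \x lambda)%E
    (fun w : E * measurableTypeR R => v w.1 * Psi (w.1 + - c w.2) * unit_itv w.2).
Proof.
move=> Lv mPsi HPsi; have mv := loc_integrable_measurable Lv.
apply: (@itg_le _ _ _ _ _ (fun w : E * measurableTypeR R =>
  (`|C| * `|v w.1 * \1_(cube (r + `|t|)) w.1|) * unit_itv w.2)).
- apply: measurable_funM; last first.
    by apply: measurableT_comp => //; exact: measurable_unit_itv.
  apply: measurable_funM; first exact: measurableT_comp.
  apply: measurableT_comp => //; apply: measurable_rV_add => //.
  by apply: measurable_rV_opp; apply: measurableT_comp => //; exact: measurable_seg.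
- move=> [x s] /=; rewrite !normrM [`|unit_itv s|]ger0_norm ?unit_itv_ge0//.
  have [->|ws] := eqVneq (unit_itv s) 0; first by rewrite !mulr0.
  rewrite ler_wpM2r ?unit_itv_ge0// mulrCA ler_wpM2l//.
  rewrite (le_trans (HPsi _))// (le_trans (ler_norm _))// normrM ler_wpM2l//.
  rewrite (ger0_norm (indic_cube_ge0 _ _)) (ger0_norm (indic_cube_ge0 _ _)).
  apply: le_indic_cube => xz; rewrite -(subrK (c s) x).
  by apply: cubeD => //; exact: cube_seg.
- apply: (@itg_prod _ _ _ _ R mu lambda (fun x => `|C| * `|v x * \1_(cube (r + `|t|)) x|)).
    by apply/itgZ/itg_norm; exact: loc_integrable_cube.
  exact: itg_unit_itv.
Qed.

Definition line_avg v x : R := rint lambda (fun s => v (x + c s) * unit_itv s).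

Lemma line_avg_rint v (Psi : E -> R) (C r : R) : loc_integrable v ->
  measurable_fun setT Psi -> (forall x, `|Psi x| <= C * \1_(cube r) x) ->
  [/\ itg (mu \x lambda)%E
    (fun w : E * measurableTypeR R => v (w.1 + c w.2) * Psi w.1 * unit_itv w.2),
  itg mu (fun x => line_avg v x * Psi x) &
  rint mu (fun x => line_avg v x * Psi x) =
  rint lambda (fun s => rint mu (fun x => v x * Psi (x + - c s) * unit_itv s))].
Proof.
move=> Lv mPsi HPsi; have I1 := itg_line Lv mPsi HPsi.
have mv := loc_integrable_measurable Lv.
have IV : itg (mu \x lambda)%E (fun w : E * measurableTypeR R =>
    v (w.1 + c w.2) * Psi w.1 * unit_itv w.2).
  by apply: eq_itg (itg_shear measurable_seg I1) => w /=; rewrite addrK.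
have E2 x : rint lambda (fun s => v (x + c s) * Psi x * unit_itv s) = line_avg v x * Psi x.
  rewrite mulrC -rintZ_measurable.
    by apply: eq_rint => s; rewrite mulrAC mulrC.
  apply: measurable_funM; last exact: measurable_unit_itv.
  apply: (measurableT_comp mv); apply: measurable_rV_add => //.
  exact: measurable_seg.
have IE : itg mu (fun x => line_avg v x * Psi x).
  by apply: eq_itg (rint_fubini_itg IV) => x /=; exact: E2.
split => //; rewrite -(rint_shear measurable_seg I1)/=.
by apply: eq_rint => x; rewrite -E2; apply: eq_rint => s; rewrite addrK.
Qed.

Lemma loc_integrable_line_avg v : loc_integrable v -> loc_integrable (line_avg v).
Proof.
move=> Lv; apply: loc_integrable_intro => k.
have H (x : E) : `|\1_(cube k%:R) x| <= 1 * \1_(cube k%:R) x :> R.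
  by rewrite mul1r ger0_norm// indic_cube_ge0.
by have [] := line_avg_rint Lv (measurable_indic_cube k%:R) H.
Qed.

Lemma translate_eq_line_avg u h : weak_partial i u h ->
  {ae mu, forall x, u (x + t *: delta_mx 0 i) - u x = t * line_avg h x}.
Proof.
move=> W; have [Lu Lh _] := W.
have Lsh := loc_integrable_shift (t *: delta_mx 0 i) Lu.
have Lavg := loc_integrable_line_avg Lh.
have LD : loc_integrable (fun x => (u (x + t *: delta_mx 0 i) - u x) - t * line_avg h x).
  apply: loc_integrableB; first exact: loc_integrableB.
  exact: loc_integrableZ.
suff : {ae mu, forall x, (u (x + t *: delta_mx 0 i) - u x) - t * line_avg h x = 0}.
  by apply: filterS => x /eqP; rewrite subr_eq0 => /eqP.
apply: ae_eq0_of_bumps => // a r r0.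
set psi := radial (bumpf r) a.
have tpsi : test_function psi by exact: test_bump.
have tdpsi := test_partial i tpsi.
have [C [n [C0 HC]]] := test_dom tpsi.
have [C' [n' [C0' HC']]] := test_dom tdpsi.
have [_ I1 E1] := line_avg_rint Lh (test_measurable tpsi) HC.
have IF := itg_line Lu (test_measurable tdpsi) HC'.
have Es s : rint mu (fun x => h x * psi (x + - c s) * unit_itv s) =
   - rint mu (fun x => u x * partial i psi (x + - c s) * unit_itv s).
  under eq_Rintegral do rewrite mulrC.
  have tps := test_shift (- c s) tpsi.
  rewrite rintZ; last exact: itg_test.
  have := weak_partialP W tps; rewrite -[LHS]opprK => /oppr_inj <-.
  rewrite mulrN -rintZ; last exact: itg_test (test_partial i tps).
  by congr (- _); apply: eq_rint => x; rewrite partial_shift mulrC.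
have E2 : t * rint mu (fun x => line_avg h x * psi x) =
    rint mu (fun x => u x * (psi (x - t *: delta_mx 0 i) - psi x)).
  rewrite E1 (eq_rint _ Es).
  have [_ IF2] := (rint_fubini_itg IF, rint_fubini_itg (itg_swap IF)).
  rewrite rintN//= -(rint_fubini IF)/= mulrN -mulNr -rintZ; last exact: (rint_fubini_itg IF).
  apply: eq_rint => x.
  have [I3 E3] := test_FTC i x (- t) tpsi.
  rewrite -scaleNr -E3.
  rewrite -rintZ_measurable; last exact: itg_measurable I3.
  rewrite -rintZ_measurable; last first.
    exact: (measurableT_comp (itg_measurable IF) (pair1_measurable x)).
  apply: eq_rint => s /=; rewrite /c -scaleNr -mulNr; ring.
have Isu : itg mu (fun x => u (x + t *: delta_mx 0 i) * psi x) by exact: itg_test.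
have Iu : itg mu (fun x => u x * psi x) by exact: itg_test.
have Its : itg mu (fun x => u x * psi (x - t *: delta_mx 0 i)).
  by apply: itg_test => //; exact: test_shift.
rewrite (eq_rint _ (g := fun x => (u (x + t *: delta_mx 0 i) * psi x - u x * psi x) -
   t * (line_avg h x * psi x))); last by move=> x; ring.
rewrite rintB; [|exact: itgB|exact: itgZ].
rewrite rintB// rintZ// E2.
rewrite -(rint_shift (- (t *: delta_mx 0 i)) (f := fun x => u (x + t *: delta_mx 0 i) * psi x)); last first.
  exact: itg_measurable Isu.
rewrite -rintB//; last first.
  by apply: eq_itg Its => x; rewrite subrK.
rewrite -rintB.
- by rewrite -[RHS](rint0 mu); apply: eq_rint => x; rewrite subrK; ring.
- apply: itgB => //; by apply: eq_itg Its => x; rewrite subrK.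
- by apply: eq_itg (itgB Its Iu) => x; ring.
Qed.

End line.
End difference_quotients.

Lemma cvgn_sum (R : realType) (I : finType) (f : nat -> I -> R) (l : I -> R) :
  (forall j, f n j @[n --> \oo] --> l j) -> \sum_j f n j @[n --> \oo] --> \sum_j l j.
Proof.
move=> H; elim: (index_enum I) => [|j s IH].
  under eq_fun do rewrite big_nil.
  by rewrite big_nil; exact: cvg_cst.
under eq_fun do rewrite big_cons.
by rewrite big_cons; apply: cvgD.
Qed.

Lemma clamp_spec (R : realType) (H q : R) : 0 <= H ->
  let c := Num.max (- H) (Num.min H q) in
  [/\ `|c| <= H, forall g, `|g| <= H -> `|c - g| <= `|q - g| &
      forall d, 0 <= d -> `|q| <= H + d -> `|q - c| <= d].
Proof.
move=> H0 c.
have [[cE h]|[[cE h]|[cE h]]] : (c = q /\ -H <= q <= H) \/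
    (c = H /\ H < q) \/ (c = - H /\ q < - H).
  rewrite /c; have [h1|h1] := leP q H.
    have [h2|h2] := leP (- H) q; first by left.
    by right; right.
  by right; left; split => //; apply/max_idPr; lra.
- rewrite cE; split => [|//|d d0 _]; first by rewrite ler_norml.
  by rewrite subrr normr0.
- rewrite cE; split => [|g|d d0]; first by rewrite ger0_norm.
    rewrite ler_norml => /andP[g1 g2].
    by rewrite !ger0_norm ?subr_ge0//; lra.
  by rewrite ler_norml => /andP[q1 q2]; rewrite ger0_norm ?subr_ge0; lra.
- rewrite cE; split => [|g|d d0]; first by rewrite normrN ger0_norm.
    rewrite ler_norml => /andP[g1 g2].
    by rewrite !ler0_norm ?subr_le0//; lra.
  by rewrite ler_norml => /andP[q1 q2]; rewrite ler0_norm ?subr_le0; lra.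
Qed.

Lemma ae_cvg0_of_summable (R : realType) d (T : measurableType d)
    (nu : {measure set T -> \bar R}) (f : nat -> T -> R) :
  (forall n x, 0 <= f n x) -> (forall n, itg nu (f n)) ->
  (forall n, rint nu (f n) <= 2 ^- n) ->
  {ae nu, forall x, f n x @[n --> \oo] --> 0}.
Proof.
move=> f0 If Hf.
have mf n : measurable_fun setT (fun x => (f n x)%:E) by exact: measurable_int (If n).
have f0' x n : (0 <= (f n x)%:E)%E by rewrite lee_fin.
have S : (\int[nu]_x (\sum_(n <oo) (f n x)%:E) < +oo)%E.
  rewrite integral_nneseries//.
  apply: (@le_lt_trans _ _ (\sum_(n <oo) (2 / (2 ^ n.+1)%:R : R)%:E)%E).
    apply: lee_nneseries => [n _ _|n _]; first exact: integral_ge0.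
    rewrite -EFin_rint// lee_fin (le_trans (Hf n))//.
    by rewrite natrX exprS invfM mulrA mulfV ?mul1r// pnatr_eq0.
  by apply: le_lt_trans (ltry 2); apply: epsilon_trick0.
have IS : nu.-integrable setT (fun x => \sum_(n <oo) (f n x)%:E)%E.
  apply/integrableP; split.
    by apply: ge0_emeasurable_sum => // n x _ _.
  suff -> : (\int[nu]_x `|\sum_(n <oo) (f n x)%:E| =
    \int[nu]_x (\sum_(n <oo) (f n x)%:E))%E by [].
  by apply: eq_integral => x _; rewrite gee0_abs//; apply: nneseries_ge0.
apply: filterS (integrable_ae measurableT IS) => x /(_ I) xfin.
have tail : (\sum_(N <= k <oo) (f k x)%:E @[N --> \oo] --> 0)%E.
  by apply: nneseries_tail_cvg => //; rewrite ltey_eq xfin.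
have : ((f n x)%:E @[n --> \oo] --> 0)%E.
  apply: (squeeze_cvge _ _ tail); last exact: cvg_cst.
  apply: nearW => n; rewrite f0'/=.
  have := @nneseries_lim_ge R (fun k => (f k x)%:E) xpredT n n.+1 (fun k _ _ => f0' x k).
  by rewrite big_nat1.
exact: fine_cvg.
Qed.

Section chain_rule.
Context {R : realType} {p : nat}.
Notation E := 'rV[R]_p.
Notation mu := (@lebesgue_rV R p).
Notation lambda := (@lebesgue_measure R).
Notation unit_itv := (@unit_itv R).
Implicit Types (f g u h v : E -> R) (x y z a : E) (i : 'I_p).

Definition quot i (t : R) u x : R := (u (x + t *: delta_mx 0 i) - u x) / t.

Lemma loc_integrable_quot i t u : loc_integrable u -> loc_integrable (quot i t u).
Proof.
move=> Lu; rewrite /quot; under eq_fun do rewrite mulrC.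
apply: loc_integrableZ; apply: loc_integrableB => //.
exact: loc_integrable_shift.
Qed.

Lemma quot_cvg_L1 i u h (r e : R) : weak_partial i u h -> 0 < e ->
  \forall t \near (0 : R)^', rint mu (fun x => `|quot i t u x - h x| * \1_(cube r) x) <= e.
Proof.
move=> W e0; have [Lu Lh _] := W.
have [d /andP[d0 d1] Hd] := loc_translation_continuity r Lh e0.
near=> t.
have t0 : t != 0 by near: t; exact: nbhs_dnbhs_neq.
have td : `|t| <= d.
  rewrite ltW//; near: t; apply: dnbhs0_lt; exact: d0.
pose c := @seg R p i t.
have mh := loc_integrable_measurable Lh.
have H1 (x : E) : `|\1_(cube r) x| <= 1 * \1_(cube r) x :> R.
  by rewrite mul1r ger0_norm// indic_cube_ge0.
have [I1 I2 _] := @line_avg_rint _ _ i t _ _ _ _ Lh (measurable_indic_cube r) H1.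
have I3 : itg (mu \x lambda)%E (fun w : E * measurableTypeR R =>
    h w.1 * \1_(cube r) w.1 * unit_itv w.2).
  apply: (@itg_prod _ _ _ _ R mu lambda (fun x => h x * \1_(cube r) x)).
    exact: loc_integrable_cube.
  exact: itg_unit_itv.
pose J (w : E * measurableTypeR R) :=
  (h (w.1 + c w.2) - h w.1) * \1_(cube r) w.1 * unit_itv w.2.
have IJ : itg (mu \x lambda)%E J.
  by apply: eq_itg (itgB I1 I3) => w; rewrite /J; ring.
have aeJ : {ae mu, forall x, itg lambda (fun s => J (x, s))}.
  exact: ae_integrable1 IJ.
have IJn : itg (mu \x lambda)%E (fun w => `|J w|) by exact: itg_norm.
have key : {ae mu, forall x, `|quot i t u x - h x| * \1_(cube r) x <=
     rint lambda (fun s => `|J (x, s)|)}.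
  apply: filterS2 (translate_eq_line_avg t W) aeJ => x Hx IJx.
  apply: le_trans (rint_norm IJx).
  have Ih : itg lambda (fun s => h x * \1_(cube r) x * unit_itv s).
    by apply: itgZ; exact: itg_unit_itv.
  suff -> : rint lambda (fun s => J (x, s)) = (quot i t u x - h x) * \1_(cube r) x.
    by rewrite normrM (ger0_norm (indic_cube_ge0 _ _)).
  have IA : itg lambda (fun s => h (x + c s) * \1_(cube r) x * unit_itv s).
    by apply: eq_itg (itgD IJx Ih) => s; rewrite /J/=; ring.
  rewrite (eq_rint _ (g := fun s => h (x + c s) * \1_(cube r) x * unit_itv s -
    h x * \1_(cube r) x * unit_itv s)); last by move=> s; rewrite /J/=; ring.
  rewrite rintB// rintZ ?rint_unit_itv1 ?mulr1; last exact: itg_unit_itv.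
  rewrite mulrBl; congr (_ - _).
  have -> : quot i t u x = line_avg i t h x by rewrite /quot Hx mulrC mulKf.
  rewrite mulrC -rintZ_measurable.
    by apply: eq_rint => s; rewrite mulrAC mulrC.
  apply: measurable_funM; last exact: measurable_unit_itv.
  apply: (measurableT_comp mh); apply: measurable_rV_add => //.
  exact: measurable_seg.
have Iq : itg mu (fun x => `|quot i t u x - h x| * \1_(cube r) x).
  apply: loc_integrable_cube; apply: loc_integrable_norm.
  by apply: loc_integrableB => //; exact: loc_integrable_quot.
apply: le_trans (rint_ae_le Iq (rint_fubini_itg IJn) key) _.
rewrite (rint_fubini IJn).
apply: (@le_trans _ _ (rint lambda (fun s => e * unit_itv s))); last first.
  by rewrite rintZ ?rint_unit_itv1 ?mulr1//; exact: itg_unit_itv.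
apply: rint_le => [||s].
- exact: (rint_fubini_itg (itg_swap IJn)).
- by apply: itgZ; exact: itg_unit_itv.
have -> : rint mu (fun x => `|J (x, s)|) =
    unit_itv s * rint mu (fun x => `|h (x + c s) - h x| * \1_(cube r) x).
  rewrite -rintZ_measurable.
    apply: eq_rint => x; rewrite /J /= !normrM (ger0_norm (unit_itv_ge0 _)).
    by rewrite (ger0_norm (indic_cube_ge0 _ _)) mulrC.
  apply: measurable_funM; last exact: measurable_indic_cube.
  apply: measurableT_comp => //; apply: measurable_funB => //.
  by apply: (measurableT_comp mh); exact: measurable_shift.
have [->|ws] := eqVneq (unit_itv s) 0; first by rewrite mul0r mulr0.
rewrite mulrC ler_wpM2r ?unit_itv_ge0//.
have [_ /ltW //] := Hd (c s) (le_cube td (@cube_seg R p i t s ws)).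
Unshelve. all: by end_near. Qed.

Lemma quot_ae_seq (I : finType) i (u h : I -> E -> R) :
  (forall j, weak_partial i (u j) (h j)) ->
  exists t : nat -> R, [/\ forall n, t n != 0 /\ `|t n| <= 1, t n @[n --> \oo] --> 0,
    forall j (r : R),
      rint mu (fun x => `|quot i (t n) (u j) x - h j x| * \1_(cube r) x) @[n --> \oo] --> 0 &
    {ae mu, forall x, forall j, quot i (t n) (u j) x @[n --> \oo] --> h j x}].
Proof.
move=> W.
have /choice[t Ht] (n : nat) : exists t : R, [/\ t != 0, `|t| <= n.+1%:R^-1 &
   forall j, rint mu (fun x => `|quot i t (u j) x - h j x| * \1_(cube n%:R) x) <= 2 ^- n].
  have e0 : 0 < 2 ^- n :> R by rewrite invr_gt0 exprn_gt0.
  have H1 : \forall t \near (0 : R)^', forall j,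
     rint mu (fun x => `|quot i t (u j) x - h j x| * \1_(cube n%:R) x) <= 2 ^- n.
    by apply: filter_forall => j; exact: quot_cvg_L1.
  have H2 : \forall t \near (0 : R)^', `|t| < n.+1%:R^-1.
    by apply: dnbhs0_lt; rewrite invr_gt0.
  have H3 : \forall t \near (0 : R)^', t != 0 by exact: nbhs_dnbhs_neq.
  near ((0 : R)^') => t; exists t; split.
  - by near: t.
  - by apply: ltW; near: t.
  - by near: t.
have Lq n j : loc_integrable (fun x => `|quot i (t n) (u j) x - h j x|).
  have [Lu Lh _] := W j; apply: loc_integrable_norm; apply: loc_integrableB => //.
  exact: loc_integrable_quot.
have geo : (2 ^- n : R) @[n --> \oo] --> 0.
  under eq_fun do rewrite -exprVn.
  by apply: cvg_expr; rewrite ger0_norm ?invr_ge0// invf_lt1// ltr1n.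
exists t; split.
- move=> n; have [? tn _] := Ht n; split=> //; apply: le_trans tn _.
  by rewrite invf_le1// ler1n.
- apply/cvgr0Pnorm_le => d d0; near=> n.
  have [_ + _] := Ht n; move=> /le_trans; apply; near: n.
  exists (Num.truncn d^-1) => // m /= dm.
  rewrite invf_ple ?posrE//; apply: le_trans (ltW (truncnS_gt _)) _.
  by rewrite ler_nat ltnS.
- move=> j r; have [k rk] := ge_nat r.
  apply/cvgr0Pnorm_le => d d0; near=> n.
  rewrite ger0_norm; last by apply: rint_ge0 => x; rewrite mulr_ge0// indic_cube_ge0.
  apply: (@le_trans _ _ (2 ^- n)).
    have [_ _ /(_ j)] := Ht n; apply: le_trans.
    apply: rint_le => [||x]; [exact: loc_integrable_cube..|].
    rewrite ler_wpM2l//; apply: le_indic_cube; apply: le_cube.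
    rewrite (le_trans rk)// ler_nat; near: n; exact: nbhs_infty_ge.
  rewrite -[leLHS]ger0_norm ?invr_ge0 ?exprn_ge0//; near: n.
  by move/cvgr0Pnorm_le : geo; exact.
- apply: filter_forall => j.
  have := @ae_cvg0_of_summable R _ _ mu
    (fun n x => `|quot i (t n) (u j) x - h j x| * \1_(cube n%:R) x).
  move=> /(_ (fun n x => mulr_ge0 (normr_ge0 _) (indic_cube_ge0 _ _))).
  move=> /(_ (fun n => loc_integrable_cube _ (Lq n j))).
  have Ht3 n := let: And3 _ _ h := Ht n in h j.
  move=> /(_ Ht3).
  apply: filterS => x cx; have [k xk] := ge_nat `|x|.
  apply/cvgrPdist_le => e e0; near=> n.
  rewrite distrC.
  have xn : cube n%:R x.
    apply: le_cube (@cube_normr _ _ x); rewrite (le_trans xk)// ler_nat.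
    by near: n; exact: nbhs_infty_ge.
  rewrite -[leLHS]mulr1 -(indic_cube1 xn) -[leLHS]ger0_norm; last first.
    by rewrite mulr_ge0// indic_cube_ge0.
  near: n; move/cvgr0Pnorm_le : cx; exact.
Unshelve. all: by end_near. Qed.

Lemma test_quot_cvg i (phi : E -> R) (t : nat -> R) x : test_function phi ->
  (forall n, t n != 0) -> t n @[n --> \oo] --> 0 ->
  quot i (t n) phi x @[n --> \oo] --> partial i phi x.
Proof.
move=> [Cphi _] tn0 t0; have [df _] := Ck_is_derive i x (Cphi 1%N).
have H : (fun n => quot i (t n) phi x) =
  (fun h : R => h^-1 *: ((phi \o shift x) (h *: delta_mx 0 i) - phi x)) \o t.
  apply/funext => n /=; rewrite /quot mulrC.
  by congr (_ * (phi _ - _)); rewrite addrC.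
rewrite H; apply: cvg_comp; last exact: df.
move=> A [e /= e0 HA]; have /cvgr0Pnorm_lt/(_ _ e0) := t0.
apply: filterS => n te; apply: HA => //=; by rewrite sub0r normrN.
Qed.

Lemma test_quot_dom i (phi : E -> R) : test_function phi -> exists C, exists n : nat,
  0 <= C /\ forall t x, t != 0 -> `|t| <= 1 -> `|quot i t phi x| <= C * \1_(cube n%:R) x.
Proof.
move=> tphi; have td := test_partial i tphi.
have [C [n [C0 HC]]] := test_dom td.
exists C, n.+1; split=> // t x t0 t1.
have [I1 E1] := test_FTC i x t tphi.
rewrite /quot -E1 normrM normfV ler_pdivrMr ?normr_gt0//.
apply: le_trans (rint_norm I1) _.
rewrite -[leRHS]mulr1 -[X in _ <= _ * X](@rint_unit_itv1 R) -rintZ; last exact: itg_unit_itv.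
apply: rint_le => [||s].
- exact: itg_norm.
- by apply: itgZ; exact: itg_unit_itv.
rewrite !normrM (ger0_norm (unit_itv_ge0 _)) [leRHS]mulrC.
have [->|ws] := eqVneq (unit_itv s) 0; first by rewrite !mul0r.
rewrite ler_wpM2l ?unit_itv_ge0// [leRHS]mulrC ler_wpM2l//.
apply: (le_trans (HC _)); rewrite ler_wpM2l//; apply: le_indic_cube => xc.
rewrite -(addrK ((t * s) *: delta_mx 0 i) x) -natr1; apply: cubeD => //.
by apply: cubeN; apply: le_cube t1 _ _; exact: (@cube_seg R p i t s ws).
Qed.

(* No differentiability of [F] as a function of the [u j] is assumed: clamping the
   quotients of [F] between [- H] and [H] makes them dominated, and the error is
   controlled by the L1 distance between the quotients of the [u j] and the [h j]. *)
Lemma weak_partial_chain (I : finType) i (u h : I -> E -> R) (F G : E -> R) (C : R) :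
  (forall j, weak_partial i (u j) (h j)) -> loc_integrable F ->
  measurable_fun setT G -> 0 <= C ->
  (forall x z, `|F (x + z) - F x| <= C * \sum_j `|u j (x + z) - u j x|) ->
  (forall x, `|G x| <= C * \sum_j `|h j x|) ->
  (forall (t : nat -> R) x, (forall n, t n != 0) -> t n @[n --> \oo] --> 0 ->
     (forall j, quot i (t n) (u j) x @[n --> \oo] --> h j x) ->
     quot i (t n) F x @[n --> \oo] --> G x) ->
  weak_partial i F G.
Proof.
move=> W LF mG C0 HF HG HFG.
pose H x := C * \sum_j `|h j x|.
have H0 x : 0 <= H x by rewrite mulr_ge0// sumr_ge0.
have Lh j : loc_integrable (h j) by have [] := W j.
have Lu j : loc_integrable (u j) by have [] := W j.
have LH : loc_integrable H.
  by apply: loc_integrableZ; apply: loc_integrable_sum => j; exact: loc_integrable_norm.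
have LG : loc_integrable G by exact: loc_integrable_le LH.
have mH := loc_integrable_measurable LH.
apply: weak_partial_intro => // phi tphi.
have [t [tn0' t0 tL1 tae]] := quot_ae_seq W.
have tn0 n : t n != 0 by have [] := tn0' n.
have tn1 n : `|t n| <= 1 by have [] := tn0' n.
have [Cp [np [Cp0 HCp]]] := test_dom tphi.
have LqF n : loc_integrable (quot i (t n) F) by exact: loc_integrable_quot.
have IqF n : itg mu (fun x => quot i (t n) F x * phi x) by exact: itg_test.
have lhs : rint mu (fun x => quot i (t n) F x * phi x) @[n --> \oo] -->
    - rint mu (fun x => F x * partial i phi x).
  have E1 n : itg mu (fun x => F x * quot i (- t n) phi x) /\
      rint mu (fun x => quot i (t n) F x * phi x) =
      - rint mu (fun x => F x * quot i (- t n) phi x).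
    have tps := test_shift (- (t n *: delta_mx 0 i)) tphi.
    have I1 : itg mu (fun x => F x * phi x) by exact: itg_test.
    have I2 : itg mu (fun x => F x * phi (x - t n *: delta_mx 0 i)) by exact: itg_test.
    have I3 : itg mu (fun x => F (x + t n *: delta_mx 0 i) * phi x).
      by apply: itg_test => //; exact: loc_integrable_shift.
    have I4 : itg mu (fun x => F x * quot i (- t n) phi x).
      apply: (eq_itg _ (itgZ (- (t n)^-1) (itgB I2 I1))) => x.
      by rewrite /quot scaleNr invrN; ring.
    split => //.
    transitivity ((t n)^-1 * (rint mu (fun x => F (x + t n *: delta_mx 0 i) * phi x) -
        rint mu (fun x => F x * phi x))).
      rewrite -rintB// -rintZ; last exact: itgB.
      by apply: eq_rint => x; rewrite /quot; ring.
    transitivity ((t n)^-1 * (rint mu (fun x => F x * phi (x - t n *: delta_mx 0 i)) -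
        rint mu (fun x => F x * phi x))).
      congr (_ * (_ - _)).
      rewrite -(rint_shift (t n *: delta_mx 0 i) (itg_measurable I2)).
      by apply: eq_rint => x; rewrite addrK.
    rewrite -rintB// -rintZ; last exact: itgB.
    rewrite -rintN//.
    by apply: eq_rint => x; rewrite /quot scaleNr invrN; ring.
  under eq_fun do rewrite (E1 _).2.
  apply: cvgN.
  have [Cq [nq [Cq0 HCq]]] := test_quot_dom i tphi.
  have Nt0 : - t n @[n --> \oo] --> 0 by rewrite -[X in _ --> X]oppr0; exact: cvgN.
  have Ntn0 n : - t n != 0 by rewrite oppr_eq0.
  have [] := @rint_dct _ _ _ mu (fun n x => F x * quot i (- t n) phi x)
    (fun x => F x * partial i phi x) (fun x => Cq * `|F x * \1_(cube nq%:R) x|).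
  - by move=> n; exact: itg_measurable (E1 n).1.
  - by apply: itg_measurable; apply: itg_test => //; exact: test_partial.
  - by apply/itgZ/itg_norm; exact: loc_integrable_cube.
  - move=> n x; rewrite normrM (normrM (F x) (\1__ x)) mulrCA.
    rewrite (ger0_norm (indic_cube_ge0 _ _)).
    by apply: ler_wpM2l => //; apply: HCq; rewrite ?normrN.
  - apply: aeW => x; apply: cvgM; first exact: cvg_cst.
    exact: test_quot_cvg.
  - by [].
pose D n x := C * \sum_j `|quot i (t n) (u j) x - h j x|.
have LD n : loc_integrable (D n).
  apply: loc_integrableZ; apply: loc_integrable_sum => j; apply: loc_integrable_norm.
  by apply: loc_integrableB => //; exact: loc_integrable_quot.
pose cl n x := Num.max (- H x) (Num.min (H x) (quot i (t n) F x)).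
have mcl n : measurable_fun setT (cl n).
  apply: measurable_maxr; first exact: measurableT_comp.
  apply: measurable_minr => //; exact: loc_integrable_measurable.
have cl_le n x : `|cl n x| <= H x.
  by have [] := clamp_spec (quot i (t n) F x) (H0 x).
have cl_G n x : `|cl n x - G x| <= `|quot i (t n) F x - G x|.
  by have [_ + _] := clamp_spec (quot i (t n) F x) (H0 x); apply; exact: HG.
have cl_q n x : `|quot i (t n) F x - cl n x| <= D n x.
  have q1 : `|quot i (t n) F x| <= H x + D n x.
    rewrite /quot normrM normfV ler_pdivrMr ?normr_gt0//.
    apply: le_trans (HF _ _) _; rewrite /H /D -mulrDr -mulrA ler_wpM2l//.
    rewrite -big_split/= mulr_suml; apply: ler_sum => j _.
    rewrite -ler_pdivrMr ?normr_gt0// -normfV -normrM -/(quot i (t n) (u j) x).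
    rewrite addrC -[X in `|X| <= _](subrK (h j x)).
    exact: ler_normD.
  have D0 : 0 <= D n x by rewrite mulr_ge0// sumr_ge0.
  by have [_ _] := clamp_spec (quot i (t n) F x) (H0 x); apply.
have Lcl n : loc_integrable (cl n) by exact: loc_integrable_le LH.
have Icl n : itg mu (fun x => cl n x * phi x) by exact: itg_test.
have rhs1 : rint mu (fun x => cl n x * phi x) @[n --> \oo] --> rint mu (fun x => G x * phi x).
  have [] := @rint_dct _ _ _ mu (fun n x => cl n x * phi x)
    (fun x => G x * phi x) (fun x => `|H x * phi x|).
  - by move=> n; exact: itg_measurable (Icl n).
  - by apply: measurable_funM => //; exact: test_measurable.
  - by apply: itg_norm; exact: itg_test.
  - by move=> n x; rewrite (normrM (cl n x)) (normrM (H x)) ler_wpM2r// (ger0_norm (H0 x)).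
  - apply: filterS tae => x hx; apply: cvgM; last exact: cvg_cst.
    have /cvgrPdist_le cq := HFG t x tn0 t0 hx.
    apply/cvgrPdist_le => e e0; apply: filterS (cq e e0) => n.
    by rewrite !(distrC (G x)); apply: le_trans.
  - by [].
have rhs2 : rint mu (fun x => (quot i (t n) F x - cl n x) * phi x) @[n --> \oo] --> 0.
  apply/norm_cvg0P.
  apply: (cvg0_le (v := fun n => Cp * (C * \sum_j
     rint mu (fun x => `|quot i (t n) (u j) x - h j x| * \1_(cube np%:R) x)))); last first.
    rewrite -[X in _ --> X](mulr0 Cp); apply: cvgM; first exact: cvg_cst.
    rewrite -[X in _ --> X](mulr0 C); apply: cvgM; first exact: cvg_cst.
    rewrite [X in _ --> X](_ : _ = \sum_(j : I) 0); last by rewrite big1.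
    by apply: cvgn_sum => j; exact: tL1.
  move=> n; rewrite normr_ge0/=.
  have Id : itg mu (fun x => (quot i (t n) F x - cl n x) * phi x).
    by apply: itg_test => //; exact: loc_integrableB.
  apply: le_trans (rint_norm Id) _.
  have Lj j : itg mu (fun x => `|quot i (t n) (u j) x - h j x| * \1_(cube np%:R) x).
    apply: loc_integrable_cube; apply: loc_integrable_norm.
    by apply: loc_integrableB => //; exact: loc_integrable_quot.
  rewrite -rint_sum// -rintZ; last exact: itg_sum.
  rewrite -rintZ; last by apply: itgZ; exact: itg_sum.
  apply: rint_le => [||x]; first exact: itg_norm.
    by apply: itgZ; apply: itgZ; exact: itg_sum.
  rewrite normrM (le_trans (ler_pM _ _ (cl_q n x) (HCp x)))//.
  by rewrite /D mulrCA -mulrA -mulr_suml.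
have rhs : rint mu (fun x => quot i (t n) F x * phi x) @[n --> \oo] --> rint mu (fun x => G x * phi x).
  rewrite -[X in _ --> X]addr0.
  have -> : (fun n => rint mu (fun x => quot i (t n) F x * phi x)) =
      (fun n => rint mu (fun x => cl n x * phi x) +
        rint mu (fun x => (quot i (t n) F x - cl n x) * phi x)).
    apply/funext => n; rewrite -rintD//; last by apply: itg_test => //; exact: loc_integrableB.
    by apply: eq_rint => x; ring.
  exact: cvgD.
by apply: oppr_inj; rewrite opprK; apply: cvg_unique lhs rhs.
Qed.

End chain_rule.

(** * Chain rules *)

Section quotient_calculus.
Context {R : realType} {p : nat}.
Notation E := 'rV[R]_p.
Notation mu := (@lebesgue_rV R p).
Implicit Types (f g u h v w : E -> R) (x y z a : E) (i : 'I_p) (t : nat -> R).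

Definition qcvg i t u x (d : R) := quot i (t n) u x @[n --> \oo] --> d.

Section sequence.
Variables (i : 'I_p) (t : nat -> R) (x : E).
Hypotheses (tn0 : forall n, t n != 0) (t0 : t n @[n --> \oo] --> 0).

Lemma eq_qcvg u v d : (forall n, u (x + t n *: delta_mx 0 i) = v (x + t n *: delta_mx 0 i)) ->
  u x = v x -> qcvg i t u x d -> qcvg i t v x d.
Proof.
by move=> H0 H1; rewrite /qcvg; under eq_fun do rewrite /quot H0 H1.
Qed.

Lemma qcvg_shift u d : qcvg i t u x d ->
  u (x + t n *: delta_mx 0 i) @[n --> \oo] --> u x.
Proof.
move=> H; have -> : (fun n => u (x + t n *: delta_mx 0 i)) =
    (fun n => u x + t n * quot i (t n) u x).
  by apply/funext => n; rewrite /quot [t n * _]mulrC divfK// [RHS]addrC subrK.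
rewrite -[X in _ --> X]addr0; apply: cvgD; first exact: cvg_cst.
by rewrite -[X in _ --> X](mul0r d); apply: cvgM.
Qed.

Lemma qcvg_cst (c : R) : qcvg i t (fun=> c) x 0.
Proof. by rewrite /qcvg /quot; under eq_fun do rewrite subrr mul0r; exact: cvg_cst. Qed.

Lemma qcvgD u v d e : qcvg i t u x d -> qcvg i t v x e ->
  qcvg i t (fun y => u y + v y) x (d + e).
Proof.
move=> Hu Hv; rewrite /qcvg.
rewrite (_ : (fun n => _) = (fun n => quot i (t n) u x + quot i (t n) v x)).
  exact: cvgD.
by apply/funext => n; rewrite /quot -mulrDl; congr (_ / _); ring.
Qed.

Lemma qcvgM u v d e : qcvg i t u x d -> qcvg i t v x e ->
  qcvg i t (fun y => u y * v y) x (d * v x + u x * e).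
Proof.
move=> Hu Hv; rewrite /qcvg.
rewrite (_ : (fun n => _) = (fun n => quot i (t n) u x * v (x + t n *: delta_mx 0 i) +
    u x * quot i (t n) v x)).
  apply: cvgD; apply: cvgM => //; [exact: qcvg_shift Hv|exact: cvg_cst].
by apply/funext => n; rewrite /quot; ring.
Qed.

Lemma qcvg_sum (I : finType) (u : I -> E -> R) (d : I -> R) :
  (forall j, qcvg i t (u j) x (d j)) -> qcvg i t (fun y => \sum_j u j y) x (\sum_j d j).
Proof.
move=> H; rewrite /qcvg.
rewrite (_ : (fun n => _) = (fun n => \sum_j quot i (t n) (u j) x)).
  exact: cvgn_sum.
by apply/funext => n; rewrite /quot -sumrB mulr_suml.
Qed.

Lemma qcvgV u d : (forall y, u y != 0) -> qcvg i t u x d ->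
  qcvg i t (fun y => (u y)^-1) x (- d / (u x ^+ 2)).
Proof.
move=> u0 Hu; rewrite /qcvg.
rewrite (_ : (fun n => _) = (fun n => - quot i (t n) u x *
   ((u (x + t n *: delta_mx 0 i))^-1 * (u x)^-1))).
  rewrite expr2 invfM; apply: cvgM; first exact: cvgN.
  apply: cvgM; last exact: cvg_cst.
  by apply: cvgV => //; exact: qcvg_shift Hu.
apply/funext => n; rewrite /quot.
by field; rewrite tn0 !u0.
Qed.

Lemma qcvg_comp (f : R -> R) (df : R) u d :
  is_derive (u x) (1 : R) f df -> qcvg i t u x d ->
  qcvg i t (fun y => f (u y)) x (df * d).
Proof.
move=> Df Hu.
pose q (h : R) : R := if h == 0 then df else (f (h + u x) - f (u x)) / h.
have q0 : q h @[h --> 0] --> df.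
  have H := @ex_derive _ _ _ _ _ _ _ Df; have E := @derive_val _ _ _ _ _ _ _ Df.
  move: H; rewrite /derivable => H.
  have {}H : h^-1 *: ((f \o shift (u x)) (h *: (1 : R)) - f (u x)) @[h --> 0^'] --> df.
    by rewrite -E; exact: H.
  apply/cvgrPdist_le => e e0; move/cvgrPdist_le : H => /(_ e e0).
  rewrite near_withinE; apply: filterS => h Hh.
  rewrite /q; case: eqVneq => [_|h0]; first by rewrite subrr normr0 ltW.
  by move: (Hh h0); rewrite /= /GRing.scale/= mulr1 (mulrC h^-1).
have D n : u (x + t n *: delta_mx 0 i) - u x = t n * quot i (t n) u x.
  by rewrite /quot mulrC divfK.
have D0 : u (x + t n *: delta_mx 0 i) - u x @[n --> \oo] --> 0.
  rewrite -[X in _ --> X](subrr (u x)); apply: cvgB; last exact: cvg_cst.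
  exact: qcvg_shift Hu.
rewrite /qcvg.
rewrite (_ : (fun n => _) = (fun n => q (u (x + t n *: delta_mx 0 i) - u x) * quot i (t n) u x)).
  by apply: cvgM => //; exact: (cvg_comp _ _ D0 q0).
apply/funext => n; rewrite /quot /q; case: eqVneq => [h0|h0].
  rewrite h0 mul0r mulr0.
  by move/eqP : h0; rewrite subr_eq0 => /eqP ->; rewrite subrr mul0r.
by rewrite subrK mulrA divfK.
Qed.

End sequence.
End quotient_calculus.

Lemma lipschitz_ge0 (R : realType) (f df : R -> R) (C : R) :
  (forall s : R, is_derive s (1 : R) f (df s)) -> (forall s, 0 <= s -> `|df s| <= C) ->
  forall a b, 0 <= a -> 0 <= b -> `|f a - f b| <= C * `|a - b|.
Proof.
move=> Df HC.
have cf : continuous f := is_derive_continuous Df.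
have key a b : 0 <= a -> a <= b -> `|f b - f a| <= C * `|b - a|.
  move=> a0 ab.
  have [c] := @MVT_segment R f df a b ab (fun s _ => Df s) (continuous_subspaceT cf).
  rewrite in_itv/= => /andP[ac _] ->.
  by rewrite normrM ler_wpM2r// HC// (le_trans a0).
move=> a b a0 b0; have [ab|/ltW ba] := leP a b; last exact: key.
by rewrite distrC (distrC a); exact: key.
Qed.

Section scalar_chain.
Context {R : realType} {p : nat}.
Notation E := 'rV[R]_p.
Notation mu := (@lebesgue_rV R p).
Implicit Types (f g u h v w : E -> R) (x y z a : E) (i : 'I_p) (t : nat -> R).

Lemma weak_partial_comp i (f df : R -> R) (C : R) u h : weak_partial i u h ->
  (forall x, 0 <= u x) ->
  (forall s : R, is_derive s (1 : R) f (df s)) -> continuous df ->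
  (forall s, 0 <= s -> `|df s| <= C) ->
  weak_partial i (fun x => f (u x)) (fun x => df (u x) * h x).
Proof.
move=> W u0 Df cdf HC; have [Lu Lh _] := W.
have mu' := loc_integrable_measurable Lu; have mh := loc_integrable_measurable Lh.
have C0 : 0 <= C by apply: le_trans (HC 0 _).
have mf : measurable_fun setT f.
  by apply: continuous_measurable_fun; exact: is_derive_continuous Df.
have mdf : measurable_fun setT df by exact: continuous_measurable_fun.
have Lip := lipschitz_ge0 Df HC.
apply: (@weak_partial_chain _ _ unit i (fun=> u) (fun=> h) _ _ C) => //.
- apply: (@loc_integrable_le _ _ _ (fun x => `|f 0| + C * `|u x|)).
  + exact: measurableT_comp.
  + move=> x; rewrite -[X in `|X|](subrK (f 0)) addrC (le_trans (ler_normD _ _))//.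
    by rewrite lerD2l -[X in C * `|X|]subr0 Lip.
  + apply: loc_integrableD; last by apply: loc_integrableZ; exact: loc_integrable_norm.
    by apply: loc_integrable_bounded => // x; rewrite normr_id.
- by apply: measurable_funM => //; exact: measurableT_comp.
- by move=> x z; rewrite big_const card_unit/= addr0; exact: Lip.
- by move=> x; rewrite big_const card_unit/= addr0 normrM ler_wpM2r// HC.
- by move=> t x tn0 t0 /(_ tt) H; exact: (qcvg_comp tn0 t0 (Df _) H).
Qed.

Lemma weak_partialZ i (k : R) u h : weak_partial i u h ->
  weak_partial i (fun x => k * u x) (fun x => k * h x).
Proof.
move=> W; have [Lu Lh _] := W.
apply: weak_partial_intro; [exact: loc_integrableZ..|move=> phi tphi].
have Iu : itg mu (fun x => u x * partial i phi x).
  by apply: itg_test => //; exact: test_partial.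
have Ih : itg mu (fun x => h x * phi x) by exact: itg_test.
transitivity (k * rint mu (fun x => u x * partial i phi x)).
  by rewrite -rintZ//; apply: eq_rint => x; rewrite mulrA.
rewrite (weak_partialP W tphi) mulrN -rintZ//; congr (- _).
by apply: eq_rint => x; rewrite mulrA.
Qed.

Lemma is_derive_expNl (l s : R) :
  is_derive s (1 : R) (fun s => expR (- l * s)) (- l * expR (- l * s)).
Proof.
have H : is_derive s (1 : R) (fun s : R => - l * s) (- l).
  by apply: is_derive_eq; rewrite /GRing.scale/= mulr1.
have := is_derive1_comp (is_derive_expR (- l * s)) H.
by rewrite mulrC.
Qed.

Lemma expNl_le1 (l s : R) : 0 <= l -> 0 <= s -> expR (- l * s) <= 1.
Proof. by move=> l0 s0; rewrite -expR0 ler_expR mulNr oppr_le0 mulr_ge0. Qed.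

Lemma weak_partial_expN i (l : R) w h : weak_partial i w h -> (forall x, 0 <= w x) ->
  0 <= l ->
  weak_partial i (fun x => expR (- l * w x)) (fun x => - l * expR (- l * w x) * h x).
Proof.
move=> W w0 l0.
apply: (@weak_partial_comp i (fun s => expR (- l * s)) (fun s => - l * expR (- l * s)) l) => //.
- exact: is_derive_expNl.
- move=> s; apply: cvgM; first exact: cvg_cst.
  exact: (is_derive_continuous (is_derive_expNl l)).
- move=> s s0; rewrite normrM normrN (ger0_norm l0) (ger0_norm (expR_ge0 _)).
  by rewrite ler_piMr// expNl_le1.
Qed.

Definition damp (l s : R) : R := s * expR (- l * s).

Lemma is_derive_damp (l s : R) :
  is_derive s (1 : R) (damp l) ((1 - l * s) * expR (- l * s)).
Proof.
have H := is_derive_expNl l s.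
have K := is_deriveM (is_derive_id s (1 : R)) H.
rewrite (_ : (1 - l * s) * _ = s *: (- l * expR (- l * s)) + (expR (- l * s))%:A)//.
by rewrite /GRing.scale/=; ring.
Qed.

Lemma damp_ge0 l s : 0 <= s -> 0 <= damp l s.
Proof. by move=> s0; rewrite mulr_ge0// expR_ge0. Qed.

Lemma damp_le l s : 0 <= l -> 0 <= s -> damp l s <= s.
Proof. by move=> l0 s0; rewrite ler_piMr// expNl_le1. Qed.

Lemma damp_bounded l s : 0 < l -> damp l s <= l^-1.
Proof.
move=> l0; rewrite /damp mulNr expRN.
rewrite ler_pdivrMr ?expR_gt0//.
rewrite mulrC ler_pdivlMr// mulrC.
by apply: le_trans (expR_ge1Dx _); rewrite lerDr.
Qed.

Lemma damp_derive_le1 (l s : R) : 0 <= l -> 0 <= s -> `|(1 - l * s) * expR (- l * s)| <= 1.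
Proof.
move=> l0 s0; rewrite normrM (ger0_norm (expR_ge0 _)) mulNr expRN.
rewrite ler_pdivrMr ?expR_gt0// mul1r.
apply: le_trans (expR_ge1Dx _); have := mulr_ge0 l0 s0.
by rewrite ler_norml => h; apply/andP; split; lra.
Qed.

Lemma weak_partial_damp i (l : R) w h : weak_partial i w h -> (forall x, 0 <= w x) ->
  0 <= l ->
  weak_partial i (fun x => damp l (w x))
    (fun x => (1 - l * w x) * expR (- l * w x) * h x).
Proof.
move=> W w0 l0.
apply: (@weak_partial_comp i (damp l) (fun s => (1 - l * s) * expR (- l * s)) 1) => //.
- exact: is_derive_damp.
- move=> s; apply: cvgM; last exact: (is_derive_continuous (is_derive_expNl l)).
  apply: cvgB; first exact: cvg_cst.
  by apply: cvgM; [exact: cvg_cst|exact: cvg_id].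
- by move=> s s0; exact: damp_derive_le1.
Qed.

End scalar_chain.

Section vector_fields.
Context {R : realType} {p : nat}.
Notation E := 'rV[R]_p.
Notation mu := (@lebesgue_rV R p).
Implicit Types (u h v w : E -> R) (x y z a : E) (i : 'I_p).

Lemma weak_partialM i u h v k (Cu Cv : R) : weak_partial i u h -> weak_partial i v k ->
  (forall x, `|u x| <= Cu) -> (forall x, `|v x| <= Cv) ->
  weak_partial i (fun x => u x * v x) (fun x => h x * v x + u x * k x).
Proof.
move=> Wu Wv Bu Bv; have [Lu Lh _] := Wu; have [Lv Lk _] := Wv.
have [mu' mv mh mk] : [/\ measurable_fun setT u, measurable_fun setT v,
   measurable_fun setT h & measurable_fun setT k].
  by split; exact: loc_integrable_measurable.
have Cu0 : 0 <= Cu by apply: le_trans (Bu 0).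
have Cv0 : 0 <= Cv by apply: le_trans (Bv 0).
apply: (@weak_partial_chain _ _ bool i (fun b => if b then u else v)
  (fun b => if b then h else k) _ _ (Cu + Cv)).
- by case.
- apply: (@loc_integrable_bounded _ _ _ (Cu * Cv)); first exact: measurable_funM.
  by move=> x; rewrite normrM ler_pM.
- by apply: measurable_funD; exact: measurable_funM.
- exact: addr_ge0.
- move=> x z; rewrite big_bool/=.
  rewrite (_ : _ - _ = (u (x + z) - u x) * v (x + z) + u x * (v (x + z) - v x)); last by ring.
  rewrite (le_trans (ler_normD _ _))// [leRHS]mulrDr !normrM lerD//.
    by rewrite mulrC ler_wpM2r// (le_trans (Bv _))// lerDr.
  by rewrite ler_wpM2r// (le_trans (Bu _))// lerDl.
- move=> x; rewrite big_bool/= (le_trans (ler_normD _ _))// [leRHS]mulrDr !normrM lerD//.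
    by rewrite mulrC ler_wpM2r// (le_trans (Bv _))// lerDr.
  by rewrite ler_wpM2r// (le_trans (Bu _))// lerDl.
- by move=> t x tn0 t0 H; apply: qcvgM => //; [exact: (H true)|exact: (H false)].
Qed.

Lemma sqnormE (v : E) : sqnorm v = \sum_j v 0 j ^+ 2.
Proof. by apply: eq_bigr => j _; rewrite expr2. Qed.

Lemma sqnorm_ge0 (v : E) : 0 <= sqnorm v.
Proof. by rewrite sqnormE sumr_ge0// => j _; exact: sqr_ge0. Qed.

Lemma sqr_le_sqnorm (v : E) j : v 0 j ^+ 2 <= sqnorm v.
Proof.
by rewrite sqnormE (bigD1 j)//= lerDl sumr_ge0// => k _; exact: sqr_ge0.
Qed.

Lemma mul_le_sqnorm (v : E) j k : `|v 0 j| * `|v 0 k| <= sqnorm v.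
Proof.
have := sqr_le_sqnorm v j; have := sqr_le_sqnorm v k.
rewrite -!(real_normK (num_real (v 0 _))).
have : 0 <= (`|v 0 j| - `|v 0 k|) ^+ 2 by exact: sqr_ge0.
by rewrite sqrrB; lra.
Qed.

(* The truncation acts on the whole vector because, in the application, only the sum
   [DA . g] is integrable and not its separate terms. *)
Definition trunc (l : R) (v : E) : R := (1 + l * sqnorm v)^-1.

Section trunc.
Variable l : R.
Hypothesis l0 : 0 < l.
Let B := 1 + l^-1.

Let den_gt0 (v : E) : 0 < 1 + l * sqnorm v.
Proof. by rewrite ltr_pwDl// mulr_ge0 ?sqnorm_ge0// ltW. Qed.

Lemma trunc_ge0 (v : E) : 0 <= trunc l v.
Proof. by rewrite /trunc invr_ge0 ltW. Qed.

Lemma trunc_le1 (v : E) : trunc l v <= 1.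
Proof.
by rewrite /trunc invf_le1// lerDl mulr_ge0 ?sqnorm_ge0// ltW.
Qed.

Lemma trunc_mul_le1 (v : E) j k : l * (`|v 0 j| * `|v 0 k|) * trunc l v <= 1.
Proof.
rewrite /trunc ler_pdivrMr// mul1r (le_trans (ler_wpM2l (ltW l0) (mul_le_sqnorm v j k)))//.
by rewrite lerDr.
Qed.

Lemma trunc_coord_le (v : E) j : `|v 0 j| * trunc l v <= B.
Proof.
apply: (@le_trans _ _ ((1 + `|v 0 j| * `|v 0 j|) * trunc l v)).
  rewrite ler_wpM2r ?trunc_ge0//.
  have : 0 <= (`|v 0 j| - 1) ^+ 2 by exact: sqr_ge0.
  by have := normr_ge0 (v 0 j); rewrite sqrrB expr2; lra.
rewrite mulrDl mul1r lerD ?trunc_le1//.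
by rewrite -[leRHS]mulr1 ler_pdivlMl// mulrA trunc_mul_le1.
Qed.

Lemma trunc_lipschitz (v w : E) k :
  `|v 0 k * trunc l v - w 0 k * trunc l w| <= (2 + l * B ^+ 2) * \sum_j `|v 0 j - w 0 j|.
Proof.
have tD : trunc l v - trunc l w =
    \sum_j (w 0 j - v 0 j) * (l * (w 0 j + v 0 j) * (trunc l v * trunc l w)).
  have -> : trunc l v - trunc l w = l * (sqnorm w - sqnorm v) * (trunc l v * trunc l w).
    by rewrite /trunc; field; rewrite (gt_eqF (den_gt0 v)) (gt_eqF (den_gt0 w)).
  rewrite !sqnormE -sumrB mulr_sumr mulr_suml; apply: eq_bigr => j _.
  by ring.
have B0 : 0 <= B by rewrite addr_ge0// invr_ge0 ltW.
rewrite (_ : _ - _ = (v 0 k - w 0 k) * trunc l v + w 0 k * (trunc l v - trunc l w)); last by ring.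
rewrite (le_trans (ler_normD _ _))//.
rewrite (_ : 2 + _ = 1 + (1 + l * B ^+ 2)); last by ring.
rewrite [leRHS]mulrDl lerD//.
  rewrite normrM (ger0_norm (trunc_ge0 _)) mul1r.
  rewrite (bigD1 k)//= -[leLHS]addr0 lerD ?sumr_ge0//.
  by rewrite ler_piMr// trunc_le1.
rewrite tD normrM (le_trans (ler_wpM2l (normr_ge0 _) (ler_norm_sum _ _ _)))//.
rewrite !mulr_sumr; apply: ler_sum => j _.
rewrite normrM mulrCA (distrC (w 0 j)) mulrC ler_wpM2r//.
rewrite !normrM (ger0_norm (trunc_ge0 v)) (ger0_norm (trunc_ge0 w)) (ger0_norm (ltW l0)).
apply: (@le_trans _ _ (`|w 0 k| * (l * (`|w 0 j| + `|v 0 j|) * (trunc l v * trunc l w)))).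
  rewrite ler_wpM2l// ler_wpM2r ?mulr_ge0 ?trunc_ge0// ler_wpM2l ?(ltW l0)//.
  exact: ler_normD.
rewrite (_ : `|w 0 k| * _ = l * (`|w 0 k| * `|w 0 j|) * trunc l w * trunc l v +
   l * ((`|w 0 k| * trunc l w) * (`|v 0 j| * trunc l v))); last by ring.
rewrite lerD//.
  rewrite -[leRHS]mulr1 ler_pM ?trunc_le1 ?trunc_ge0 ?trunc_mul_le1//.
  by rewrite !mulr_ge0// ?trunc_ge0// ltW.
rewrite ler_wpM2l ?(ltW l0)// expr2 ler_pM ?trunc_coord_le//.
all: by rewrite mulr_ge0// trunc_ge0.
Qed.

Lemma measurable_trunc (g : E -> E) : (forall j, measurable_fun setT (fun x => g x 0 j)) ->
  measurable_fun setT (fun x => trunc l (g x)).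
Proof.
move=> mg; rewrite (_ : (fun x => _) = (fun s => (1 + l * `|s|)^-1) \o (fun x => sqnorm (g x))).
  apply: measurableT_comp.
    apply: continuous_measurable_fun => s; apply: cvgV.
      by rewrite gt_eqF// ltr_pwDl// mulr_ge0// ltW.
    apply: cvgD; first exact: cvg_cst.
    by apply: cvgM; [exact: cvg_cst|apply: cvg_norm; exact: cvg_id].
  rewrite (_ : (fun x => _) = (fun x => \sum_j g x 0 j ^+ 2)).
    by apply: measurable_sum => j; exact: measurable_funX.
  by apply/funext => x; rewrite sqnormE.
by apply/funext => x/=; rewrite ger0_norm// sqnorm_ge0.
Qed.

Lemma weak_partial_trunc (g : E -> E) (J : E -> 'M[R]_p) i k : weak_jacobian g J ->
  weak_partial i (fun x => g x 0 k * trunc l (g x))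
    (fun x => J x k i * trunc l (g x) -
       2 * l * (\sum_j g x 0 k * g x 0 j * J x j i) * trunc l (g x) ^+ 2).
Proof.
move=> Wg.
have mg j : measurable_fun setT (fun x => g x 0 j).
  by have [/loc_integrable_measurable] := Wg j i.
have mJ j : measurable_fun setT (fun x => J x j i).
  by have [_ /loc_integrable_measurable] := Wg j i.
have B0 : 0 <= B by rewrite addr_ge0// invr_ge0 ltW.
have lB0 : 0 <= l * B ^+ 2 by rewrite mulr_ge0 ?sqr_ge0// ltW.
apply: (@weak_partial_chain _ _ 'I_p i (fun j x => g x 0 j) (fun j x => J x j i)
  _ _ (3 + l * B ^+ 2)).
- by move=> j; exact: Wg.
- apply: (@loc_integrable_bounded _ _ _ B).
    by apply: measurable_funM => //; exact: measurable_trunc.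
  by move=> x; rewrite normrM (ger0_norm (trunc_ge0 _)) trunc_coord_le.
- apply: measurable_funB.
    by apply: measurable_funM => //; exact: measurable_trunc.
  apply: measurable_funM; last by apply: measurable_funX; exact: measurable_trunc.
  apply: measurable_funM; first exact: measurable_cst.
  apply: measurable_sum => j; apply: measurable_funM => //; exact: measurable_funM.
- lra.
- move=> x z; apply: le_trans (trunc_lipschitz _ _ _) _.
  by rewrite ler_wpM2r ?sumr_ge0//; lra.
- move=> x; apply: (@le_trans _ _ ((1 + 2) * \sum_j `|J x j i|)); last first.
    by rewrite ler_wpM2r ?sumr_ge0//; lra.
  rewrite (le_trans (ler_normB _ _))// [leRHS]mulrDl mul1r lerD//.
    rewrite normrM (ger0_norm (trunc_ge0 _)) (bigD1 k)//= -[leLHS]addr0 lerD ?sumr_ge0//.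
    by rewrite ler_piMr// trunc_le1.
  rewrite -2!mulrA normrM ger0_norm// ler_wpM2l//.
  rewrite mulr_suml mulr_sumr (le_trans (ler_norm_sum _ _ _))//; apply: ler_sum => j _.
  rewrite (_ : _ * _ = (l * (g x 0 k * g x 0 j) * trunc l (g x)) * trunc l (g x) * J x j i);
    last by rewrite expr2; ring.
  rewrite normrM ler_piMl// normrM (ger0_norm (trunc_ge0 _)).
  rewrite mulr_ile1 ?trunc_ge0 ?trunc_le1//.
  by rewrite !normrM (ger0_norm (trunc_ge0 _)) (ger0_norm (ltW l0)) trunc_mul_le1.
- move=> t x tn0 t0 H.
  have Hs : qcvg i t (fun y => 1 + l * sqnorm (g y)) x
      (0 + (0 * sqnorm (g x) + l * \sum_j (J x j i * g x 0 j + g x 0 j * J x j i))).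
    apply: qcvgD; first exact: qcvg_cst.
    apply: (qcvgM tn0 t0 (u := fun=> l)); first exact: qcvg_cst.
    by apply: (qcvg_sum (u := fun j y => g y 0 j * g y 0 j)) => j; apply: qcvgM => //; exact: H.
  have den0 y : 1 + l * sqnorm (g y) != 0 by rewrite gt_eqF.
  have := qcvgM tn0 t0 (H k) (qcvgV tn0 t0 den0 Hs).
  congr (qcvg _ _ _ _ _).
  rewrite -/(trunc l (g x)) add0r mul0r add0r exprVn.
  have -> : \sum_j (J x j i * g x 0 j + g x 0 j * J x j i) = 2 * \sum_j g x 0 j * J x j i.
    by rewrite mulr_sumr; apply: eq_bigr => j _; ring.
  have -> : \sum_j g x 0 k * g x 0 j * J x j i = g x 0 k * \sum_j g x 0 j * J x j i.
    by rewrite mulr_sumr; apply: eq_bigr => j _; ring.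
  by ring.
Qed.

End trunc.

Lemma rint_by_parts_trunc (A : E -> R) (DA g : E -> E) (J : E -> 'M[R]_p) (C l : R) psi :
  weak_gradient A DA -> weak_jacobian g J -> (forall x, `|A x| <= C) -> 0 < l ->
  test_function psi ->
  rint mu (fun x => A x * (\sum_i g x 0 i * partial i psi x) * trunc l (g x)) =
  - rint mu (fun x => ((dotV (DA x) (g x) + A x * \tr (J x)) * trunc l (g x) -
     2 * l * A x * (\sum_i \sum_j g x 0 i * g x 0 j * J x j i) * trunc l (g x) ^+ 2) * psi x).
Proof.
move=> WA Wg HA l0 tpsi.
have tb i x : `|g x 0 i * trunc l (g x)| <= 1 + l^-1.
  by rewrite normrM (ger0_norm (trunc_ge0 l0 _)) trunc_coord_le.
have W i := weak_partialM (WA i) (weak_partial_trunc l0 i i Wg) HA (tb i).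
have I1 i : itg mu (fun x => A x * (g x 0 i * trunc l (g x)) * partial i psi x).
  by apply: itg_test; [have [] := W i|exact: test_partial].
have I2 i : itg mu (fun x => (DA x 0 i * (g x 0 i * trunc l (g x)) + A x *
    (J x i i * trunc l (g x) - 2 * l * (\sum_j g x 0 i * g x 0 j * J x j i) *
       trunc l (g x) ^+ 2)) * psi x).
  by apply: itg_test; [have [] := W i|].
transitivity (\sum_i rint mu (fun x => A x * (g x 0 i * trunc l (g x)) * partial i psi x)).
  rewrite -rint_sum//; apply: eq_rint => x.
  by rewrite mulr_sumr mulr_suml; apply: eq_bigr => i _; ring.
under eq_bigr do rewrite (weak_partialP (W _) tpsi).
rewrite sumrN -rint_sum//; congr (- _); apply: eq_rint => x.
rewrite -mulr_suml; congr (_ * _); rewrite big_split/=.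
rewrite (mulrDl (dotV _ _)) -[RHS]addrA; congr (_ + _).
  by rewrite mulr_suml; apply: eq_bigr => i _; ring.
rewrite !mulr_sumr 2!mulr_suml -sumrB; apply: eq_bigr => i _.
by ring.
Qed.

End vector_fields.

(** * Integration by parts for vector fields *)

Section integration_by_parts.
Context {R : realType} {p : nat}.
Notation E := 'rV[R]_p.
Notation mu := (@lebesgue_rV R p).
Implicit Types (u h v w : E -> R) (x y z a : E) (i : 'I_p).

Lemma measurable_dotV (f g : E -> E) : (forall j, measurable_fun setT (fun x => f x 0 j)) ->
  (forall j, measurable_fun setT (fun x => g x 0 j)) ->
  measurable_fun setT (fun x => dotV (f x) (g x)).
Proof. by move=> mf mg; apply: measurable_sum => j; exact: measurable_funM. Qed.

Lemma measurable_mxtrace (J : E -> 'M[R]_p) : (forall j i, measurable_fun setT (fun x => J x j i)) ->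
  measurable_fun setT (fun x => \tr (J x)).
Proof. by move=> mJ; apply: measurable_sum => j; exact: mJ. Qed.

Lemma weak_gradient_measurable u (D : E -> E) : weak_gradient u D ->
  forall j, measurable_fun setT (fun x => D x 0 j).
Proof. by move=> W j; have [_ /loc_integrable_measurable] := W j. Qed.

Lemma weak_jacobian_measurable (g : E -> E) (J : E -> 'M[R]_p) : weak_jacobian g J ->
  forall j i, measurable_fun setT (fun x => J x j i).
Proof. by move=> W j i; have [_ /loc_integrable_measurable] := W j i. Qed.

Lemma cvgn_invS : (n.+1%:R^-1 : R) @[n --> \oo] --> (0 : R).
Proof. exact: cvg_harmonic. Qed.

Section by_parts.
Variables (g : E -> E) (J : E -> 'M[R]_p) (psi : E -> R).
Hypotheses (Wg : weak_jacobian g J) (tpsi : test_function psi).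

Let mg j : measurable_fun setT (fun x => g x 0 j).
Proof. by have [/loc_integrable_measurable] := Wg j j. Qed.

Let mdir : measurable_fun setT (fun x => \sum_i g x 0 i * partial i psi x).
Proof.
apply: measurable_sum => j; apply: measurable_funM => //.
exact: test_measurable (test_partial j tpsi).
Qed.

Let Lg j : loc_integrable (fun x => g x 0 j). Proof. by have [] := Wg j j. Qed.
Let LJ j i : loc_integrable (fun x => J x j i). Proof. by have [] := Wg j i. Qed.

Lemma rint_by_parts (A : E -> R) (DA : E -> E) (C : R) :
  weak_gradient A DA -> (forall x, `|A x| <= C) ->
  itg mu (fun x => dotV (DA x) (g x) * psi x) ->
  rint mu (fun x => A x * \sum_i g x 0 i * partial i psi x) =
  - rint mu (fun x => (dotV (DA x) (g x) + A x * \tr (J x)) * psi x).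
Proof.
move=> WA HA IDg.
have mDA := weak_gradient_measurable WA.
have mJ := weak_jacobian_measurable Wg.
have [j0|p0] := pselect (exists j : 'I_p, True); last first.
  have no (F : 'I_p -> R) : \sum_j F j = 0.
    by rewrite big1// => j _; case: p0; exists j.
  rewrite (eq_rint _ (g := fun=> 0)); last by move=> x; rewrite no mulr0.
  rewrite [in RHS](eq_rint _ (g := fun=> 0)); last first.
    by move=> x; rewrite /dotV /mxtrace !no mulr0 addr0 mul0r.
  by rewrite rint0 oppr0.
have mA : measurable_fun setT A.
  by case: j0 => j _; have [/loc_integrable_measurable] := WA j.
have mpsi := test_measurable tpsi.
have C0 : 0 <= C by apply: le_trans (HA 0).
pose l (n : nat) : R := n.+1%:R^-1.
have l0 n : 0 < l n by rewrite invr_gt0.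
have cl : l n @[n --> \oo] --> 0 by exact: cvgn_invS.
pose th n x := trunc (l n) (g x).
have mth n : measurable_fun setT (th n) by exact: measurable_trunc.
have th0 n x : 0 <= th n x by exact: trunc_ge0.
have th1 n x : th n x <= 1 by exact: trunc_le1.
have cth x : th n x @[n --> \oo] --> (1 : R).
  rewrite -[X in _ --> X]invr1; apply: cvgV; first exact: oner_neq0.
  rewrite -[X in _ --> X]addr0; apply: cvgD; first exact: cvg_cst.
  rewrite -[X in _ --> X](mul0r (sqnorm (g x))).
  by apply: cvgM => //; exact: cvg_cst.
have ID1 : itg mu (fun x => C * \sum_i `|g x 0 i * partial i psi x|).
  apply/itgZ/itg_sum => i; apply/itg_norm/itg_test => //; exact: test_partial.
have [] := @rint_dct _ _ _ mu
  (fun n x => A x * (\sum_i g x 0 i * partial i psi x) * th n x)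
  (fun x => A x * \sum_i g x 0 i * partial i psi x)
  (fun x => C * \sum_i `|g x 0 i * partial i psi x|).
- by move=> n; apply: measurable_funM => //; exact: measurable_funM.
- exact: measurable_funM.
- exact: ID1.
- move=> n x; rewrite normrM (ger0_norm (th0 n x)) -[leRHS]mulr1 ler_pM//.
  by rewrite normrM ler_pM// ler_norm_sum.
- apply: aeW => x; rewrite -[X in _ --> X]mulr1.
  by apply: cvgM; [exact: cvg_cst|exact: cth].
move=> _ lhs.
pose S x := \sum_i \sum_j g x 0 i * g x 0 j * J x j i.
pose SJ x := \sum_i \sum_j `|J x j i|.
have mS : measurable_fun setT S.
  apply: measurable_sum => i; apply: measurable_sum => j.
  by apply: measurable_funM => //; exact: measurable_funM.
have LSJ : loc_integrable SJ.
  by do 2!apply: loc_integrable_sum => ?; exact: loc_integrable_norm.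
have SJ0 x : 0 <= SJ x by rewrite sumr_ge0// => ? _; rewrite sumr_ge0.
have S_le n x : l n * `|S x| * th n x <= SJ x.
  rewrite -mulrA mulrCA (le_trans (ler_wpM2r _ (ler_norm_sum _ _ _)))//.
    by rewrite mulr_ge0// ltW.
  rewrite mulr_suml; apply: ler_sum => i _.
  rewrite (le_trans (ler_wpM2r _ (ler_norm_sum _ _ _)))//.
    by rewrite mulr_ge0// ltW.
  rewrite mulr_suml; apply: ler_sum => j _.
  rewrite !normrM (_ : _ * _ = (l n * (`|g x 0 i| * `|g x 0 j|) * th n x) * `|J x j i|); last by ring.
  by rewrite ler_piMl// trunc_mul_le1.
have trle x : `|\tr (J x)| <= SJ x.
  rewrite (le_trans (ler_norm_sum _ _ _))//; apply: ler_sum => i _.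
  by rewrite (bigD1 i)//= lerDl sumr_ge0.
have [] := @rint_dct _ _ _ mu
  (fun n x => ((dotV (DA x) (g x) + A x * \tr (J x)) * th n x -
     2 * l n * A x * S x * th n x ^+ 2) * psi x)
  (fun x => (dotV (DA x) (g x) + A x * \tr (J x)) * psi x)
  (fun x => `|dotV (DA x) (g x) * psi x| + 3 * C * `|SJ x * psi x|).
- move=> n; apply: measurable_funM => //; apply: measurable_funB.
    apply: measurable_funM => //; apply: measurable_funD; first exact: measurable_dotV.
    by apply: measurable_funM => //; exact: measurable_mxtrace.
  apply: measurable_funM; last exact: measurable_funX.
  by apply: measurable_funM => //; apply: measurable_funM.
- apply: measurable_funM => //; apply: measurable_funD; first exact: measurable_dotV.
  by apply: measurable_funM => //; exact: measurable_mxtrace.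
- by apply: itgD; [exact: itg_norm|apply/itgZ/itg_norm; exact: itg_test].
- move=> n x; rewrite normrM (normrM (dotV _ _)) (normrM (SJ x)) [X in _ <= _ + X]mulrA -[leRHS]mulrDl ler_wpM2r//.
  rewrite (ger0_norm (SJ0 x)) (le_trans (ler_normB _ _))//.
  rewrite [leRHS](_ : _ = (`|dotV (DA x) (g x)| + C * SJ x) + 2 * C * SJ x); last by ring.
  rewrite lerD//.
    rewrite normrM (ger0_norm (th0 n x)) -[leRHS]mulr1 ler_pM//.
    by rewrite (le_trans (ler_normD _ _))// lerD2l normrM ler_pM.
  rewrite !normrM (ger0_norm (th0 n x)) (ger0_norm (ltW (l0 n))) (ger0_norm (ler0n _ 2)).
  rewrite [leLHS](_ : _ = 2 * `|A x| * ((l n * `|S x| * th n x) * th n x)); last by ring.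
  rewrite ler_pM ?mulr_ge0 ?(ltW (l0 n))//; first by rewrite ler_wpM2l.
  by rewrite -[leRHS]mulr1 ler_pM ?mulr_ge0 ?(ltW (l0 n)).
- apply: aeW => x; apply: cvgM; last exact: cvg_cst.
  rewrite -[X in _ --> X]subr0; apply: cvgB.
    by rewrite -[X in _ --> X]mulr1; apply: cvgM; [exact: cvg_cst|exact: cth].
  rewrite (_ : (fun n => _) = (fun n => l n * (2 * A x * S x * th n x ^+ 2))).
    rewrite -[X in _ --> X](mul0r (2 * A x * S x * 1 ^+ 2)); apply: cvgM => //.
    apply: cvgM; first exact: cvg_cst.
    by rewrite !expr2; apply: cvgM; exact: cth.
  by apply/funext => n; ring.
move=> _ /cvgN rhs.
have E n := rint_by_parts_trunc WA Wg HA (l0 n) tpsi.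
move: lhs; rewrite (funext E) => lhs.
exact: cvg_unique lhs rhs.
Qed.

Lemma weak_gradient_damp w (Dw : E -> E) (l : R) : weak_gradient w Dw ->
  (forall x, 0 <= w x) -> 0 <= l ->
  weak_gradient (fun x => damp l (w x))
    (fun x => ((1 - l * w x) * expR (- l * w x)) *: Dw x).
Proof.
move=> W w0 l0 i.
rewrite (_ : (fun x => _ 0 i) = (fun x => (1 - l * w x) * expR (- l * w x) * Dw x 0 i)).
  exact: weak_partial_damp.
by apply/funext => x; rewrite mxE.
Qed.

Lemma dotVZ (k : R) (u v : E) : dotV (k *: u) v = k * dotV u v.
Proof. by rewrite /dotV mulr_sumr; apply: eq_bigr => j _; rewrite mxE mulrA. Qed.

Lemma rint_by_parts_ge0 w (Dw : E -> E) : weak_gradient w Dw -> (forall x, 0 <= w x) ->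
  measurable_fun setT w ->
  itg mu (fun x => dotV (Dw x) (g x) * psi x) ->
  itg mu (fun x => w x * \tr (J x) * psi x) ->
  itg mu (fun x => w x * \sum_i g x 0 i * partial i psi x) ->
  rint mu (fun x => w x * \sum_i g x 0 i * partial i psi x) =
  - rint mu (fun x => (dotV (Dw x) (g x) + w x * \tr (J x)) * psi x).
Proof.
move=> W w0 mw I1 I2 I3.
have mD := weak_gradient_measurable W.
have mJ := weak_jacobian_measurable Wg.
have mpsi := test_measurable tpsi.
have mtr := measurable_mxtrace mJ.
have mDg := measurable_dotV mD mg.
pose l (n : nat) : R := n.+1%:R^-1.
have l0 n : 0 < l n by rewrite invr_gt0.
have l0' n : 0 <= l n by exact: ltW.
have cl : l n @[n --> \oo] --> 0 by exact: cvgn_invS.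
have ce x : expR (- l n * w x) @[n --> \oo] --> (1 : R).
  rewrite -expR0; apply: continuous_cvg; first exact: continuous_expR.
  rewrite -[X in _ --> X](mul0r (w x)); apply: cvgM; last exact: cvg_cst.
  by rewrite -oppr0; exact: cvgN.
have mlw n : measurable_fun setT (fun x => expR (- l n * w x)).
  apply: (measurableT_comp (continuous_measurable_fun (@continuous_expR R))).
  by apply: measurable_funM; [exact: measurable_cst|].
have md n : measurable_fun setT (fun x => damp (l n) (w x)) by exact: measurable_funM.
have key n : rint mu (fun x => damp (l n) (w x) * \sum_i g x 0 i * partial i psi x) =
  - rint mu (fun x => ((1 - l n * w x) * expR (- l n * w x) * dotV (Dw x) (g x)
       + damp (l n) (w x) * \tr (J x)) * psi x).
  rewrite (@rint_by_parts _ _ (l n)^-1 (weak_gradient_damp W w0 (l0' n))).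
  - by congr (- _); apply: eq_rint => x; rewrite dotVZ.
  - by move=> x; rewrite ger0_norm ?damp_ge0// damp_bounded.
  - apply: (itg_le _ _ (itg_norm I1)).
      apply: measurable_funM => //.
      under eq_fun do rewrite dotVZ.
      apply: measurable_funM => //; apply: measurable_funM => //.
      apply: measurable_funB; first exact: measurable_cst.
      by apply: measurable_funM; [exact: measurable_cst|].
    by move=> x; rewrite dotVZ -mulrA normrM ler_piMl// damp_derive_le1.
have [] := @rint_dct _ _ _ mu
  (fun n x => damp (l n) (w x) * \sum_i g x 0 i * partial i psi x)
  (fun x => w x * \sum_i g x 0 i * partial i psi x)
  (fun x => `|w x * \sum_i g x 0 i * partial i psi x|).
- by move=> n; exact: measurable_funM.
- exact: measurable_funM.
- exact: itg_norm.
- move=> n x; rewrite !(normrM _ (\sum_i _)) ler_wpM2r//.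
  by rewrite !ger0_norm ?damp_ge0// damp_le.
- apply: aeW => x; apply: cvgM; last exact: cvg_cst.
  rewrite -[X in _ --> X]mulr1; apply: cvgM; [exact: cvg_cst|exact: ce].
move=> _ lhs.
have [] := @rint_dct _ _ _ mu
  (fun n x => ((1 - l n * w x) * expR (- l n * w x) * dotV (Dw x) (g x)
       + damp (l n) (w x) * \tr (J x)) * psi x)
  (fun x => (dotV (Dw x) (g x) + w x * \tr (J x)) * psi x)
  (fun x => `|dotV (Dw x) (g x) * psi x| + `|w x * \tr (J x) * psi x|).
- move=> n; apply: measurable_funM => //; apply: measurable_funD; last exact: measurable_funM.
  apply: measurable_funM => //; apply: measurable_funM => //.
  apply: measurable_funB; first exact: measurable_cst.
  by apply: measurable_funM; [exact: measurable_cst|].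
- apply: measurable_funM => //; apply: measurable_funD => //; exact: measurable_funM.
- by apply: itgD; exact: itg_norm.
- move=> n x; rewrite mulrDl (le_trans (ler_normD _ _))// lerD//.
    by rewrite -mulrA normrM ler_piMl// damp_derive_le1.
  rewrite !(normrM _ (psi x)) ler_wpM2r// !(normrM _ (\tr _)) ler_wpM2r//.
  by rewrite !ger0_norm ?damp_ge0// damp_le.
- apply: aeW => x; apply: cvgM; last exact: cvg_cst.
  apply: cvgD.
    rewrite -[X in _ --> X]mul1r; apply: cvgM; last exact: cvg_cst.
    rewrite -[X in _ --> X](mul1r 1); apply: cvgM; last exact: ce.
    rewrite -[X in _ --> X]subr0; apply: cvgB; first exact: cvg_cst.
    by rewrite -[X in _ --> X](mul0r (w x)); apply: cvgM => //; exact: cvg_cst.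
  apply: cvgM; last exact: cvg_cst.
  by rewrite -[X in _ --> X]mulr1; apply: cvgM; [exact: cvg_cst|exact: ce].
move=> _ /cvgN rhs; move: lhs; rewrite (funext key) => lhs.
exact: cvg_unique lhs rhs.
Qed.

End by_parts.
End integration_by_parts.

(** * Mollification *)

Section mollification.
Context {R : realType} {p : nat}.
Notation E := 'rV[R]_p.
Notation mu := (@lebesgue_rV R p).
Implicit Types (u h v w phi psi eta : E -> R) (x y z a : E) (i : 'I_p).

Lemma loc_integrable_continuous u : continuous u -> loc_integrable u.
Proof.
move=> cu; have mu' := measurable_continuous cu.
apply: loc_integrable_intro => k.
have : compact (u @` cube k%:R).
  by apply: continuous_compact; [exact: continuous_subspaceT|exact: compact_cube].
move=> /compact_bounded[M [_ HM]].
have HM1 := HM (M + 1) ltac:(by rewrite ltrDl).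
apply: (itg_le (g := fun x => (M + 1) * \1_(cube k%:R) x)).
- by apply: measurable_funM => //; exact: measurable_indic_cube.
- move=> x; rewrite normrM (ger0_norm (indic_cube_ge0 _ _)) indicE.
  case: (boolP (x \in _)) => [|_]; last by rewrite !mulr0.
  by rewrite inE => xk; rewrite !mulr1; apply: HM1; exists x.
- exact/itgZ/itg_cube.
Qed.

Definition convol u eta x : R := rint mu (fun y => u y * eta (y - x)).

Lemma testZ (k : R) phi : test_function phi -> test_function (fun x => k * phi x).
Proof.
move=> tphi; have [n Hn] := test_supp tphi; have [Cphi _] := tphi.
apply: (@test_intro _ _ _ n%:R) => [j|x].
  by apply: CkM; [exact: Ck_cst|exact: Cphi].
by rewrite mulf_eq0 negb_or => /andP[_ px]; apply: Hn; exact: subset_closure.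
Qed.

Lemma testN phi : test_function phi -> test_function (fun x => - phi x).
Proof. by move=> /(testZ (-1)); under eq_fun do rewrite mulN1r. Qed.

Lemma testM phi psi : (forall k, Ck k phi) -> test_function psi ->
  test_function (fun x => phi x * psi x).
Proof.
move=> Cphi tpsi; have [n Hn] := test_supp tpsi; have [Cpsi _] := tpsi.
apply: (@test_intro _ _ _ n%:R) => [j|x]; first by apply: CkM.
by rewrite mulf_eq0 negb_or => /andP[_ px]; apply: Hn; exact: subset_closure.
Qed.

Lemma itg_conv u eta x : loc_integrable u -> test_function eta ->
  itg mu (fun y => u y * eta (y - x)).
Proof. by move=> Lu te; apply: itg_test => //; exact: test_shift. Qed.

Lemma convE u eta x : loc_integrable u -> test_function eta ->
  convol u eta x = rint mu (fun z => u (x + z) * eta z).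
Proof.
move=> Lu te; rewrite /convol -(rint_shift x (itg_measurable (itg_conv x Lu te))).
by apply: eq_rint => z; rewrite addrK addrC.
Qed.

Lemma is_derive_of_qcvg i (f : E -> R) x (d : R) :
  (forall t, (forall n, t n != 0) -> t n @[n --> \oo] --> 0 -> qcvg i t f x d) ->
  is_derive x (delta_mx 0 i : E) f d.
Proof.
move=> H.
have K : (fun h : R => h^-1 *: ((f \o shift x) (h *: delta_mx 0 i) - f x)) h @[h --> 0^'] --> d.
  apply/cvgr_dnbhsP => t [tn0 t0].
  have := H t tn0 t0; rewrite /qcvg /quot.
  have E1 n : (t n)^-1 *: ((f \o shift x) (t n *: delta_mx 0 i) - f x) =
     (f (x + t n *: delta_mx 0 i) - f x) / t n.
    by rewrite [LHS](_ : _ = (t n)^-1 * (f (t n *: delta_mx 0 i + x) - f x))// mulrC [_ + x]addrC.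
  by under [in X in _ -> X]eq_fun do rewrite E1.
apply: DeriveDef; last exact: cvg_lim.
by apply/cvg_ex; exists d.
Qed.

Lemma conv_is_derive u eta i x : loc_integrable u -> test_function eta ->
  is_derive x (delta_mx 0 i : E) (convol u eta) (convol u (fun z => - partial i eta z) x).
Proof.
move=> Lu te; apply: is_derive_of_qcvg => t tn0 t0.
have ts : test_function (fun y => eta (y - x)) by exact: test_shift.
have [C [k [C0 HC]]] := test_quot_dom i ts.
have [N _ HN] : \forall n \near \oo, `|t n| <= 1.
  by move/cvgr0Pnorm_le : t0; apply.
have mu' := loc_integrable_measurable Lu.
have Nt0 : - t n @[n --> \oo] --> 0 by rewrite -oppr0; exact: cvgN.
have E1 n : quot i (t n) (convol u eta) x =
    rint mu (fun y => u y * - quot i (- t n) (fun y => eta (y - x)) y).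
  rewrite /quot /convol mulrC -rintB; [|exact: itg_conv..].
  rewrite -rintZ; last by apply: itgB; exact: itg_conv.
  apply: eq_rint => y; rewrite scaleNr invrN opprD addrA (addrAC y).
  by ring.
rewrite /qcvg (funext E1) -(cvg_shiftn N).
have md n : measurable_fun setT (fun y => u y * - quot i (- t n) (fun y => eta (y - x)) y).
  apply: measurable_funM => //; apply: measurable_funN => //.
  apply: measurable_funM => //; apply: measurable_funB; last exact: test_measurable.
  apply: (measurableT_comp (test_measurable ts)); exact: measurable_shift.
have [] := @rint_dct _ _ _ mu
  (fun n y => u y * - quot i (- t (n + N)%N) (fun y => eta (y - x)) y)
  (fun y => u y * - partial i eta (y - x)) (fun y => C * `|u y * \1_(cube k%:R) y|).
- by move=> n; exact: md.
- apply: measurable_funM => //; apply: measurable_funN => //.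
  by apply: test_measurable; apply: (test_shift (phi := partial i eta)); exact: test_partial.
- by apply/itgZ/itg_norm; exact: loc_integrable_cube.
- move=> n y; rewrite normrM (normrM (u y)) mulrCA ler_wpM2l// normrN.
  rewrite (ger0_norm (indic_cube_ge0 _ _)); apply: HC; first by rewrite oppr_eq0.
  by rewrite normrN; apply: HN => /=; rewrite leq_addl.
- apply: aeW => y; apply: cvgM; first exact: cvg_cst.
  apply: cvgN; rewrite -(partial_shift eta (- x)).
  apply: test_quot_cvg => //; first by move=> n; rewrite oppr_eq0.
  by have := Nt0; rewrite -(cvg_shiftn N).
- by [].
Qed.

Lemma conv_continuous u eta : loc_integrable u -> test_function eta ->
  continuous (convol u eta).
Proof.
move=> Lu te x; have FF : Filter (nbhs x) by exact: nbhs_filter.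
apply/cvgrPdist_le => e e0.
apply: contrapT => H.
have mu' := loc_integrable_measurable Lu.
have [C [k [C0 HC]]] := test_dom te.
have /choice[z Hz] (n : nat) : exists z, `|x - z| <= n.+1%:R^-1 /\
    e < `|convol u eta x - convol u eta z|.
  apply: contrapT => /forallNP K; apply: H.
  have d0 : 0 < n.+1%:R^-1 :> R by rewrite invr_gt0.
  have B : nbhs x [set z | `|x - z| <= n.+1%:R^-1].
    have := @nbhsx_ballx _ _ x _ d0; rewrite -ball_normE.
    by apply: filterS => z /= /ltW.
  by apply: filterS B => z xz; rewrite leNgt; apply/negP => ez; apply: (K z).
have zx : z n @[n --> \oo] --> x.
  apply/cvgrPdist_le => d d0; near=> n.
  apply: le_trans ((Hz n).1) _; near: n.
  exists (Num.truncn d^-1) => // m /= dm.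
  rewrite invf_ple ?posrE//; apply: le_trans (ltW (truncnS_gt _)) _.
  by rewrite ler_nat ltnS.
have z1 n : cube (1 + `|x|) (z n).
  rewrite -(subrK x (z n)); apply: cubeD; last exact: cube_normr.
  apply: le_cube (@cube_normr _ _ _); rewrite distrC (le_trans (Hz n).1)//.
  by rewrite invf_le1// ler1n.
have [] := @rint_dct _ _ _ mu (fun n y => u y * eta (y - z n)) (fun y => u y * eta (y - x))
  (fun y => C * `|u y * \1_(cube (k%:R + (1 + `|x|))) y|).
- by move=> n; apply: itg_measurable; exact: itg_conv.
- by apply: itg_measurable; exact: itg_conv.
- by apply/itgZ/itg_norm; exact: loc_integrable_cube.
- move=> n y; rewrite normrM (normrM (u y)) mulrCA ler_wpM2l//.
  rewrite (ger0_norm (indic_cube_ge0 _ _)) (le_trans (HC _))// ler_wpM2l//.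
  by apply: le_indic_cube => h; rewrite -(subrK (z n) y); apply: cubeD.
- apply: aeW => y; apply: cvgM; first exact: cvg_cst.
  apply: continuous_cvg; first exact: test_continuous.
  by apply: cvgB => //; exact: cvg_cst.
move=> _ /cvgrPdist_le/(_ e e0)[n _ /(_ n (leqnn n))] /=.
by rewrite leNgt (Hz n).2.
Unshelve. all: by end_near. Qed.

Lemma Ck_conv k u eta : loc_integrable u -> test_function eta -> Ck k (convol u eta).
Proof.
move=> Lu; elim: k eta => [|k IH] eta te.
  by split => //; exact: conv_continuous.
apply: (@Ck_intro _ _ _ _ (fun i => convol u (fun z => - partial i eta z))).
- exact: conv_continuous.
- by move=> i x; exact: conv_is_derive.
- by move=> i; apply: IH; apply: testN; exact: test_partial.
Qed.

Lemma partial_eq i phi (d : E -> R) :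
  (forall x, is_derive x (delta_mx 0 i : E) phi (d x)) -> partial i phi = d.
Proof. by move=> H; apply/funext => x; exact: (@derive_val _ _ _ _ _ _ _ (H x)). Qed.

Lemma partialN i phi : (forall k, Ck k phi) ->
  partial i (fun x => - phi x) = (fun x => - partial i phi x).
Proof.
by move=> Cp; apply: partial_eq => x; apply: is_deriveN; exact: Ck_is_derive (Cp 1%N).
Qed.

Lemma conv_ge0 u eta x : (forall y, 0 <= u y) -> (forall z, 0 <= eta z) -> 0 <= convol u eta x.
Proof. by move=> u0 e0; apply: rint_ge0 => y; rewrite mulr_ge0. Qed.

Lemma test_laplacian eta : test_function eta -> test_function (laplacian eta).
Proof.
move=> te; have [n Hn] := test_supp te; have [Ce _] := te.
have tp i : test_function (partial i (partial i eta)) by do 2!apply: test_partial.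
have /choice[m Hm] i := test_supp (tp i).
apply: (@test_intro _ _ _ (\sum_i (m i)%:R)) => [k|x].
  by apply: Ck_sum => i; have [] := tp i.
move=> lx; have [i pix] : exists i, partial i (partial i eta) x != 0.
  apply: contrapT => /forallNP K; move/eqP: lx; apply.
  by apply: big1 => i _; apply/eqP/negP => /negP; exact: K.
have := @le_cube R p (m i)%:R (\sum_i (m i)%:R); apply.
  by rewrite (bigD1 i)//= lerDl sumr_ge0.
by apply: (Hm i); exact: subset_closure.
Qed.

Lemma laplacian_conv u eta x : loc_integrable u -> test_function eta ->
  laplacian (convol u eta) x = convol u (laplacian eta) x.
Proof.
move=> Lu te; have [Ce _] := te.
have tp i : test_function (partial i eta) by exact: test_partial.
have tpp i : test_function (partial i (partial i eta)) by exact: test_partial.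
rewrite /laplacian.
have -> : convol u (fun x => \sum_i partial i (partial i eta) x) x =
    \sum_i convol u (partial i (partial i eta)) x.
  rewrite /convol -rint_sum; last by move=> i; exact: itg_conv.
  by apply: eq_rint => y; rewrite mulr_sumr.
apply: eq_bigr => i _.
rewrite (partial_eq (fun x => conv_is_derive i x Lu te)).
rewrite (partial_eq (fun x => conv_is_derive i x Lu (testN (tp i)))).
rewrite partialN; last by have [] := tp i.
by congr (convol u _ x); apply/funext => z; rewrite opprK.
Qed.

Lemma rint_partial i phi : test_function phi -> rint mu (partial i phi) = 0.
Proof.
move=> tp; have mp := test_measurable tp; have Ip := itg_test1 tp.
pose t (n : nat) : R := n.+1%:R^-1.
have tn0 n : t n != 0 by rewrite invr_eq0 pnatr_eq0.
have t0 : t n @[n --> \oo] --> 0 by exact: cvgn_invS.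
have E1 n : rint mu (quot i (t n) phi) = 0.
  have Is := itg_shift (t n *: delta_mx 0 i) Ip.
  transitivity ((t n)^-1 * (rint mu (fun x => phi (x + t n *: delta_mx 0 i)) - rint mu phi)).
    by rewrite -rintB// -rintZ ?itgB//; apply: eq_rint => x; rewrite mulrC.
  by rewrite rint_shift// subrr mulr0.
have [C [k [C0 HC]]] := test_quot_dom i tp.
have [] := @rint_dct _ _ _ mu (fun n => quot i (t n) phi) (partial i phi)
  (fun y => C * \1_(cube k%:R) y).
- move=> n; apply: measurable_funM => //; apply: measurable_funB => //.
  by apply: (measurableT_comp mp); exact: measurable_shift.
- exact: test_measurable (test_partial i tp).
- exact/itgZ/itg_cube.
- move=> n x; apply: HC => //; rewrite ger0_norm ?invr_ge0//.
  by rewrite invf_le1// ler1n.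
- by apply: aeW => x; exact: test_quot_cvg.
move=> _; rewrite (funext E1) => H.
by apply/esym; apply: (cvg_unique _ (cvg_cst 0) H).
Qed.

Lemma Ck_by_parts i phi psi : (forall k, Ck k phi) -> test_function psi ->
  rint mu (fun x => phi x * partial i psi x) = - rint mu (fun x => partial i phi x * psi x).
Proof.
move=> Cphi tpsi; have [Cpsi _] := tpsi.
have t1 : test_function (fun x => phi x * partial i psi x).
  by apply: testM => //; exact: test_partial.
have t2 : test_function (fun x => partial i phi x * psi x).
  by apply: testM => // k; apply: Ck_partial; exact: Cphi.
apply/eqP; rewrite -addr_eq0 -rintD; [|exact: itg_test1..].
rewrite -[X in _ == X](rint_partial i (testM Cphi tpsi)); apply/eqP.
apply: eq_rint => x; apply/esym.
rewrite [X in _ = _ + X]mulrC.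
exact: (@derive_val _ _ _ _ _ _ _ (is_deriveM (Ck_is_derive i x (Cphi 1%N)) (Ck_is_derive i x (Cpsi 1%N)))).
Qed.

Lemma Ck_green phi psi : (forall k, Ck k phi) -> test_function psi ->
  rint mu (fun x => phi x * laplacian psi x) = rint mu (fun x => laplacian phi x * psi x).
Proof.
move=> Cphi tpsi.
have Cp i k : Ck k (partial i phi) by apply: Ck_partial; exact: Cphi.
have Cpp i k : Ck k (partial i (partial i phi)) by apply: Ck_partial; exact: Cp.
transitivity (\sum_i rint mu (fun x => phi x * partial i (partial i psi) x)).
  rewrite -rint_sum => [|i].
    by apply: eq_rint => x; rewrite mulr_sumr.
  by apply: itg_test1; apply: testM => //; do 2!apply: test_partial.
transitivity (\sum_i rint mu (fun x => partial i (partial i phi) x * psi x)).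
  apply: eq_bigr => i _; rewrite Ck_by_parts//; last exact: test_partial.
  by rewrite Ck_by_parts ?opprK.
rewrite -rint_sum => [|i].
  by apply: eq_rint => x; rewrite mulr_suml.
by apply: itg_test1; exact: testM.
Qed.

Lemma laplacian_comp (f df ddf : R -> R) phi x : (forall k, Ck k phi) ->
  (forall s : R, is_derive s (1 : R) f (df s)) ->
  (forall s : R, is_derive s (1 : R) df (ddf s)) ->
  laplacian (fun y => f (phi y)) x =
  ddf (phi x) * (\sum_i partial i phi x ^+ 2) + df (phi x) * laplacian phi x.
Proof.
move=> Cphi Df Ddf; rewrite /laplacian !mulr_sumr -big_split; apply: eq_bigr => i _.
rewrite (partial_eq (fun x => is_derive_comp_rV (Df _) (Ck_is_derive i x (Cphi 1%N)))).
have D2 := Ck_is_derive i x (Ck_partial i (Cphi 2%N)).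
have D1 := is_derive_comp_rV (Ddf _) (Ck_is_derive i x (Cphi 1%N)).
rewrite /partial (@derive_val _ _ _ _ _ _ _ (is_deriveM D1 D2)) /GRing.scale/=.
by rewrite /partial; ring.
Qed.

Lemma conv_cvg_L1 u (r e : R) : loc_integrable u -> 0 < e ->
  exists2 d : R, 0 < d & forall eta, test_function eta -> (forall z, 0 <= eta z) ->
    rint mu eta = 1 -> (forall z, eta z != 0 -> cube d z) ->
    rint mu (fun x => `|convol u eta x - u x| * \1_(cube r) x) <= e.
Proof.
move=> Lu e0; have [d /andP[d0 d1] Hd] := loc_translation_continuity r Lu e0.
exists d => // eta te eta0 eta1 He.
have mu' := loc_integrable_measurable Lu; have me := test_measurable te.
have Ie := itg_test1 te.
pose G (w : E * E) := u w.1 * \1_(cube r) (w.1 + - w.2) * eta w.2.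
have IG : itg (mu \x mu)%E G.
  apply: (itg_le (g := fun w : E * E => `|u w.1 * \1_(cube (r + d)) w.1| * eta w.2)).
  - apply: measurable_funM; last exact: measurableT_comp.
    apply: measurable_funM; first exact: measurableT_comp.
    apply: (measurableT_comp (measurable_indic_cube r)).
    by apply: measurable_rV_add => //; apply: measurable_rV_opp.
  - move=> [x z]; rewrite /G /= !normrM [`|eta z|]ger0_norm//.
    have [->|ez] := eqVneq (eta z) 0; first by rewrite !mulr0.
    rewrite ler_wpM2r// ler_wpM2l// !(ger0_norm (indic_cube_ge0 _ _)).
    apply: le_indic_cube => xz; rewrite -(subrK z x); apply: cubeD => //; exact: He.
  - apply: (itg_prod (f := fun x => `|u x * \1_(cube (r + d)) x|)) => //.
    exact/itg_norm/loc_integrable_cube.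
have IGs := itg_shear (c := fun z => z) (@measurable_id _ _ setT) IG.
have IP : itg (mu \x mu)%E (fun w : E * E => u w.1 * \1_(cube r) w.1 * eta w.2).
  exact: (itg_prod (loc_integrable_cube r Lu) Ie).
pose J (w : E * E) := (u (w.1 + w.2) - u w.1) * \1_(cube r) w.1 * eta w.2.
have IJ : itg (mu \x mu)%E J.
  by apply: eq_itg (itgB IGs IP) => w; rewrite /J /G /= addrK; ring.
have IJn : itg (mu \x mu)%E (fun w : E * E => `|J w|) by exact: itg_norm.
have Lc : loc_integrable (convol u eta).
  by apply: loc_integrable_continuous; exact: conv_continuous.
have key x : `|convol u eta x - u x| * \1_(cube r) x <= rint mu (fun z => `|J (x, z)|).
  have I1 : itg mu (fun z => u (x + z) * eta z).
    apply: itg_test => //; under eq_fun do rewrite addrC.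
    exact: loc_integrable_shift.
  have I2 : itg mu (fun z => u x * eta z) by exact: itgZ.
  have E1 : rint mu (fun z => J (x, z)) = (convol u eta x - u x) * \1_(cube r) x.
    transitivity (\1_(cube r) x * (rint mu (fun z => u (x + z) * eta z) -
        rint mu (fun z => u x * eta z))).
      by rewrite -rintB// -rintZ ?itgB//; apply: eq_rint => z; rewrite /J /=; ring.
    by rewrite rintZ// eta1 mulr1 -convE// mulrC.
  rewrite -(ger0_norm (indic_cube_ge0 r x)) -normrM -E1; apply: rint_norm.
  by apply: (eq_itg _ (itgZ (\1_(cube r) x) (itgB I1 I2))) => z; rewrite /J /=; ring.
apply: le_trans (rint_le _ (rint_fubini_itg IJn) key) _.
  apply: loc_integrable_cube; apply: loc_integrable_norm; exact: loc_integrableB.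
rewrite (rint_fubini IJn).
apply: (@le_trans _ _ (rint mu (fun z => e * eta z))); last by rewrite rintZ// eta1 mulr1.
apply: rint_le => [||z].
- exact: (rint_fubini_itg (itg_swap IJn)).
- exact: itgZ.
have -> : rint mu (fun x => `|J (x, z)|) =
    eta z * rint mu (fun x => `|u (x + z) - u x| * \1_(cube r) x).
  rewrite -rintZ_measurable.
    apply: eq_rint => x; rewrite /J /= !normrM (ger0_norm (eta0 _)).
    by rewrite (ger0_norm (indic_cube_ge0 _ _)) mulrC.
  apply: measurable_funM; last exact: measurable_indic_cube.
  apply: measurableT_comp => //; apply: measurable_funB => //.
  by apply: (measurableT_comp mu'); exact: measurable_shift.
have [->|ez] := eqVneq (eta z) 0; first by rewrite mul0r mulr0.
rewrite mulrC ler_wpM2r//.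
by have [_ /ltW] := Hd z (He z ez).
Qed.

End mollification.

(** * Means of harmonic functions *)

Section mean_value.
Context {R : realType} {p : nat}.
Notation E := 'rV[R]_p.
Notation mu := (@lebesgue_rV R p).
Implicit Types (u h v phi psi eta : E -> R) (x y z a : E) (i : 'I_p).

Definition kernel_profile (s : R) : R := flat 2 (1 - s).
Definition kernel_profile' (s : R) : R := - (flat 4 (1 - s) - 2 * flat 3 (1 - s)).
Notation rho := kernel_profile.
Notation drho := kernel_profile'.

Lemma is_derive_flatB k (s : R) : is_derive s (1 : R) (fun s => flat k (1 - s))
  (- (flat k.+2 (1 - s) - k%:R * flat k.+1 (1 - s))).
Proof.
have H : is_derive s (1 : R) (fun s : R => 1 - s) (-1).
  have := is_deriveB (is_derive_cst (1 : R) s (1 : R)) (is_derive_id s (1 : R)).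
  by rewrite sub0r.
have := @is_derive1_comp _ (flat k) (fun s => 1 - s) s _ _ (is_derive_flat k (1 - s)) H.
by rewrite mulrN1.
Qed.

Lemma smooth_flatB k : smooth (fun s : R => flat k (1 - s)).
Proof.
move=> n; have := C1_affine (-1 : R) 1 (smooth_flat k n).
by congr C1; apply/funext => s; rewrite mulN1r addrC.
Qed.

Lemma is_derive_rho (s : R) : is_derive s (1 : R) rho (drho s).
Proof. exact: is_derive_flatB. Qed.

Lemma derive1_bump1 : derive1 (bumpf (1 : R)) = (fun s => - rho s).
Proof.
apply: derive1_is_derive => s; have := is_derive_flatB 0 s.
by rewrite mul0r subr0.
Qed.

Lemma flat_le (k : nat) (t : R) : t <= 1 -> flat k t <= (k.+2)`!%:R.
Proof.
move=> t1; have [t0|t0] := leP t 0; first by rewrite flat_le0.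
apply: le_trans (flat_le_sqr _ _) _.
by rewrite ler_piMr// expr_le1// ltW.
Qed.

Lemma rho_ge0 s : 0 <= rho s. Proof. exact: flat_ge0. Qed.

Lemma rho_eq0 s : 1 <= s -> rho s = 0.
Proof. by move=> s1; rewrite /rho flat_le0// subr_le0. Qed.

Lemma drho_eq0 s : 1 <= s -> drho s = 0.
Proof. by move=> s1; rewrite /drho !flat_le0 ?subr_le0// mulr0 subrr oppr0. Qed.

Let M : R := 6`!%:R + 2 * 5`!%:R.

Lemma rho_le s : 0 <= s -> `|rho s| <= M.
Proof.
move=> s0; rewrite ger0_norm ?rho_ge0// (le_trans (flat_le _ _)) ?gerBl//.
by rewrite /M -natrM -natrD ler_nat.
Qed.

Lemma drho_le s : 0 <= s -> `|drho s| <= M.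
Proof.
move=> s0; rewrite /drho normrN (le_trans (ler_normB _ _))// lerD//.
  by rewrite ger0_norm ?flat_ge0// flat_le// gerBl.
by rewrite ger0_norm ?mulr_ge0 ?flat_ge0// ler_wpM2l// flat_le// gerBl.
Qed.

Lemma smooth_scale (f : R -> R) (b c : R) : smooth f -> smooth (fun s => c * f (b * s)).
Proof.
move=> Sf k; apply: C1M; first exact: C1_cst.
have := C1_affine b 0 (Sf k); congr C1; apply/funext => s.
by rewrite addr0.
Qed.

Lemma derive1_scale (f : R -> R) (b c : R) : smooth f ->
  derive1 (fun s => c * f (b * s)) = (fun s => c * b * derive1 f (b * s)).
Proof.
move=> Sf; apply: derive1_is_derive => s.
have H : is_derive s (1 : R) (fun s : R => b * s) b.
  by apply: is_derive_eq; rewrite /GRing.scale/= mulr1.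
have D := is_derive1_comp (C1_is_derive (b * s) (Sf 1%N)) H.
have := is_deriveZ c D.
by rewrite /GRing.scale/= (mulrC _ b) mulrA.
Qed.

(* The parameter [t] is the inverse of the radius of the mean, which keeps the kernel
   polynomial in [t].  Its derivative in [t] is a negative multiple of the Laplacian
   of [mean_potential t >= 0], so the means of a subharmonic function are monotone. *)
Definition mean_kernel (t : R) : E -> R := radial (fun s => t ^+ p * rho (t ^+ 2 * s)) 0.
Definition mean_potential (t : R) : E -> R := radial (fun s => t ^+ p * bumpf 1 (t ^+ 2 * s)) 0.

Lemma test_scaled (f : R -> R) (t : R) : 0 < t -> smooth f -> (forall s, 1 <= s -> f s = 0) ->
  test_function (radial (fun s => t ^+ p * f (t ^+ 2 * s)) 0 : E -> R).
Proof.
move=> t0 Sf f0; have t2 : 0 < t ^+ 2 by exact: exprn_gt0.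
apply: (@test_radial _ _ _ _ (t ^+ 2)^-1); first exact: smooth_scale.
by move=> s s1; rewrite f0 ?mulr0// mulrC -ler_pdivrMr// mul1r.
Qed.

Lemma test_mean_kernel t : 0 < t -> test_function (mean_kernel t).
Proof. by move=> t0; apply: test_scaled => //; [exact: smooth_flatB|exact: rho_eq0]. Qed.

Lemma test_mean_potential t : 0 < t -> test_function (mean_potential t).
Proof. by move=> t0; apply: test_scaled => //; [exact: smooth_bump|exact: bump_eq0]. Qed.

Lemma mean_kernel_ge0 t z : 0 < t -> 0 <= mean_kernel t z.
Proof. by move=> t0; rewrite mulr_ge0 ?rho_ge0// exprn_ge0// ltW. Qed.

Lemma mean_potential_ge0 t z : 0 < t -> 0 <= mean_potential t z.
Proof. by move=> t0; rewrite mulr_ge0 ?bump_ge0// exprn_ge0// ltW. Qed.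

Lemma sqd_lt_cube (t : R) z : 0 < t -> t ^+ 2 * sqd 0 z < 1 -> cube t^-1 z.
Proof.
move=> t0 H i; have t2 : 0 < t ^+ 2 by exact: exprn_gt0.
have := le_sqd 0 z i; rewrite mxE subr0 => zi.
rewrite -(ler_pXn2r (n := 2)) ?nnegrE ?invr_ge0 ?(ltW t0)// real_normK ?num_real//.
rewrite (le_trans zi)// exprVn -[leRHS]mul1r ler_pdivlMr// mulrC.
exact: ltW.
Qed.

Lemma mean_kernel_cube t z : 0 < t -> mean_kernel t z != 0 -> cube t^-1 z.
Proof.
move=> t0; rewrite mulf_eq0 negb_or => /andP[_ H]; apply: sqd_lt_cube => //.
by rewrite ltNge; apply: contra H => H; rewrite rho_eq0.
Qed.

Lemma mean_kernel_deriveE (t : R) z : 0 < t ->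
  - (2 * t ^+ 3)^-1 * laplacian (mean_potential t) z =
  p%:R * t ^+ p.-1 * rho (t ^+ 2 * sqd 0 z) +
  t ^+ p * (2 * t * sqd 0 z * drho (t ^+ 2 * sqd 0 z)).
Proof.
move=> t0; rewrite /mean_potential laplacian_radial; last first.
  by apply: smooth_scale; exact: smooth_bump.
rewrite derive1_scale; last exact: smooth_bump.
rewrite derive1_bump1.
rewrite (_ : (fun s => t ^+ p * t ^+ 2 * - rho (t ^+ 2 * s)) =
   (fun s => - (t ^+ p * t ^+ 2) * rho (t ^+ 2 * s))); last first.
  by apply/funext => s; rewrite mulrN mulNr.
rewrite derive1_scale; last exact: smooth_flatB.
have -> : derive1 rho = drho by apply: derive1_is_derive => s; exact: is_derive_rho.
have tp : p%:R * t ^+ p = p%:R * t ^+ p.-1 * t.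
  by case: (p) => [|q]; rewrite ?mul0r//= exprSr mulrA.
rewrite (_ : 2 * p%:R * (t ^+ p * t ^+ 2 * - _) =
  - 2 * (p%:R * t ^+ p) * t ^+ 2 * rho (t ^+ 2 * sqd 0 z)); last by ring.
by rewrite tp; field; rewrite gt_eqF.
Qed.

Lemma is_derive_mean_kernel (t : R) z : 0 < t ->
  is_derive t (1 : R) (fun t => mean_kernel t z)
    (- (2 * t ^+ 3)^-1 * laplacian (mean_potential t) z).
Proof.
move=> t0; rewrite mean_kernel_deriveE//.
have D1 : is_derive t (1 : R) (fun t : R => t ^+ 2 * sqd 0 z) (2 * t * sqd 0 z).
  have := is_deriveM (is_deriveX 2 (is_derive_id t (1 : R))) (is_derive_cst (sqd 0 z) t (1 : R)).
  rewrite /GRing.scale/= mulr0 add0r mulr1 expr1.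
  by rewrite (mulrC (sqd 0 z)).
have D2 := @is_derive1_comp _ rho (fun t => t ^+ 2 * sqd 0 z) t _ _ (is_derive_rho (t ^+ 2 * sqd 0 z)) D1.
have D3 : is_derive t (1 : R) (fun t : R => t ^+ p) (p%:R * t ^+ p.-1).
  case: (p) => [|q]; first by rewrite mul0r; exact: is_derive_cst.
  have := is_deriveX q.+1 (is_derive_id t (1 : R)).
  by rewrite exprfctE /GRing.scale/= mulr1.
have := is_deriveM D3 D2; rewrite /GRing.scale/=.
by rewrite [X in is_derive _ _ _ X -> _](_ : _ = p%:R * t ^+ p.-1 * rho (t ^+ 2 * sqd 0 z) +
  t ^+ p * (2 * t * sqd 0 z * drho (t ^+ 2 * sqd 0 z))); last ring.
Qed.

Lemma derive_mean_kernel_le (a b t : R) z : 0 < a -> a <= t -> t <= b ->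
  `|- (2 * t ^+ 3)^-1 * laplacian (mean_potential t) z| <=
  (p%:R * b ^+ p.-1 * M + b ^+ p * (2 * b * a ^- 2 * M)) * \1_(cube a^-1) z.
Proof.
move=> a0 at' tb; have t0 : 0 < t by exact: lt_le_trans at'.
have b0 : 0 < b by exact: lt_le_trans tb.
have M0 : 0 <= M by rewrite addr_ge0// mulr_ge0.
have D0 : 0 <= p%:R * b ^+ p.-1 * M + b ^+ p * (2 * b * a ^- 2 * M).
  by rewrite addr_ge0// !mulr_ge0 ?exprn_ge0 ?invr_ge0 ?(ltW b0) ?exprn_ge0 ?(ltW a0).
rewrite mean_kernel_deriveE//; set s := t ^+ 2 * sqd 0 z.
have [s1|s1] := leP 1 s.
  by rewrite rho_eq0// drho_eq0// !mulr0 addr0 normr0 mulr_ge0// indic_cube_ge0.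
have q0 := sqd_ge0 0 z; have s0 : 0 <= s by rewrite mulr_ge0// sqr_ge0.
have zc : cube a^-1 z.
  have := @sqd_lt_cube t z t0 s1; apply: le_cube.
  by rewrite lef_pV2.
have qa : sqd 0 z <= a ^- 2.
  rewrite -[leRHS]mul1r ler_pdivlMr ?exprn_gt0// (le_trans _ (ltW s1))// /s mulrC.
  by rewrite ler_wpM2r// ler_pXn2r// ?nnegrE ltW.
rewrite indic_cube1// mulr1 (le_trans (ler_normD _ _))// lerD//.
  rewrite normrM ler_pM ?rho_le// ger0_norm ?mulr_ge0 ?exprn_ge0 ?(ltW t0)//.
  by rewrite ler_wpM2l// lerXn2r// nnegrE ltW.
rewrite normrM ler_pM//.
  by rewrite ger0_norm ?exprn_ge0 ?(ltW t0)// lerXn2r ?nnegrE ?(ltW t0) ?(ltW b0).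
rewrite normrM ler_pM ?drho_le// ger0_norm ?mulr_ge0 ?(ltW t0)//.
by rewrite ler_pM ?mulr_ge0 ?(ltW t0)// ler_wpM2l.
Qed.

End mean_value.

Section harmonicity.
Context {R : realType} {p : nat}.
Notation E := 'rV[R]_p.
Notation mu := (@lebesgue_rV R p).
Implicit Types (u h v phi psi eta : E -> R) (x y z a : E) (i : 'I_p).

Lemma laplacian_shift phi z x :
  laplacian (fun y => phi (y + z)) x = laplacian phi (x + z).
Proof.
apply: eq_bigr => i _.
have -> : partial i (fun y => phi (y + z)) = (fun y => partial i phi (y + z)).
  by apply/funext => y; exact: partial_shift.
exact: partial_shift.
Qed.

Lemma weakly_superharmonicP u phi : weakly_superharmonic u -> test_function phi ->
  (forall x, 0 <= phi x) -> rint mu (fun x => u x * laplacian phi x) <= 0.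
Proof.
move=> [Lu H] tp p0; rewrite -lee_fin EFin_rint ?H//.
by apply: itg_test => //; exact: test_laplacian.
Qed.

Lemma weakly_subharmonicP u phi : weakly_subharmonic u -> test_function phi ->
  (forall x, 0 <= phi x) -> 0 <= rint mu (fun x => u x * laplacian phi x).
Proof.
move=> [Lu H] tp p0; rewrite -lee_fin EFin_rint ?H//.
by apply: itg_test => //; exact: test_laplacian.
Qed.

Lemma superharmonic_convol u eta x : weakly_superharmonic u -> test_function eta ->
  (forall z, 0 <= eta z) -> convol u (laplacian eta) x <= 0.
Proof.
move=> Su te e0; have H := weakly_superharmonicP Su (test_shift (- x) te) (fun y => e0 _).
have E1 : rint mu (fun y => u y * laplacian (fun z => eta (z - x)) y) =
    convol u (laplacian eta) x.
  by clear; apply: eq_rint => y; rewrite laplacian_shift.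
by move: H; rewrite E1; exact: id.
Qed.

Lemma subharmonic_convol u eta x : weakly_subharmonic u -> test_function eta ->
  (forall z, 0 <= eta z) -> 0 <= convol u (laplacian eta) x.
Proof.
move=> Su te e0; have H := weakly_subharmonicP Su (test_shift (- x) te) (fun y => e0 _).
have E1 : rint mu (fun y => u y * laplacian (fun z => eta (z - x)) y) =
    convol u (laplacian eta) x.
  by clear; apply: eq_rint => y; rewrite laplacian_shift.
by move: H; rewrite E1; exact: id.
Qed.

Lemma derive_conv_mean_kernel u x (t : R) : loc_integrable u -> 0 < t ->
  is_derive t (1 : R) (fun t => convol u (mean_kernel t) x)
    (- (2 * t ^+ 3)^-1 * rint mu (fun y => u y * laplacian (mean_potential t) (y - x))).
Proof.
move=> Lu t0; have mu' := loc_integrable_measurable Lu.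
pose a := t / 2; pose b := t + 1.
have a0 : 0 < a by rewrite divr_gt0.
have tI : [set` `]a, b[%R] t.
  by rewrite /= in_itv/= /a /b; apply/andP; split; lra.
have I0 s : [set` `]a, b[%R] s -> [/\ 0 < s, a <= s & s <= b].
  rewrite /= in_itv/= => /andP[as_ sb]; split; [|exact: ltW..].
  exact: lt_trans as_.
pose f (s : R) y := u y * mean_kernel s (y - x).
pose df (s : R) y := - (2 * s ^+ 3)^-1 * laplacian (mean_potential s) (y - x).
have Df (s : R) y : 0 < s -> is_derive (s : R) (1 : R) (fun s : R => f s y) (u y * df s y).
  move=> s0; have D := is_deriveZ (u y) (is_derive_mean_kernel (y - x) s0).
  exact: D.
have d1 s y : 0 < s -> partial1of2 f s y = u y * df s y.
  by move=> s0; rewrite partial1of2E; exact: (@derive_val _ _ _ _ _ _ _ (Df s y s0)).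
have intf s : [set` `]a, b[%R] s -> itg mu (f s).
  by case/I0 => s0 _ _; apply: itg_conv => //; exact: test_mean_kernel.
have derf s y : [set` `]a, b[%R] s -> setT y -> derivable (f ^~ y) s 1.
  by case/I0 => s0 _ _ _; exact: (@ex_derive _ _ _ _ _ _ _ (Df s y s0)).
pose C := (p%:R * b ^+ p.-1 * (6`!%:R + 2 * 5`!%:R) +
  b ^+ p * (2 * b * a ^- 2 * (6`!%:R + 2 * 5`!%:R))) : R.
pose G y := `|C| * `|u y * \1_(cube (a^-1 + `|x|)) y|.
have G0 y : 0 <= G y by exact: mulr_ge0.
have IG : itg mu G by apply/itgZ/itg_norm; exact: loc_integrable_cube.
have GB s y : [set` `]a, b[%R] s -> setT y -> `|partial1of2 f s y| <= G y.
  case/I0 => s0 as_ sb _; rewrite d1// /G normrM (normrM (u y)) mulrCA ler_wpM2l//.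
  rewrite (le_trans (derive_mean_kernel_le (y - x) a0 as_ sb))//.
  rewrite -/C (le_trans (ler_wpM2r (indic_cube_ge0 _ _) (ler_norm C))) ?ler_wpM2l//.
  rewrite (ger0_norm (indic_cube_ge0 _ _)); apply: le_indic_cube => h.
  by rewrite -(subrK x y); apply: cubeD => //; exact: cube_normr.
have H1 := derivable_under_integral measurableT tI intf derf G0 IG GB.
have H2 := differentiation_under_integral measurableT tI intf derf G0 IG GB.
apply: DeriveDef; first exact: H1.
move: H2; rewrite derive1E => ->.
rewrite -rintZ_measurable.
  apply: eq_rint => y; rewrite d1// /df; ring.
apply: measurable_funM => //.
apply: (measurableT_comp (test_measurable (test_laplacian (test_mean_potential t0)))).
exact: measurable_shift.
Qed.

Lemma mean_nonincreasing u x (a b : R) : weakly_subharmonic u -> 0 < a -> a <= b ->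
  convol u (mean_kernel b) x <= convol u (mean_kernel a) x.
Proof.
move=> Su a0 ab; have [Lu _] := Su.
have Iab t : t \in `[a, b]%R -> 0 < t.
  by rewrite in_itv/= => /andP[at_ _]; exact: lt_le_trans at_.
have [c cab E1] := @MVT_segment R (fun t => convol u (mean_kernel t) x) _ a b ab
  (fun t tab => derive_conv_mean_kernel x Lu (Iab t (subset_itv_oo_cc tab)))
  ltac:(by apply: derivable_within_continuous => t /Iab t0;
        exact: (@ex_derive _ _ _ _ _ _ _ (derive_conv_mean_kernel x Lu t0))).
rewrite -subr_le0 E1 mulr_le0_ge0 ?subr_ge0//.
have c0 := Iab c cab.
rewrite mulNr oppr_le0 mulr_ge0//; first by rewrite invr_ge0 mulr_ge0// exprn_ge0// ltW.
exact: subharmonic_convol Su (test_mean_potential c0) (fun y => mean_potential_ge0 y c0).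
Qed.

Lemma weakly_subharmonic_cst (k : R) : weakly_subharmonic (fun _ : E => k).
Proof.
split; first by apply: (@loc_integrable_bounded _ _ _ `|k|).
move=> phi tp _; have tl := test_laplacian tp.
rewrite -EFin_rint; last by apply/itgZ/itg_test1.
rewrite rintZ; last exact: itg_test1.
rewrite lee_fin /laplacian rint_sum; last by move=> i; apply/itg_test1; do 2!apply: test_partial.
by rewrite big1 ?mulr0// => i _; apply: rint_partial; exact: test_partial.
Qed.

Lemma mean_kernel_mass (t : R) : 0 < t ->
  rint mu (mean_kernel t) = rint mu (mean_kernel 1 : E -> R).
Proof.
move: t.
have key (k a b : R) : 0 < a -> a <= b ->
    k * rint mu (mean_kernel b : E -> R) <= k * rint mu (mean_kernel a : E -> R).
  move=> a0 ab; have b0 := lt_le_trans a0 ab.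
  have := mean_nonincreasing 0 (weakly_subharmonic_cst k) a0 ab.
  have E1 t : 0 < t -> convol (fun=> k) (mean_kernel t) (0 : E) = k * rint mu (mean_kernel t : E -> R).
    move=> t0; rewrite (convE _ (weakly_subharmonic_cst k).1 (test_mean_kernel t0)).
    by rewrite rintZ//; apply: itg_test1; exact: test_mean_kernel.
  by rewrite (E1 _ a0) (E1 _ b0).
have key2 (a b : R) : 0 < a -> a <= b ->
    rint mu (mean_kernel b : E -> R) = rint mu (mean_kernel a : E -> R).
  move=> a0 ab; apply/eqP; rewrite eq_le; have := key 1 a b a0 ab; rewrite !mul1r => ->.
  by have := key (-1) a b a0 ab; rewrite !mulN1r lerN2 => ->.
by move=> t t0; have [t1|/ltW t1] := leP t 1; [rewrite (key2 _ _ t0 t1)|rewrite (key2 1 t)].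
Qed.

Lemma mean_kernel_mass_gt0 : 0 < rint mu (mean_kernel 1 : E -> R).
Proof.
apply: (@lt_le_trans _ _ (rint mu (radial (bumpf 1) 0 : E -> R))).
  exact: rint_bump_gt0.
apply: rint_le => [||x].
- exact: itg_test1 (test_bump _ _).
- by apply: itg_test1; exact: test_mean_kernel.
rewrite /mean_kernel /radial !expr1n !mul1r /bumpf /kernel_profile.
have s0 := sqd_ge0 0 x; set s := sqd 0 x in s0 *.
rewrite /flat; case: ifP => // s1.
rewrite ler_wpM2r ?expR_ge0// expr0 invr1 -[leLHS]invr1 lef_pV2 ?posrE ?exprn_gt0//.
by rewrite exprn_ile1 ?(ltW s1)// gerBl.
Qed.

Definition mollifier (t : R) z := (rint mu (mean_kernel 1 : E -> R))^-1 * mean_kernel t z.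

Lemma test_mollifier t : 0 < t -> test_function (mollifier t).
Proof. by move=> t0; apply: testZ; exact: test_mean_kernel. Qed.

Lemma mollifier_ge0 t z : 0 < t -> 0 <= mollifier t z.
Proof.
move=> t0; rewrite mulr_ge0 ?mean_kernel_ge0// invr_ge0 ltW//; exact: mean_kernel_mass_gt0.
Qed.

Lemma rint_mollifier t : 0 < t -> rint mu (mollifier t) = 1.
Proof.
move=> t0; rewrite rintZ; last by apply: itg_test1; exact: test_mean_kernel.
by rewrite mean_kernel_mass// mulVf// gt_eqF// mean_kernel_mass_gt0.
Qed.

Lemma mollifier_cube t z : 0 < t -> mollifier t z != 0 -> cube t^-1 z.
Proof. by move=> t0; rewrite mulf_eq0 negb_or => /andP[_]; exact: mean_kernel_cube. Qed.

Lemma conv_mollifier_cvg u (r e : R) : loc_integrable u -> 0 < e ->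
  exists2 t : R, 1 <= t & rint mu (fun x => `|convol u (mollifier t) x - u x| * \1_(cube r) x) <= e.
Proof.
move=> Lu e0; have [d d0 Hd] := conv_cvg_L1 r Lu e0.
have t0 : 0 < 1 + d^-1 by rewrite addr_gt0 ?invr_gt0.
exists (1 + d^-1); first by rewrite lerDl invr_ge0 ltW.
apply: Hd => [|z||z Hz].
- exact: test_mollifier.
- exact: mollifier_ge0.
- exact: rint_mollifier.
apply: le_cube (mollifier_cube t0 Hz).
by rewrite invf_ple ?posrE// lerDr.
Qed.


Lemma subharmonic_le_mean u : weakly_subharmonic u ->
  {ae mu, forall x, u x <= convol u (mollifier 1) x}.
Proof.
move=> Su; have [Lu _] := Su; have t1 : (0 : R) < 1 by [].
have c0 : 0 < (rint mu (mean_kernel 1 : E -> R))^-1 by rewrite invr_gt0 mean_kernel_mass_gt0.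
pose v t := convol u (mollifier t).
have Lv t : 0 < t -> loc_integrable (v t).
  move=> t0; apply: loc_integrable_continuous; apply: conv_continuous => //.
  exact: test_mollifier.
have mono t x : 1 <= t -> v t x <= v 1 x.
  move=> t1'; have t0 := lt_le_trans t1 t1'.
  have E1 s : 0 < s -> v s x = (rint mu (mean_kernel 1 : E -> R))^-1 * convol u (mean_kernel s) x.
    move=> s0; rewrite /v /convol -rintZ; last by apply: itg_conv => //; exact: test_mean_kernel.
    by apply: eq_rint => y; rewrite /mollifier; ring.
  rewrite [leLHS](E1 _ t0) [leRHS](E1 _ t1); apply: (ler_wpM2l (ltW c0)); exact: mean_nonincreasing.
have [w [Lw vw] ->] : exists2 w, loc_integrable w /\ (forall t x, 1 <= t -> v t x <= w x) &
    convol u (mollifier 1) = w.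
  by exists (v 1) => //; split => //; exact: Lv.
suff : {ae mu, forall x, 0 <= w x - u x}.
  by apply: filterS => x; rewrite subr_ge0.
apply: ae_ge0_of_bumps; first exact: loc_integrableB.
move=> a r r0; set B := radial (bumpf r) a.
have tB : test_function B by exact: test_bump.
have B0 x : 0 <= B x by exact: bump_ge0.
have [C [n [C0 HC]]] := test_dom tB.
apply/ler_addgt0Pr => e e0.
have [t t1' Ht] := conv_mollifier_cvg n%:R Lu (e := e / (C + 1)) ltac:(by rewrite divr_gt0// ltr_wpDl).
have t0 := lt_le_trans t1 t1'.
have I1 : itg mu (fun x => (w x - v t x) * B x).
  by apply: itg_test => //; apply: loc_integrableB => //; exact: Lv.
have I2 : itg mu (fun x => (v t x - u x) * B x).
  by apply: itg_test => //; apply: loc_integrableB => //; exact: Lv.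
have -> : rint mu (fun x => (w x - u x) * B x) =
    rint mu (fun x => (w x - v t x) * B x) + rint mu (fun x => (v t x - u x) * B x).
  by rewrite -(rintD I1 I2); clear; apply: eq_rint => x; ring.
have H1 : 0 <= rint mu (fun x => (w x - v t x) * B x).
  by apply: rint_ge0 => x; rewrite mulr_ge0// subr_ge0 vw.
suff : `|rint mu (fun x => (v t x - u x) * B x)| <= e.
  by rewrite ler_norml => /andP[H2 _]; lra.
have I3 : itg mu (fun x => `|v t x - u x| * \1_(cube n%:R) x).
  by apply: loc_integrable_cube; apply: loc_integrable_norm; apply: loc_integrableB => //; exact: Lv.
apply: (le_trans (rint_norm I2)).
apply: (@le_trans _ _ (rint mu (fun x => C * (`|v t x - u x| * \1_(cube n%:R) x)))).
  apply: rint_le; [exact: itg_norm|exact: itgZ|move=> x].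
  by rewrite normrM mulrCA ler_wpM2l.
rewrite rintZ// (le_trans (ler_wpM2l C0 Ht))//.
by rewrite mulrCA ler_piMr ?(ltW e0)// ler_pdivrMr ?ltr_wpDl// mul1r lerDl.
Qed.

Lemma subharmonic_locally_bounded u (r : R) : weakly_subharmonic u ->
  exists M : R, {ae mu, forall x, cube r x -> u x <= M}.
Proof.
move=> Su; have [Lu _] := Su.
have cv : continuous (convol u (mollifier 1)).
  by apply: conv_continuous => //; exact: test_mollifier.
have : compact (convol u (mollifier 1) @` cube r).
  by apply: continuous_compact; [exact: continuous_subspaceT|exact: compact_cube].
move=> /compact_bounded[M [_ HM]]; exists (M + 1).
apply: filterS (subharmonic_le_mean Su) => x ux xr.
rewrite (le_trans ux)// (le_trans (ler_norm _))//.
by apply: HM; [rewrite ltrDl|exists x].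
Qed.

Lemma superharmonic_expN u psi (l : R) : weakly_superharmonic u -> (forall x, 0 <= u x) ->
  0 < l -> test_function psi -> (forall x, 0 <= psi x) ->
  0 <= rint mu (fun x => expR (- l * u x) * laplacian psi x).
Proof.
move=> Su u0 l0 tpsi psi0; have [Lu _] := Su.
have mu' := loc_integrable_measurable Lu.
have tl := test_laplacian tpsi.
have [C [n [C0 HC]]] := test_dom tl.
apply/ler_addgt0Pr => e e0.
have [t t1 Ht] := conv_mollifier_cvg n%:R Lu (e := e / (l * (C + 1)))
  ltac:(by rewrite divr_gt0// mulr_gt0// ltr_wpDl).
have t0 : 0 < t by exact: lt_le_trans t1.
have te := test_mollifier t0.
pose v := convol u (mollifier t).
have v0 x : 0 <= v x by apply: conv_ge0 => // z; exact: mollifier_ge0.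
have Cv k : Ck k v by exact: Ck_conv.
have Lv : loc_integrable v by apply: loc_integrable_continuous; exact: conv_continuous.
have D1 s := is_derive_expNl l s.
have D2 (s : R) : is_derive s (1 : R) (fun s => - l * expR (- l * s)) (- l * (- l * expR (- l * s))).
  exact: is_deriveZ.
have CF k : Ck k (fun x => expR (- l * v x)).
  apply: (Ck_comp (f := fun s => expR (- l * s))) => //.
  have := C1_affine (- l) 0 (smooth_expR k).
  by congr C1; apply/funext => s; rewrite addr0.
have lv x : laplacian v x <= 0.
  rewrite (laplacian_conv x Lu te).
  exact: superharmonic_convol Su te (fun y => mollifier_ge0 y t0).
have H1 : 0 <= rint mu (fun x => expR (- l * v x) * laplacian psi x).
  rewrite Ck_green//; apply: rint_ge0 => x; rewrite mulr_ge0//.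
  rewrite (laplacian_comp x Cv D1 D2) addr_ge0//.
    rewrite mulrA mulrNN mulr_ge0 ?mulr_ge0 ?expR_ge0 ?(ltW l0)//.
    by rewrite sumr_ge0// => i _; exact: sqr_ge0.
  by rewrite mulr_le0// mulNr oppr_le0 mulr_ge0 ?expR_ge0// ltW.
have mexp (w : E -> R) : measurable_fun setT w -> measurable_fun setT (fun x => expR (- l * w x)).
  move=> mw; apply: (measurableT_comp (continuous_measurable_fun (@continuous_expR R))).
  by apply: measurable_funM; [exact: measurable_cst|].
have Lexp (w : E -> R) : measurable_fun setT w -> (forall x, 0 <= w x) ->
    loc_integrable (fun x => expR (- l * w x)).
  move=> mw w0; apply: (@loc_integrable_bounded _ _ _ 1); first exact: mexp.
  by move=> x; rewrite ger0_norm ?expR_ge0// expNl_le1// ltW.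
have mv := loc_integrable_measurable Lv.
have I1 : itg mu (fun x => expR (- l * v x) * laplacian psi x).
  by apply: itg_test => //; exact: Lexp.
have I2 : itg mu (fun x => expR (- l * u x) * laplacian psi x).
  by apply: itg_test => //; exact: Lexp.
have Lip := lipschitz_ge0 (C := l) D1 ltac:(by move=> s s0;
  rewrite normrM normrN (ger0_norm (ltW l0)) (ger0_norm (expR_ge0 _)) ler_piMr ?expNl_le1 ?(ltW l0)).
suff : `|rint mu (fun x => expR (- l * v x) * laplacian psi x) -
         rint mu (fun x => expR (- l * u x) * laplacian psi x)| <= e.
  by rewrite ler_norml => /andP[_ H2]; lra.
rewrite -rintB//.
have I3 : itg mu (fun x => `|v x - u x| * \1_(cube n%:R) x).
  by apply: loc_integrable_cube; apply: loc_integrable_norm; apply: loc_integrableB.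
apply: (le_trans (rint_norm (itgB I1 I2))).
apply: (@le_trans _ _ (rint mu (fun x => (l * C) * (`|v x - u x| * \1_(cube n%:R) x)))).
  apply: rint_le; [exact/itg_norm/itgB|exact: itgZ|move=> x].
  rewrite -mulrBl normrM (_ : l * C * _ = (l * `|v x - u x|) * (C * \1_(cube n%:R) x)); last by ring.
  by rewrite ler_pM// Lip.
rewrite rintZ// (le_trans (ler_wpM2l _ Ht))//; first by rewrite mulr_ge0// ltW.
rewrite mulrCA ler_piMr ?(ltW e0)// ler_pdivrMr ?mulr_gt0 ?ltr_wpDl// mul1r.
by rewrite ler_wpM2l ?(ltW l0)// lerDl.
Qed.

End harmonicity.

(** * The logarithmic gradient *)

Section log_gradient.
Context {R : realType} {p : nat}.
Notation E := 'rV[R]_p.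
Notation mu := (@lebesgue_rV R p).
Implicit Types (u h v phi psi eta : E -> R) (x y z a : E) (i : 'I_p).

Lemma damp_derive_mul_bounded (l s : R) : 0 < l -> 0 <= s ->
  `|(1 - l * s) * expR (- l * s) * s| <= 4 / l.
Proof.
move=> l0 s0; pose x := l * s / 2.
have x0 : 0 <= x by rewrite divr_ge0// mulr_ge0// ltW.
have e1 : 1 + x <= expR x by exact: expR_ge1Dx.
have ep : 0 < expR x by exact: expR_gt0.
have lsE : l * s = 2 * x by rewrite /x; field.
have -> : expR (- l * s) = (expR x)^-1 * (expR x)^-1.
  by rewrite -expRN -expRD; congr expR; rewrite mulNr lsE; ring.
rewrite ler_pdivlMr// -[X in _ * X](ger0_norm (ltW l0)) -normrM.
rewrite (_ : _ * l = ((1 - 2 * x) / expR x) * ((2 * x) / expR x)); last by rewrite -lsE; ring.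
rewrite normrM (_ : 4 = 2 * 2 :> R); last by ring.
rewrite ler_pM// normrM normfV (gtr0_norm ep) ler_pdivrMr//.
  by rewrite ler_norml; apply/andP; split; lra.
by rewrite ger0_norm; lra.
Qed.

Lemma measurable_exp_mul u (k : R) : measurable_fun setT u ->
  measurable_fun setT (fun x => expR (k * u x)).
Proof.
move=> mu'; apply: (measurableT_comp (continuous_measurable_fun (@continuous_expR R))).
by apply: measurable_funM.
Qed.

Lemma loc_integrableM u (f : E -> R) (C : R) : measurable_fun setT u ->
  (forall x, `|u x| <= C) -> loc_integrable f -> loc_integrable (fun x => u x * f x).
Proof.
move=> mu' uC Lf; have mf := loc_integrable_measurable Lf.
apply: (@loc_integrable_le _ _ _ (fun x => C * `|f x|)).
- exact: measurable_funM.
- by move=> x; rewrite normrM ler_wpM2r.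
- by apply: loc_integrableZ; exact: loc_integrable_norm.
Qed.

Lemma loc_integrable_aeM u (f : E -> R) : measurable_fun setT u -> (forall x, 0 <= u x) ->
  (forall r : R, exists M : R, {ae mu, forall x, cube r x -> u x <= M}) ->
  loc_integrable f -> loc_integrable (fun x => u x * f x).
Proof.
move=> mu' u0 HM Lf; have mf := loc_integrable_measurable Lf.
apply: loc_integrable_intro => k; have [M uM] := HM k%:R.
have L : loc_integrable (fun x => Num.min (u x) `|M| * f x).
  apply: (@loc_integrableM _ _ `|M|) => //; first by apply: measurable_minr.
  by move=> x; rewrite ger0_norm ?le_min ?u0//= ge_min lexx orbT.
apply: itg_ae (loc_integrable_cube k%:R L).
  by apply: measurable_funM; [exact: measurable_funM|exact: measurable_indic_cube].
apply: filterS uM => x Hx; rewrite indicE.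
case: (boolP (x \in _)) => [|_]; last by rewrite !mulr0.
by rewrite inE => /Hx ux; rewrite min_l// (le_trans ux)// ler_norm.
Qed.

Variables (m : E -> R) (Dm g : E -> E) (J : E -> 'M[R]_p).
Hypotheses (m0 : forall x, 0 < m x) (Wm : weak_gradient m Dm) (Wg : weak_jacobian g J)
  (Dm_def : forall x i, Dm x 0 i = m x * g x 0 i)
  (Lg2 : loc_integrable (fun x => sqnorm (g x))) (Lm : loc_integrable m).

Let mm : measurable_fun setT m. Proof. exact: loc_integrable_measurable. Qed.
Let LtrJ : loc_integrable (fun x => \tr (J x)).
Proof. by apply: loc_integrable_sum => i; have [] := Wg i i. Qed.
Let mg j : measurable_fun setT (fun x => g x 0 j).
Proof. by have [/loc_integrable_measurable] := Wg j j. Qed.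
Let DmgE x : dotV (Dm x) (g x) = m x * sqnorm (g x).
Proof. by rewrite /sqnorm /dotV mulr_sumr; apply: eq_bigr => i _; rewrite Dm_def mulrA. Qed.

Lemma rint_laplacian_gradient u (Du : E -> E) psi : weak_gradient u Du -> test_function psi ->
  rint mu (fun x => u x * laplacian psi x) =
  - rint mu (fun x => \sum_i Du x 0 i * partial i psi x).
Proof.
move=> Wu tpsi.
have tpp i : test_function (partial i psi) by exact: test_partial.
have tppp i : test_function (partial i (partial i psi)) by exact: test_partial.
rewrite rint_sum; last by move=> i; apply: itg_test => //; have [] := Wu i.
rewrite -sumrN.
transitivity (\sum_i rint mu (fun x => u x * partial i (partial i psi) x)).
  rewrite -rint_sum; last by move=> i; apply: itg_test => //; have [] := Wu i.
  by apply: eq_rint => x; rewrite mulr_sumr.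
by apply: eq_bigr => i _; exact: weak_partialP.
Qed.

(* [exp (- l m)] is subharmonic with gradient [- l damp l m g]; this gives the
   inequality with [(1 - l m) |g|^2] in place of [|g|^2], and [l] tends to 0. *)
Lemma superharmonic_log_gradient : weakly_superharmonic m ->
  {ae mu, forall x, \tr (J x) + sqnorm (g x) <= 0}.
Proof.
move=> Sm; pose l (n : nat) : R := n.+1%:R^-1.
have l0 n : 0 < l n by rewrite invr_gt0.
have m0' x : 0 <= m x by exact: ltW.
have mtr := loc_integrable_measurable LtrJ.
pose c n x := (1 - l n * m x) * expR (- l n * m x) * m x.
have mc n : measurable_fun setT (c n).
  apply: measurable_funM => //; apply: measurable_funM; last exact: measurable_exp_mul.
  by apply: measurable_funB => //; exact: measurable_funM.
have cb n x : `|c n x| <= 4 / l n by exact: damp_derive_mul_bounded.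
have Lc n : loc_integrable (fun x => c n x * sqnorm (g x)).
  exact: loc_integrableM (mc n) (cb n) Lg2.
have md n : measurable_fun setT (fun x => damp (l n) (m x)).
  by apply: measurable_funM => //; exact: measurable_exp_mul.
have db n x : `|damp (l n) (m x)| <= (l n)^-1.
  by rewrite ger0_norm ?damp_ge0// damp_bounded.
have Ld n : loc_integrable (fun x => damp (l n) (m x) * \tr (J x)).
  exact: loc_integrableM (md n) (db n) LtrJ.
have step n : {ae mu, forall x, 0 <= - (c n x * sqnorm (g x) + damp (l n) (m x) * \tr (J x))}.
  apply: ae_ge0_of_bumps.
    have := loc_integrableZ (-1) (loc_integrableD (Lc n) (Ld n)).
    by congr loc_integrable; apply/funext => x; rewrite mulN1r.
  move=> a r r0; set psi := radial (bumpf r) a.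
  have tpsi : test_function psi by exact: test_bump.
  have H := superharmonic_expN Sm m0' (l0 n) tpsi (fun x => bump_ge0 _ _).
  have We : weak_gradient (fun x => expR (- l n * m x))
      (fun x => (- l n * expR (- l n * m x)) *: Dm x).
    move=> i; rewrite (_ : (fun x => _ 0 i) = (fun x => - l n * expR (- l n * m x) * Dm x 0 i)).
      by apply: weak_partial_expN => //; exact: ltW.
    by apply/funext => x; rewrite mxE.
  have DAg x : dotV (((1 - l n * m x) * expR (- l n * m x)) *: Dm x) (g x) = c n x * sqnorm (g x).
    by rewrite dotVZ DmgE mulrA.
  have I1 : itg mu (fun x => dotV (((1 - l n * m x) * expR (- l n * m x)) *: Dm x) (g x) * psi x).
    have := itg_test (Lc n) tpsi.
    by congr (mu.-integrable setT _); apply/funext => x; rewrite DAg.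
  have V := rint_by_parts Wg tpsi (weak_gradient_damp Wm m0' (ltW (l0 n))) (db n) I1.
  have E1 : rint mu (fun x => expR (- l n * m x) * laplacian psi x) =
      l n * rint mu (fun x => damp (l n) (m x) * \sum_i g x 0 i * partial i psi x).
    rewrite (rint_laplacian_gradient We tpsi) -rintZ_measurable; last first.
      apply: measurable_funM => //; apply: measurable_sum => i.
      apply: measurable_funM => //; exact: test_measurable (test_partial i tpsi).
    rewrite -[LHS]mulN1r -rintZ_measurable; last first.
      apply: measurable_sum => i; apply: measurable_funM.
        exact: (weak_gradient_measurable We).
      exact: test_measurable (test_partial i tpsi).
    apply: eq_rint => x; rewrite !mulr_sumr; apply: eq_bigr => i _.
    by rewrite mxE Dm_def /damp; ring.
  move: H; rewrite E1 V pmulr_rge0//; congr (0 <= _).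
  rewrite -[LHS]mulN1r -rintZ_measurable; last first.
    apply: measurable_funM; last exact: test_measurable.
    apply: measurable_funD; last exact: measurable_funM.
    apply: measurable_dotV => // j.
    rewrite (_ : (fun x => _ 0 j) = (fun x => (1 - l n * m x) * expR (- l n * m x) * Dm x 0 j)).
      apply: measurable_funM; last exact: (weak_gradient_measurable Wm).
      apply: measurable_funM; last exact: measurable_exp_mul.
      by apply: measurable_funB => //; exact: measurable_funM.
    by apply/funext => x; rewrite mxE.
  by apply: eq_rint => x; rewrite DAg; ring.
have all_n : {ae mu, forall x, forall n, (1 - l n * m x) * sqnorm (g x) + \tr (J x) <= 0}.
  apply/ae_foralln => n; apply: filterS (step n) => x.
  rewrite /c /damp oppr_ge0.
  rewrite (_ : _ + _ = (m x * expR (- l n * m x)) * ((1 - l n * m x) * sqnorm (g x) + \tr (J x))); last by ring.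
  by rewrite pmulr_rle0// mulr_gt0// expR_gt0.
apply: filterS all_n => x Hx; rewrite addrC -[X in X + _]mul1r.
have H : (1 - l n * m x) * sqnorm (g x) + \tr (J x) @[n --> \oo] -->
    1 * sqnorm (g x) + \tr (J x).
  apply: cvgD; last exact: cvg_cst.
  apply: cvgM; last exact: cvg_cst.
  rewrite -[X in _ --> X]subr0; apply: cvgB; first exact: cvg_cst.
  rewrite -[X in _ --> X](mul0r (m x)); apply: cvgM; last exact: cvg_cst.
  exact: cvgn_invS.
rewrite -(cvg_lim (@Rhausdorff R) H); apply: limr_le; first by apply/cvg_ex; eexists; exact: H.
exact: nearW.
Qed.

Lemma subharmonic_log_gradient : weakly_subharmonic m ->
  {ae mu, forall x, 0 <= \tr (J x) + sqnorm (g x)}.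
Proof.
move=> Sm; have m0' x : 0 <= m x by exact: ltW.
have mb (r : R) : exists M : R, {ae mu, forall x, cube r x -> m x <= M}.
  exact: subharmonic_locally_bounded.
have L1 := loc_integrable_aeM mm m0' mb Lg2.
have L2 := loc_integrable_aeM mm m0' mb LtrJ.
suff : {ae mu, forall x, 0 <= m x * sqnorm (g x) + m x * \tr (J x)}.
  apply: filterS => x; rewrite -mulrDr pmulr_rge0// addrC//.
apply: ae_ge0_of_bumps; first exact: loc_integrableD.
move=> a r r0; set psi := radial (bumpf r) a.
have tpsi : test_function psi by exact: test_bump.
have H := weakly_subharmonicP Sm tpsi (fun x => bump_ge0 _ _).
have I1 : itg mu (fun x => dotV (Dm x) (g x) * psi x).
  have := itg_test L1 tpsi.
  by congr (mu.-integrable setT _); apply/funext => x; rewrite DmgE.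
have E1 x : \sum_i Dm x 0 i * partial i psi x = m x * \sum_i g x 0 i * partial i psi x.
  by rewrite mulr_sumr; apply: eq_bigr => i _; rewrite Dm_def mulrA.
have I3 : itg mu (fun x => m x * \sum_i g x 0 i * partial i psi x).
  have := @itg_sum _ _ _ mu _ (fun i x => Dm x 0 i * partial i psi x).
  move=> /(_ (fun i => itg_test (let: And3 _ L _ := Wm i in L) (test_partial i tpsi))).
  by congr (mu.-integrable setT _); apply/funext => x; rewrite E1.
have V := rint_by_parts_ge0 Wg tpsi Wm m0' mm I1 (itg_test L2 tpsi) I3.
move: H; rewrite (rint_laplacian_gradient Wm tpsi) (eq_rint _ E1) V opprK.
by congr (0 <= _); apply: eq_rint => x; rewrite DmgE.
Qed.

End log_gradient.

(** * The identity for the quotient *)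

Section quotient_identity.
Context {R : realType} {p : nat}.
Notation E := 'rV[R]_p.
Notation mu := (@lebesgue_rV R p).
Implicit Types (x y z a : E) (i : 'I_p).

Variables (c : R) (gam m xi : E -> R) (Dgam Dm g Dxi : E -> E) (Hgam J Hxi : E -> 'M[R]_p).
Hypotheses (Wgam : weak_hessian gam Dgam Hgam) (Wm : weak_gradient m Dm)
  (Wg : weak_jacobian g J) (Wxi : weak_hessian xi Dxi Hxi)
  (Dm_def : forall x i, Dm x 0 i = m x * g x 0 i)
  (gam_def : forall x, gam x * m x = c * xi x).

Lemma qcvg_unique i t (u : E -> R) x (d e : R) : qcvg i t u x d -> qcvg i t u x e -> d = e.
Proof. by move=> Hd He; exact: (cvg_unique (@Rhausdorff R) Hd He). Qed.

Lemma quotient_gradient_ae i :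
  {ae mu, forall x, c * Dxi x 0 i = gam x * (m x * g x 0 i) + m x * Dgam x 0 i}.
Proof.
pose u (j : option bool) : E -> R :=
  match j with None => gam | Some true => m | Some false => xi end.
pose h (j : option bool) : E -> R := fun x =>
  match j with None => Dgam x 0 i | Some true => Dm x 0 i | Some false => Dxi x 0 i end.
have W j : weak_partial i (u j) (h j).
  by case: j => [[]|]; [exact: Wm|exact: (Wxi.1 i)|exact: (Wgam.1 i)].
have [t [tn0' t0 _ tae]] := quot_ae_seq W.
have tn0 n : t n != 0 by have [] := tn0' n.
apply: filterS tae => x H.
have H1 := qcvgM tn0 t0 (H None : qcvg i t gam x _) (H (Some true) : qcvg i t m x _).
have H2 := qcvgM tn0 t0 (qcvg_cst i t x c) (H (Some false) : qcvg i t xi x _).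
have H1' := eq_qcvg (v := fun x => c * xi x) (fun n => gam_def _) (gam_def x) H1.
have := qcvg_unique H1' H2; rewrite /= Dm_def mul0r add0r => <-.
by ring.
Qed.

Lemma quotient_hessian_ae i :
  {ae mu, forall x, c * Hxi x i i =
    m x * (Hgam x i i + 2 * (Dgam x 0 i * g x 0 i) + gam x * (g x 0 i ^+ 2 + J x i i))}.
Proof.
pose u (j : option (option (option bool))) : E -> R := fun x =>
  match j with
  | None => gam x | Some None => m x | Some (Some None) => g x 0 i
  | Some (Some (Some true)) => Dgam x 0 i | Some (Some (Some false)) => Dxi x 0 i end.
pose h (j : option (option (option bool))) : E -> R := fun x =>
  match j with
  | None => Dgam x 0 i | Some None => Dm x 0 i | Some (Some None) => J x i i
  | Some (Some (Some true)) => Hgam x i i | Some (Some (Some false)) => Hxi x i i end.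
have W j : weak_partial i (u j) (h j).
  case: j => [[[[]|]|]|]; [exact: (Wgam.2 i i)|exact: (Wxi.2 i i)|exact: (Wg i i)|
    exact: (Wm i)|exact: (Wgam.1 i)].
have [t [tn0' t0 _ tae]] := quot_ae_seq W.
have tn0 n : t n != 0 by have [] := tn0' n.
have first := quotient_gradient_ae i.
have shifted : {ae mu, forall x, forall n,
    c * Dxi (x + t n *: delta_mx 0 i) 0 i =
    gam (x + t n *: delta_mx 0 i) *
      (m (x + t n *: delta_mx 0 i) * g (x + t n *: delta_mx 0 i) 0 i) +
    m (x + t n *: delta_mx 0 i) * Dgam (x + t n *: delta_mx 0 i) 0 i}.
  by apply/ae_foralln => n; exact: (ae_shift (t n *: delta_mx 0 i) first).
apply: filterS3 tae first shifted => x H E0 En.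
have Hgam' : qcvg i t gam x _ := H None.
have Hm' : qcvg i t m x _ := H (Some None).
have Hg' : qcvg i t (fun x => g x 0 i) x _ := H (Some (Some None)).
have HDgam' : qcvg i t (fun x => Dgam x 0 i) x _ := H (Some (Some (Some true))).
have HDxi' : qcvg i t (fun x => Dxi x 0 i) x _ := H (Some (Some (Some false))).
have H1 := qcvgD (qcvgM tn0 t0 Hgam' (qcvgM tn0 t0 Hm' Hg')) (qcvgM tn0 t0 Hm' HDgam').
have H2 := qcvgM tn0 t0 (qcvg_cst i t x c) HDxi'.
have H2' := eq_qcvg (v := fun x => gam x * (m x * g x 0 i) + m x * Dgam x 0 i) En E0 H2.
have := qcvg_unique H2' H1; rewrite /= Dm_def mul0r add0r => ->.
by ring.
Qed.

Lemma quotient_laplacian_ae :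
  {ae mu, forall x, c * \tr (Hxi x) =
    m x * (\tr (Hgam x) + 2 * dotV (Dgam x) (g x) + gam x * (\tr (J x) + sqnorm (g x)))}.
Proof.
have : {ae mu, forall x, forall i, c * Hxi x i i =
    m x * (Hgam x i i + 2 * (Dgam x 0 i * g x 0 i) + gam x * (g x 0 i ^+ 2 + J x i i))}.
  by apply: filter_forall => i; exact: quotient_hessian_ae.
apply: filterS => x H.
rewrite /mxtrace mulr_sumr (eq_bigr _ (fun i _ => H i)) -mulr_sumr; congr (_ * _).
rewrite !big_split/= -!mulr_sumr big_split/= sqnormE.
by congr (_ + _ * _); exact: addrC.
Qed.

End quotient_identity.

(** * Gaussian integrals *)

Section density.
Context d (T : measurableType d) (R : realType).
Variables (mu nu : {measure set T -> \bar R}) (w : T -> R).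
Hypotheses (mw : measurable_fun setT w) (w0 : forall x, 0 <= w x)
  (nuE : forall V, measurable V -> nu V = (\int[mu]_(x in V) (w x)%:E)%E).
Local Open Scope ereal_scope.
Import HBNNSimple.

Let w0E x : 0 <= (w x)%:E. Proof. by rewrite lee_fin. Qed.
Let mwE : measurable_fun setT (fun x => (w x)%:E). Proof. exact/measurable_EFinP. Qed.

Let integral_density_nnsfun (h : {nnsfun T >-> R}) :
  \int[nu]_x (h x)%:E = \int[mu]_x ((h x)%:E * (w x)%:E).
Proof.
under [LHS]eq_integral do rewrite fimfunE -fsumEFin//.
rewrite [LHS]ge0_integral_fsum//; last 2 first.
  - by move=> r; exact/measurable_EFinP/measurableT_comp.
  - by move=> n x _; rewrite EFinM nnfun_muleindic_ge0.
under [RHS]eq_integral.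
  move=> x xD; rewrite muleC fimfunE -fsumEFin// ge0_mule_fsumr; last first.
    by move=> r; rewrite EFinM nnfun_muleindic_ge0.
  over.
rewrite [RHS]ge0_integral_fsum//; last 2 first.
  - move=> r; apply: emeasurable_funM => //.
    by apply/measurable_EFinP; apply/measurableT_comp.
  - by move=> n x _; rewrite EFinM mule_ge0// nnfun_muleindic_ge0.
apply: eq_fsbigr => r _.
have [r0|r0] := ltP r 0%R.
  have z x : \1_(h @^-1` [set r]) x = 0%R :> R.
    rewrite indicE memNset//= => hx; have : (0 <= h x)%R by [].
    by rewrite hx leNgt r0.
  rewrite integral0_eq; last by move=> x _; rewrite z mulr0.
  by rewrite integral0_eq// => x _; rewrite z mulr0 mule0.
have mh : measurable (h @^-1` [set r]) by [].
under eq_integral do rewrite EFinM.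
rewrite ge0_integralZl//; last exact/measurable_EFinP/measurable_indic.
rewrite integral_indic// setIT nuE//.
under [RHS]eq_integral do rewrite EFinM muleCA.
rewrite ge0_integralZl//; last 2 first.
  - by apply: emeasurable_funM => //; exact/measurable_EFinP/measurable_indic.
  - by move=> x _; rewrite mule_ge0// lee_fin.
congr (_ * _); rewrite integral_mkcond; apply: eq_integral => x _.
by rewrite patchE indicE; case: ifP => _; rewrite ?mule1 ?mule0.
Qed.

Lemma ge0_integral_density (f : T -> \bar R) : measurable_fun setT f -> (forall x, 0 <= f x) ->
  \int[nu]_x f x = \int[mu]_x (f x * (w x)%:E).
Proof.
move=> mf f0; pose f_ := nnsfun_approx measurableT mf.
transitivity (lim (\int[nu]_x (f_ n x)%:E @[n --> \oo])).
  rewrite -monotone_convergence//=.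
  - apply: eq_integral => ? /[!inE] xD; apply/esym/cvg_lim => //=.
    exact: cvg_nnsfun_approx.
  - by move=> n; exact/measurable_EFinP/measurable_funTS.
  - by move=> n ? _; rewrite lee_fin.
  - by move=> ? _ ? ? mn; rewrite lee_fin; exact/lefP/nd_nnsfun_approx.
transitivity (lim (\int[mu]_x ((f_ n x)%:E * (w x)%:E) @[n --> \oo])).
  by apply: congr_lim; apply/funext => n; exact: integral_density_nnsfun.
rewrite -monotone_convergence//=.
- apply: eq_integral => x _; apply/cvg_lim => //=.
  apply: cvgeZr => //; exact: cvg_nnsfun_approx.
- by move=> n; apply: emeasurable_funM => //; exact/measurable_EFinP.
- by move=> n x _; rewrite mule_ge0// lee_fin.
- move=> x _ a b ab; rewrite lee_wpmul2r// lee_fin.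
  exact/lefP/nd_nnsfun_approx.
Qed.

End density.

Section gaussian.
Context {R : realType} {p : nat}.
Notation E := 'rV[R]_p.
Notation mu := (@lebesgue_rV R p).
Implicit Types (u h v phi psi eta Y : E -> R) (x y z a theta : E) (i : 'I_p).
Notation pdf := mvnormal_pdf.

Lemma ge0_integral_mvnormal theta (f : E -> \bar R) : measurable_fun setT f ->
  (forall x, 0 <= f x)%E ->
  (\int[mvnormal_prob theta]_x f x = \int[mu]_x (f x * (pdf theta x)%:E))%E.
Proof.
move=> mf f0; apply: (@ge0_integral_density _ _ _ mu (mvnormal_prob theta)) => //.
- exact: measurable_mvnormal_pdf.
- exact: mvnormal_pdf_ge0.
Qed.

Lemma itg_normal theta Y : measurable_fun setT Y ->
  normal_integrable theta Y <-> itg mu (fun x => Y x * pdf theta x).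
Proof.
move=> mY.
have mP := measurable_mvnormal_pdf theta.
have E1 : (\int[mvnormal_prob theta]_x `|(Y x)%:E| = \int[mu]_x `|(Y x * pdf theta x)%:E|)%E.
  rewrite ge0_integral_mvnormal//.
  - apply: eq_integral => x _.
    by rewrite /= normrM (ger0_norm (mvnormal_pdf_ge0 _ _)) EFinM.
  - by apply/measurable_EFinP; exact: measurableT_comp.
split=> [/integrableP[_ H]|/integrableP[_ H]].
- apply/integrableP; split; last by rewrite -E1.
  by apply/measurable_EFinP; exact: measurable_funM.
- by apply/integrableP; split; [exact/measurable_EFinP|rewrite E1].
Qed.

Lemma normal_integrable_itg theta Y :
  normal_integrable theta Y -> itg mu (fun x => Y x * pdf theta x).
Proof.
move=> H; apply/itg_normal => //; exact: itg_measurable H.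
Qed.

Lemma expectation_rint theta Y : measurable_fun setT Y -> (forall x, 0 <= Y x) ->
  itg mu (fun x => Y x * pdf theta x) ->
  ('E_(mvnormal_prob theta)[Y] = (rint mu (fun x => Y x * pdf theta x))%:E)%E.
Proof.
move=> mY Y0 IY; rewrite unlock EFin_rint//.
rewrite ge0_integral_mvnormal//; exact/measurable_EFinP.
Qed.

Lemma expectation_lty_itg theta Y : measurable_fun setT Y -> (forall x, 0 <= Y x) ->
  ('E_(mvnormal_prob theta)[Y] < +oo)%E -> itg mu (fun x => Y x * pdf theta x).
Proof.
move=> mY Y0 H; apply/itg_normal => //; apply/integrableP; split; first exact/measurable_EFinP.
by move: H; rewrite unlock; under [in X in _ -> X]eq_integral do rewrite /= ger0_norm//.
Qed.

Definition gauss (s : R) : R := normal_peak 1 ^+ p * expR (- 2^-1 * s).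

Lemma mvnormal_pdfE theta : pdf theta = radial gauss theta.
Proof.
apply/funext => x; rewrite /radial /gauss /mvnormal_pdf sqdE mulr_sumr expR_sum.
rewrite -[X in normal_peak 1 ^+ X]card_ord -prodr_const -big_split/=.
apply: eq_bigr => i _; rewrite normal_pdfE ?oner_neq0// /normal_fun.
by congr (_ * expR _); rewrite expr1n -mulr_natr mul1r; field.
Qed.

Lemma gauss_gt0 s : 0 < gauss s.
Proof. by rewrite mulr_gt0 ?expR_gt0// exprn_gt0// normal_peak_gt0// oner_neq0. Qed.

Lemma is_derive_gauss s : is_derive s (1 : R) gauss (- 2^-1 * gauss s).
Proof.
have := is_deriveZ (normal_peak 1 ^+ p : R) (is_derive_expNl 2^-1 s).
by rewrite /GRing.scale/= mulrCA.
Qed.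

Lemma smooth_gauss : smooth gauss.
Proof.
move=> k; apply: C1M; first exact: C1_cst.
have := C1_affine (- 2^-1 : R) 0 (smooth_expR k).
by congr C1; apply/funext => s; rewrite addr0.
Qed.

Lemma normal_integrable_loc Y : measurable_fun setT Y ->
  itg mu (fun x => Y x * pdf 0 x) -> loc_integrable Y.
Proof.
move=> mY IY; apply: loc_integrable_intro => k.
pose c := gauss (p%:R * k%:R ^+ 2).
have c0 : 0 < c by exact: gauss_gt0.
apply: itg_le (itgZ c^-1 (itg_norm IY)).
  by apply: measurable_funM => //; exact: measurable_indic_cube.
move=> x; rewrite !normrM (ger0_norm (indic_cube_ge0 _ _)) indicE.
rewrite (ger0_norm (mvnormal_pdf_ge0 _ _)) mulrCA ler_wpM2l//.
case: (boolP (x \in _)) => [|_]; last first.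
  by rewrite mulr_ge0 ?mvnormal_pdf_ge0// invr_ge0 ltW.
rewrite inE => xk; rewrite mulrC ler_pdivlMr// mul1r mvnormal_pdfE /radial /c /gauss.
rewrite ler_wpM2l ?exprn_ge0 ?normal_peak_ge0// ler_expR.
rewrite !mulNr lerN2 ler_wpM2l// sqdE [leRHS]mulr_natl.
rewrite -[X in _ <= _ *+ X]card_ord.
rewrite -sumr_const; apply: ler_sum => i _; rewrite mxE subr0.
by rewrite -real_normK ?num_real// lerXn2r ?nnegrE.
Qed.

End gaussian.

Section gaussian_identity.
Context {R : realType} {p : nat}.
Notation E := 'rV[R]_p.
Notation mu := (@lebesgue_rV R p).
Notation gauss := (@gauss R p).
Notation rho := kernel_profile.
Notation drho := kernel_profile'.
Implicit Types (u h v phi psi eta Y : E -> R) (x y z a : E) (i : 'I_p).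

Let M : R := 6`!%:R + 2 * 5`!%:R.
Let M0 : 0 <= M. Proof. by rewrite addr_ge0// mulr_ge0. Qed.

(* [expR 1 * bumpf 1] equals 1 at 0. *)
Definition cut_gauss (N s : R) : R := gauss s * (expR 1 * bumpf 1 (N^-1 * s)).
Definition cut_gauss' (N s : R) : R :=
  gauss s * (expR 1 * (- 2^-1 * bumpf 1 (N^-1 * s) - N^-1 * rho (N^-1 * s))).
Definition cut_gauss'' (N s : R) : R :=
  gauss s * (expR 1 * (4^-1 * bumpf 1 (N^-1 * s) + N^-1 * rho (N^-1 * s)
    - N^-1 * (N^-1 * drho (N^-1 * s)))).

Let scaled (f df : R -> R) (N s : R) : (forall s : R, is_derive s (1 : R) f (df s)) ->
  is_derive s (1 : R) (fun s => f (N^-1 * s)) (N^-1 * df (N^-1 * s)).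
Proof.
move=> Df; have H : is_derive s (1 : R) (fun s : R => N^-1 * s) N^-1.
  by apply: is_derive_eq; rewrite /GRing.scale/= mulr1.
have := @is_derive1_comp _ f (fun s => N^-1 * s) s _ _ (Df _) H.
by rewrite mulrC.
Qed.

Lemma is_derive_bump1 (s : R) : is_derive s (1 : R) (bumpf 1) (- rho s).
Proof. by have := C1_is_derive s (smooth_bump 1 1%N); rewrite derive1_bump1. Qed.

Lemma derive1_cut_gauss N : derive1 (cut_gauss N) = cut_gauss' N.
Proof.
apply: derive1_is_derive => s.
have D1 := is_deriveZ (expR 1) (scaled N s is_derive_bump1).
suff <- : gauss s * (expR 1 * (N^-1 * - rho (N^-1 * s))) +
    expR 1 * bumpf 1 (N^-1 * s) * (- 2^-1 * gauss s) = cut_gauss' N s.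
  exact: (is_deriveM (is_derive_gauss (p := p) s) D1).
by rewrite /cut_gauss'; ring.
Qed.

Lemma derive1_cut_gauss' N : derive1 (cut_gauss' N) = cut_gauss'' N.
Proof.
apply: derive1_is_derive => s.
have D1 := is_deriveZ (- 2^-1) (scaled N s is_derive_bump1).
have D2 := is_deriveZ N^-1 (scaled N s is_derive_rho).
have D3 := is_deriveZ (expR 1) (is_deriveB D1 D2).
suff <- : gauss s * (expR 1 * (- 2^-1 * (N^-1 * - rho (N^-1 * s)) -
      N^-1 * (N^-1 * drho (N^-1 * s)))) +
    expR 1 * (- 2^-1 * bumpf 1 (N^-1 * s) - N^-1 * rho (N^-1 * s)) * (- 2^-1 * gauss s) =
    cut_gauss'' N s.
  exact: (is_deriveM (is_derive_gauss (p := p) s) D3).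
by rewrite /cut_gauss''; generalize (N^-1) => k; field.
Qed.

Lemma smooth_cut_gauss N : smooth (cut_gauss N).
Proof.
move=> k; apply: C1M; first exact: smooth_gauss.
exact: smooth_scale (smooth_bump 1) k.
Qed.

Section bounds.
Variables (N s : R).
Hypotheses (N1 : 1 <= N) (s0 : 0 <= s).

Let N0 : 0 < N. Proof. exact: lt_le_trans N1. Qed.
Let Ni : 0 <= N^-1. Proof. by rewrite invr_ge0 ltW. Qed.
Let Ni1 : N^-1 <= 1. Proof. by rewrite invf_le1. Qed.
Let sN : 0 <= N^-1 * s. Proof. exact: mulr_ge0. Qed.
Let g0 : 0 <= gauss s. Proof. by rewrite ltW// gauss_gt0. Qed.
Let e0 : 0 <= expR 1 :> R. Proof. exact: expR_ge0. Qed.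

Let b_le : `|bumpf 1 (N^-1 * s)| <= M.
Proof.
rewrite ger0_norm ?bump_ge0// (le_trans (flat_le 0 _)) ?gerBl//.
by rewrite /M -natrM -natrD ler_nat.
Qed.
Let r_le : `|rho (N^-1 * s)| <= M. Proof. exact: rho_le. Qed.
Let d_le : `|drho (N^-1 * s)| <= M. Proof. exact: drho_le. Qed.

Let mul_le (a b : R) : 0 <= a <= 1 -> `|b| <= M -> `|a * b| <= M.
Proof.
move=> /andP[a0 a1] bM; rewrite normrM (ger0_norm a0) -[leRHS]mul1r.
by rewrite ler_pM.
Qed.

Let Nr_le : `|N^-1 * rho (N^-1 * s)| <= M. Proof. by apply: mul_le => //; rewrite Ni. Qed.

Lemma cut_gauss_le : `|cut_gauss N s| <= 3 * expR 1 * M * gauss s.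
Proof.
rewrite /cut_gauss normrM (ger0_norm g0) mulrC ler_wpM2r// normrM (ger0_norm e0).
rewrite (mulrC 3) -mulrA ler_wpM2l//; have := b_le; have := M0; lra.
Qed.

Lemma cut_gauss'_le : `|cut_gauss' N s| <= 3 * expR 1 * M * gauss s.
Proof.
rewrite /cut_gauss' normrM (ger0_norm g0) mulrC ler_wpM2r// normrM (ger0_norm e0).
rewrite (mulrC 3) -mulrA ler_wpM2l//.
rewrite (le_trans (ler_normB _ _))//.
have : `|- 2^-1 * bumpf 1 (N^-1 * s)| <= M by rewrite mulNr normrN; apply: mul_le => //; lra.
by have := Nr_le; have := M0; lra.
Qed.

Lemma cut_gauss''_le : `|cut_gauss'' N s| <= 3 * expR 1 * M * gauss s.
Proof.
rewrite /cut_gauss'' normrM (ger0_norm g0) mulrC ler_wpM2r// normrM (ger0_norm e0).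
rewrite (mulrC 3) -mulrA ler_wpM2l//.
rewrite (le_trans (ler_normB _ _))// (le_trans (lerD (ler_normD _ _) (lexx _)))//.
have : `|4^-1 * bumpf 1 (N^-1 * s)| <= M by apply: mul_le => //; lra.
have : `|N^-1 * (N^-1 * drho (N^-1 * s))| <= M.
  by apply: mul_le; [rewrite Ni|apply: mul_le => //; rewrite Ni].
by have := Nr_le; lra.
Qed.

End bounds.

Lemma cut_gauss_cvg (s : R) : let N (n : nat) : R := n.+1%:R in
  [/\ cut_gauss (N n) s @[n --> \oo] --> gauss s,
      cut_gauss' (N n) s @[n --> \oo] --> - 2^-1 * gauss s &
      cut_gauss'' (N n) s @[n --> \oo] --> 4^-1 * gauss s].
Proof.
move=> N.
have z : (N n)^-1 @[n --> \oo] --> (0 : R) by exact: cvgn_invS.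
have zs : (N n)^-1 * s @[n --> \oo] --> (0 : R).
  by rewrite -[X in _ --> X](mul0r s); apply: cvgM => //; exact: cvg_cst.
have b1 : bumpf 1 (0 : R) = (expR 1)^-1.
  by rewrite /bumpf /flat subr0 ltr01 expr0 !invr1 mul1r expRN.
have cb : bumpf 1 ((N n)^-1 * s) @[n --> \oo] --> (expR 1)^-1.
  rewrite -b1; apply: continuous_cvg => //.
  exact: (is_derive_continuous is_derive_bump1).
have cr : (N n)^-1 * rho ((N n)^-1 * s) @[n --> \oo] --> (0 : R).
  rewrite -[X in _ --> X](mul0r (rho 0)); apply: cvgM => //.
  apply: continuous_cvg => //; exact: (is_derive_continuous is_derive_rho).
have cd : (N n)^-1 * ((N n)^-1 * drho ((N n)^-1 * s)) @[n --> \oo] --> (0 : R).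
  rewrite -[X in _ --> X](mul0r (0 * drho 0)); apply: cvgM => //; apply: cvgM => //.
  apply: continuous_cvg => //.
  have H : C1 0 (derive1 (rho : R -> R)) by exact: (smooth_derive (smooth_flatB 2)).
  by rewrite -(derive1_is_derive is_derive_rho); exact: (C1_continuous H).
have e0 : expR 1 != 0 :> R by rewrite gt_eqF// expR_gt0.
split.
- rewrite -[X in _ --> X](mulr1) -(mulfV e0); apply: cvgM; first exact: cvg_cst.
  by apply: cvgM => //; exact: cvg_cst.
- have -> : - 2^-1 * gauss s = gauss s * (expR 1 * (- 2^-1 * (expR 1)^-1 - 0)).
    by rewrite subr0; field.
  apply: cvgM; first exact: cvg_cst.
  apply: cvgM; first exact: cvg_cst.
  by apply: cvgB => //; apply: cvgM => //; exact: cvg_cst.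
- have -> : 4^-1 * gauss s = gauss s * (expR 1 * (4^-1 * (expR 1)^-1 + 0 - 0)).
    by rewrite subr0 addr0; field.
  apply: cvgM; first exact: cvg_cst.
  apply: cvgM; first exact: cvg_cst.
  apply: cvgB => //; apply: cvgD => //.
  by apply: cvgM => //; exact: cvg_cst.
Qed.

Lemma test_cut_gauss (N : R) theta : 0 < N -> test_function (radial (cut_gauss N) theta : E -> R).
Proof.
move=> N0; apply: (@test_radial _ _ _ _ N); first exact: smooth_cut_gauss.
by move=> s Ns; rewrite /cut_gauss bump_eq0 ?mulr0// mulrC ler_pdivlMr// mul1r.
Qed.

Lemma cut_gauss_ge0 N s : 0 <= cut_gauss N s.
Proof.
rewrite /cut_gauss mulr_ge0//; first by rewrite ltW// gauss_gt0.
by rewrite mulr_ge0 ?expR_ge0// bump_ge0.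
Qed.

End gaussian_identity.

Section cross_term.
Context {R : realType} {p : nat}.
Notation E := 'rV[R]_p.
Notation mu := (@lebesgue_rV R p).
Notation pdf := mvnormal_pdf.
Notation cut_gauss := (@cut_gauss R p).
Notation cut_gauss' := (@cut_gauss' R p).
Notation cut_gauss'' := (@cut_gauss'' R p).
Implicit Types (x y z a : E) (i : 'I_p).

Variables (theta : E) (gam : E -> R) (Dgam g : E -> E) (Hgam J : E -> 'M[R]_p) (sigma kappa : R).
Hypotheses (Wgam : weak_hessian gam Dgam Hgam) (Wg : weak_jacobian g J).
Hypotheses (sigma2 : sigma * sigma = 1) (sgam : forall x, 0 <= sigma * gam x).
Hypotheses (Lgam : loc_integrable gam).
Hypothesis ineq : {ae mu, forall x,
  \tr (Hgam x) + 2 * dotV (Dgam x) (g x) <= - kappa * gam x ^+ 2}.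

Let D0 x := p%:R - sqd theta x + 2 * \tr (J x) - 2 * dotV (x - theta) (g x).

Hypotheses
  (I1 : itg mu (fun x => gam x * dotV (x - theta) (g x) * pdf theta x))
  (I2 : itg mu (fun x => gam x * \tr (J x) * pdf theta x))
  (I3 : itg mu (fun x => dotV (Dgam x) (g x) * pdf theta x))
  (I4 : itg mu (fun x => gam x ^+ 2 * pdf theta x))
  (I5 : itg mu (fun x => D0 x ^+ 2 * pdf theta x)).

Let mgam : measurable_fun setT gam. Proof. exact: loc_integrable_measurable. Qed.
Let mg j : measurable_fun setT (fun x => g x 0 j).
Proof. by have [/loc_integrable_measurable] := Wg j j. Qed.
Let mJ := weak_jacobian_measurable Wg.
Let mtr : measurable_fun setT (fun x => \tr (J x)). Proof. exact: measurable_mxtrace. Qed.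
Let mP := @measurable_mvnormal_pdf R p theta.
Let P0 x : 0 <= pdf theta x. Proof. exact: mvnormal_pdf_ge0. Qed.

Lemma measurable_shift_dot : measurable_fun setT (fun x : E => dotV (x - theta) (g x)).
Proof.
apply: measurable_dotV => // j.
rewrite (_ : (fun x => _) = (fun x : E => x 0 j - theta 0 j)).
  by apply: measurable_funB => //; exact: measurable_coord.
by apply/funext => x; rewrite !mxE.
Qed.

Lemma measurable_sqd : measurable_fun setT (sqd theta : E -> R).
Proof. by apply: measurable_continuous; exact: (Ck_continuous (Ck_sqd 0 theta)). Qed.

Lemma measurable_D0 : measurable_fun setT D0.
Proof.
apply: measurable_funB; last first.
  by apply: measurable_funM => //; exact: measurable_shift_dot.
apply: measurable_funD; last exact: measurable_funM.
by apply: measurable_funB => //; exact: measurable_sqd.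
Qed.

Lemma itg_gam_D0 : itg mu (fun x => gam x * D0 x * pdf theta x).
Proof.
apply: (itg_le _ _ (itgD I4 I5)).
  by apply: measurable_funM => //; apply: measurable_funM => //; exact: measurable_D0.
move=> x; rewrite normrM (ger0_norm (P0 x)) -mulrDl ler_wpM2r//.
rewrite ler_norml; move: (gam x) (D0 x) => b c.
have : 0 <= (b + c) ^+ 2 by exact: sqr_ge0.
have : 0 <= (b - c) ^+ 2 by exact: sqr_ge0.
rewrite sqrrB sqrrD => H1 H2; have := sqr_ge0 b; have := sqr_ge0 c.
by move=> H3 H4; apply/andP; split; lra.
Qed.

Lemma itg_gam : itg mu (fun x => gam x * pdf theta x).
Proof.
apply: (itg_le _ _ (itgD (integrable_mvnormal_pdf theta) I4)).
  exact: measurable_funM.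
move=> x; rewrite normrM (ger0_norm (P0 x)) -[X in _ <= X + _]mul1r -mulrDl ler_wpM2r//.
rewrite ler_norml; have : 0 <= (gam x + 1) ^+ 2 by exact: sqr_ge0.
have : 0 <= (gam x - 1) ^+ 2 by exact: sqr_ge0.
rewrite sqrrB sqrrD => H1 H2; have := sqr_ge0 (gam x).
by move=> H3; apply/andP; split; lra.
Qed.

(* No Gaussian moment is needed: [gam (p - |x - theta|^2)] is [gam D0] plus
   integrable terms. *)
Lemma itg_gam_sqd : itg mu (fun x => gam x * sqd theta x * pdf theta x).
Proof.
apply: (eq_itg _ (itgB (itgD (itgZ p%:R itg_gam) (itgB (itgZ 2 I2) (itgZ 2 I1))) itg_gam_D0)) => x.
by rewrite /D0; ring.
Qed.

Lemma rint_by_parts_signed psi : test_function psi ->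
  itg mu (fun x => dotV (Dgam x) (g x) * psi x) ->
  itg mu (fun x => gam x * \tr (J x) * psi x) ->
  itg mu (fun x => gam x * \sum_i g x 0 i * partial i psi x) ->
  rint mu (fun x => gam x * \sum_i g x 0 i * partial i psi x) =
  - rint mu (fun x => (dotV (Dgam x) (g x) + gam x * \tr (J x)) * psi x).
Proof.
move=> tpsi K1 K2 K3.
have W : weak_gradient (fun x => sigma * gam x) (fun x => sigma *: Dgam x).
  move=> i; rewrite (_ : (fun x => _ 0 i) = (fun x => sigma * Dgam x 0 i)).
    by apply: weak_partialZ; exact: Wgam.1.
  by apply/funext => x; rewrite mxE.
have H := rint_by_parts_ge0 Wg tpsi W sgam (measurable_funM (measurable_cst sigma) mgam).
have K1' : itg mu (fun x => dotV (sigma *: Dgam x) (g x) * psi x).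
  by apply: (eq_itg _ (itgZ sigma K1)) => x; rewrite dotVZ; ring.
have K2' : itg mu (fun x => sigma * gam x * \tr (J x) * psi x).
  by apply: (eq_itg _ (itgZ sigma K2)) => x; ring.
have K3' : itg mu (fun x => sigma * gam x * \sum_i g x 0 i * partial i psi x).
  by apply: (eq_itg _ (itgZ sigma K3)) => x; ring.
have {H} := congr1 ( *%R sigma) (H K1' K2' K3').
rewrite mulrN -!rintZ//; last first.
  by apply: (eq_itg _ (itgD K1' K2')) => x; ring.
rewrite (eq_rint _ (g := fun x => gam x * \sum_i g x 0 i * partial i psi x)); last first.
  by move=> x; rewrite !mulrA sigma2 mul1r.
move=> ->; congr (- _); apply: eq_rint => x.
rewrite dotVZ -mulrA -mulrDr !mulrA sigma2 mul1r; ring.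
Qed.

Let psi n : E -> R := radial (cut_gauss n.+1%:R) theta.
Let N (n : nat) : R := n.+1%:R.
Let N1 n : 1 <= N n. Proof. by rewrite ler1n. Qed.
Let N0 n : 0 < N n. Proof. by rewrite ltr0n. Qed.
Let tpsi n : test_function (psi n). Proof. exact: test_cut_gauss. Qed.
Let C : R := 3 * expR 1 * (6`!%:R + 2 * 5`!%:R).
Let C0 : 0 <= C. Proof. by rewrite mulr_ge0 ?addr_ge0 ?mulr_ge0 ?expR_ge0. Qed.

Let PE x : pdf theta x = @gauss R p (sqd theta x).
Proof. by rewrite mvnormal_pdfE. Qed.

Let psi_le n x : `|psi n x| <= C * pdf theta x.
Proof. by rewrite PE; exact: (cut_gauss_le (N1 n) (sqd_ge0 theta x)). Qed.

Let dirE n x : \sum_i g x 0 i * partial i (psi n) x =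
  2 * cut_gauss' (N n) (sqd theta x) * dotV (x - theta) (g x).
Proof.
rewrite /dotV mulr_sumr; apply: eq_bigr => i _.
rewrite partial_radial; last exact: smooth_cut_gauss.
by rewrite derive1_cut_gauss !mxE; ring.
Qed.

Let lapE n x : laplacian (psi n) x =
  2 * p%:R * cut_gauss' (N n) (sqd theta x) +
  4 * sqd theta x * cut_gauss'' (N n) (sqd theta x).
Proof.
rewrite laplacian_radial; last exact: smooth_cut_gauss.
by rewrite derive1_cut_gauss derive1_cut_gauss'.
Qed.

Let c'_le n x : `|cut_gauss' (N n) (sqd theta x)| <= C * pdf theta x.
Proof. by rewrite PE; exact: (cut_gauss'_le (N1 n) (sqd_ge0 theta x)). Qed.
Let c''_le n x : `|cut_gauss'' (N n) (sqd theta x)| <= C * pdf theta x.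
Proof. by rewrite PE; exact: (cut_gauss''_le (N1 n) (sqd_ge0 theta x)). Qed.

Let itg_dom (f h : E -> R) (c : R) : itg mu (fun x => f x * pdf theta x) ->
  measurable_fun setT f -> measurable_fun setT h -> 0 <= c ->
  (forall x, `|h x| <= c * pdf theta x) -> itg mu (fun x => f x * h x).
Proof.
move=> If mf mh c0 Hh; apply: (itg_le _ _ (itgZ c (itg_norm If))); first exact: measurable_funM.
by move=> x; rewrite !normrM mulrCA (ger0_norm (P0 x)) ler_wpM2l.
Qed.

Let cut_inequality n : rint mu (fun x => gam x * laplacian (psi n) x
    - 2 * (gam x * \tr (J x) * psi n x + gam x * \sum_i g x 0 i * partial i (psi n) x)
    + kappa * (gam x ^+ 2 * psi n x)) <= 0.
Proof.
have mD := weak_gradient_measurable Wgam.1.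
have mpsi := test_measurable (tpsi n).
have mdir : measurable_fun setT (fun x => \sum_i g x 0 i * partial i (psi n) x).
  apply: measurable_sum => i; apply: measurable_funM => //.
  exact: test_measurable (test_partial i (tpsi n)).
have mDg := measurable_dotV mD mg.
have K1 : itg mu (fun x => dotV (Dgam x) (g x) * psi n x).
  exact: (itg_dom I3 mDg mpsi C0 (psi_le n)).
have K2 : itg mu (fun x => gam x * \tr (J x) * psi n x).
  by apply: (itg_dom I2 _ mpsi C0 (psi_le n)); exact: measurable_funM.
have K3 : itg mu (fun x => gam x * \sum_i g x 0 i * partial i (psi n) x).
  have mgd : measurable_fun setT (fun x => gam x * dotV (x - theta) (g x)).
    by apply: measurable_funM => //; exact: measurable_shift_dot.
  have mc : measurable_fun setT (fun x => 2 * cut_gauss' (N n) (sqd theta x)).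
    apply: measurable_funM => //; rewrite -derive1_cut_gauss.
    have Sd := smooth_derive (@smooth_cut_gauss R p (N n)).
    exact: (measurable_continuous (Ck_continuous (Ck_radial 0 theta Sd))).
  have C20 : 0 <= 2 * C by rewrite mulr_ge0.
  have H x : `|2 * cut_gauss' (N n) (sqd theta x)| <= 2 * C * pdf theta x.
    by rewrite normrM (ger0_norm (ler0n _ 2)) -mulrA ler_wpM2l// c'_le.
  apply: (eq_itg _ (itg_dom I1 mgd mc C20 H)) => x.
  by rewrite dirE; ring.
have K4 : itg mu (fun x => gam x ^+ 2 * psi n x).
  by apply: (itg_dom I4 _ mpsi C0 (psi_le n)); exact: measurable_funX.
have K5 : itg mu (fun x => gam x * laplacian (psi n) x).
  by apply: itg_test => //; exact: test_laplacian.
have K6 i : itg mu (fun x => Hgam x i i * psi n x).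
  by apply: itg_test => //; have [] := Wgam.2 i i.
have K6' : itg mu (fun x => \tr (Hgam x) * psi n x).
  by apply: (eq_itg _ (itg_sum K6)) => x; rewrite mulr_suml.
have E1 : rint mu (fun x => gam x * laplacian (psi n) x) =
    rint mu (fun x => \tr (Hgam x) * psi n x).
  rewrite (rint_laplacian_gradient Wgam.1 (tpsi n)) rint_sum; last first.
    by move=> i; apply: itg_test; [have [] := Wgam.1 i|exact: test_partial].
  rewrite (eq_bigr _ (fun i _ => weak_partialP (Wgam.2 i i) (tpsi n))) sumrN opprK.
  by rewrite -rint_sum//; apply: eq_rint => x; rewrite mulr_suml.
have E2 := rint_by_parts_signed (tpsi n) K1 K2 K3.
rewrite rintD; [|by apply: itgB => //; apply: itgZ; exact: itgD|exact: itgZ].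
rewrite rintB//; last by apply: itgZ; exact: itgD.
rewrite rintZ; last exact: itgD.
have E2' : rint mu (fun x => (dotV (Dgam x) (g x) + gam x * \tr (J x)) * psi n x) =
    rint mu (fun x => dotV (Dgam x) (g x) * psi n x) +
    rint mu (fun x => gam x * \tr (J x) * psi n x).
  by rewrite -rintD//; apply: eq_rint => x; ring.
rewrite rintZ// rintD// E1 E2 E2'.
have E3 : rint mu (fun x => (\tr (Hgam x) + 2 * dotV (Dgam x) (g x) + kappa * gam x ^+ 2) * psi n x) <= 0.
  rewrite -(rint0 mu); apply: rint_ae_le; [|exact: itg0|].
    apply: (eq_itg _ (itgD (itgD K6' (itgZ 2 K1)) (itgZ kappa K4))) => x; ring.
  apply: filterS ineq => x H; rewrite mulr_le0_ge0 ?cut_gauss_ge0//.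
  by rewrite mulNr in H; lra.
move: E3; rewrite (eq_rint _ (g := fun x => \tr (Hgam x) * psi n x +
  2 * (dotV (Dgam x) (g x) * psi n x) + kappa * (gam x ^+ 2 * psi n x))); last by move=> x; ring.
rewrite rintD; [|by apply: itgD => //; exact: itgZ|exact: itgZ].
rewrite rintD//; last exact: itgZ.
by rewrite !rintZ//; lra.
Qed.

Lemma cross_term_ge :
  kappa * rint mu (fun x => gam x ^+ 2 * pdf theta x) <=
  rint mu (fun x => gam x * D0 x * pdf theta x).
Proof.
have J1 := itg_gam; have J2 := itg_gam_sqd; have J3 := itg_gam_D0.
pose G x := C * (2 * p%:R * `|gam x * pdf theta x| + 4 * `|gam x * sqd theta x * pdf theta x| +
  2 * `|gam x * \tr (J x) * pdf theta x| + 4 * `|gam x * dotV (x - theta) (g x) * pdf theta x| +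
  `|kappa| * `|gam x ^+ 2 * pdf theta x|).
have IG : itg mu G.
  exact: (itgZ _ (itgD (itgD (itgD (itgD (itgZ _ (itg_norm J1)) (itgZ _ (itg_norm J2)))
    (itgZ _ (itg_norm I2))) (itgZ _ (itg_norm I1))) (itgZ _ (itg_norm I4)))).
have mdot := measurable_shift_dot; have msqd := measurable_sqd.
have [] := @rint_dct _ _ _ mu (fun n x => gam x * laplacian (psi n) x
    - 2 * (gam x * \tr (J x) * psi n x + gam x * \sum_i g x 0 i * partial i (psi n) x)
    + kappa * (gam x ^+ 2 * psi n x))
  (fun x => kappa * (gam x ^+ 2 * pdf theta x) - gam x * D0 x * pdf theta x) G.
- move=> n; have mpsi := test_measurable (tpsi n).
  have mdir : measurable_fun setT (fun x => \sum_i g x 0 i * partial i (psi n) x).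
    apply: measurable_sum => i; apply: measurable_funM => //.
    exact: test_measurable (test_partial i (tpsi n)).
  have mlap := test_measurable (test_laplacian (tpsi n)).
  apply: measurable_funD; last first.
    by apply: measurable_funM => //; apply: measurable_funM => //; exact: measurable_funX.
  apply: measurable_funB; first exact: measurable_funM.
  apply: measurable_funM => //; apply: measurable_funD; last exact: measurable_funM.
  by apply: measurable_funM => //; exact: measurable_funM.
- apply: measurable_funB; last first.
    by apply: measurable_funM => //; apply: measurable_funM => //; exact: measurable_D0.
  by apply: measurable_funM => //; apply: measurable_funM => //; exact: measurable_funX.
- exact: IG.
- move=> n x; rewrite lapE dirE /G.
  have H1 := psi_le n x; have H2 := c'_le n x; have H3 := c''_le n x.
  have q0 := sqd_ge0 theta x.
  set P := pdf theta x in H1 H2 H3 *; set q := sqd theta x in q0 H2 H3 *.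
  set c1 := psi n x in H1 *; set c2 := cut_gauss' (N n) q in H2 *.
  set c3 := cut_gauss'' (N n) q in H3 *.
  set tr := \tr (J x); set dt := dotV _ _.
  have P0' : 0 <= P by exact: P0.
  have B (b c : R) : `|c| <= C * P -> `|b * c| <= C * `|b * P|.
    by move=> cP; rewrite !normrM (ger0_norm P0') mulrCA ler_wpM2l.
  rewrite (le_trans (ler_normD _ _))// [leRHS]mulrDr lerD//; last first.
    by rewrite normrM [leRHS]mulrCA ler_wpM2l//; exact: B.
  rewrite (_ : _ - _ = 2 * p%:R * (gam x * c2) + 4 * (gam x * q * c3) - 2 * (gam x * tr * c1)
    - 4 * (gam x * dt * c2)); last by ring.
  have Z (k b B' : R) : 0 <= k -> `|b| <= C * B' -> `|k * b| <= C * (k * B').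
    by move=> k0 bB; rewrite normrM (ger0_norm k0) mulrCA ler_wpM2l.
  rewrite (le_trans (ler_normB _ _))// [leRHS]mulrDr lerD//; last by apply: Z => //; exact: B.
  rewrite (le_trans (ler_normB _ _))// [leRHS]mulrDr lerD//; last by apply: Z => //; exact: B.
  rewrite (le_trans (ler_normD _ _))// [leRHS]mulrDr lerD//; last by apply: Z => //; exact: B.
  by apply: Z; [exact: mulr_ge0|exact: B].
- apply: aeW => x; have [L1 L2 L3] := @cut_gauss_cvg R p (sqd theta x).
  have -> : kappa * (gam x ^+ 2 * pdf theta x) - gam x * D0 x * pdf theta x =
    gam x * (2 * p%:R * (- 2^-1 * pdf theta x) + 4 * sqd theta x * (4^-1 * pdf theta x))
    - 2 * (gam x * \tr (J x) * pdf theta x +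
        gam x * (2 * (- 2^-1 * pdf theta x) * dotV (x - theta) (g x)))
    + kappa * (gam x ^+ 2 * pdf theta x) by rewrite /D0; field.
  rewrite !PE; under eq_fun do rewrite lapE dirE.
  apply: cvgD; last by do 2!(apply: cvgM; first exact: cvg_cst).
  apply: cvgB.
    apply: cvgM; first exact: cvg_cst.
    by apply: cvgD; apply: cvgM => //; exact: cvg_cst.
  apply: cvgM; first exact: cvg_cst.
  apply: cvgD; apply: cvgM => //; try exact: cvg_cst.
  apply: cvgM; last exact: cvg_cst.
  by apply: cvgM => //; exact: cvg_cst.
move=> _ H.
have : rint mu (fun x => kappa * (gam x ^+ 2 * pdf theta x) - gam x * D0 x * pdf theta x) <= 0.
  rewrite -(cvg_lim (@Rhausdorff R) H); apply: limr_le; first by apply/cvg_ex; eexists; exact: H.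
  by apply: nearW => n; exact: cut_inequality.
by rewrite rintB ?rintZ ?itgZ// subr_le0.
Qed.

End cross_term.

(** * Domination *)

Lemma rint_gt0 (R : realType) p (theta : 'rV[R]_p) (f : 'rV[R]_p -> R) :
  (forall x, 0 < f x) -> itg (lebesgue_rV p) f -> 0 < rint (lebesgue_rV p) f.
Proof.
move=> f0 If; have mf := itg_measurable If.
rewrite lt_neqAle rint_ge0 ?andbT; last by move=> x; exact: ltW.
apply/negP => /eqP z.
have : (\int[lebesgue_rV p]_(x in setT) `|(f x)%:E| = 0)%E.
  rewrite -[RHS](_ : (rint (lebesgue_rV p) f)%:E = 0%E); last by rewrite -z.
  by rewrite EFin_rint//; apply: eq_integral => x _; rewrite /= ger0_norm// ltW.
move=> /ae_eq_integral_abs H.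
have {}H := H measurableT ((measurable_EFinP _ _).2 mf).
have ae0 : {ae lebesgue_rV p, forall x, mvnormal_pdf theta x = 0}.
  apply: filterS H => x /(_ I) /= [fx].
  by have := f0 x; rewrite fx ltxx.
have := rint_ae (measurable_mvnormal_pdf theta) (measurable_cst (0 : R)) ae0.
rewrite rint0 /Rintegral integral_mvnormal_pdf => /eqP.
by rewrite oner_eq0.
Qed.

Lemma measurable_invr d (T : measurableType d) (R : realType) (f : T -> R) :
  (forall x, 0 < f x) -> measurable_fun setT f -> measurable_fun setT (fun x => (f x)^-1).
Proof.
move=> f0 mf; have -> : (fun x => (f x)^-1) = (fun x => expR (- ln (f x))).
  by apply/funext => x; rewrite expRN lnK// posrE.
apply: measurableT_comp => //; apply: measurable_funN => //.
by apply: measurableT_comp => //; exact: measurable_ln.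
Qed.

Section loss_difference.
Context {R : realType} {p : nat}.
Notation E := 'rV[R]_p.

Lemma dotVC (u v : E) : dotV u v = dotV v u.
Proof. by apply: eq_bigr => i _; rewrite mulrC. Qed.

Lemma dotVDl (u v w : E) : dotV (u + v) w = dotV u w + dotV v w.
Proof. by rewrite /dotV -big_split; apply: eq_bigr => i _; rewrite mxE mulrDl. Qed.

Lemma unbiased_loss_error (g : E -> E) (J : E -> 'M[R]_p) theta x :
  unbiased_loss g J x - sqnorm (x + g x - theta) =
  p%:R - sqd theta x + 2 * \tr (J x) - 2 * dotV (x - theta) (g x).
Proof.
rewrite /unbiased_loss /sqd /sqnorm [x + g x - theta]addrAC.
move: (x - theta) => y.
rewrite dotVDl !(dotVC _ (y + g x)) !dotVDl (dotVC (g x) y).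
by ring.
Qed.

End loss_difference.

Theorem theorem2p1 (R : realType) (p : nat)
  (m xi gamma : 'rV[R]_p -> R)
  (Dm g Dxi Dgamma : 'rV[R]_p -> 'rV[R]_p)
  (Jg Hxi Hgamma : 'rV[R]_p -> 'M[R]_p)
  (K0 alpha : R)
  (m_ge0 : forall x, 0 <= m x)
  (m_diff : weak_gradient m Dm)
  (g_def : forall x, g x = (m x)^-1 *: Dm x)
  (g_diff : weak_jacobian g Jg)
  (xi_gt0 : forall x, 0 < xi x)
  (xi_diff : weak_hessian xi Dxi Hxi)
  (harmonicity :
     (weakly_superharmonic m /\ forall x, 0 < \tr (Hxi x)) \/
     (weakly_subharmonic m /\ forall x, \tr (Hxi x) < 0))
  (xi_moment : forall theta : 'rV[R]_p,
     ('E_(mvnormal_prob theta)[fun x => ((\tr (Hxi x) / xi x) ^+ 2)%R] < +oo)%E)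
  (m_lower : exists K : R, 0 < K /\
     forall x, K * (xi x ^+ 2 / `|\tr (Hxi x)|) < m x)
  (K0_def : K0 = inf [set m x * (`|\tr (Hxi x)| / xi x ^+ 2)
                     | x in [set: 'rV[R]_p]])
  (alpha_gt0 : 0 < alpha) (alpha_lt : alpha < 2 * K0)
  (gamma_def : forall x, m x != 0 ->
     gamma x = - alpha * Num.sg (\tr (Hxi x)) * (xi x / m x))
  (g_moment : forall theta : 'rV[R]_p,
     ('E_(mvnormal_prob theta)[fun x => sqnorm (g x)] < +oo)%E)
  (risk0_fin : forall theta : 'rV[R]_p,
     (risk theta (fun x => (x + g x)%R) (unbiased_loss g Jg) < +oo)%E)
  (gamma_diff : weak_hessian gamma Dgamma Hgamma)
  (gamma_int : forall theta : 'rV[R]_p,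
     [/\ normal_integrable theta (fun x => dotV (x - theta) (Dgamma x)),
         normal_integrable theta (fun x => \tr (Hgamma x)),
         normal_integrable theta (fun x => gamma x * dotV (x - theta) (g x)),
         normal_integrable theta (fun x => gamma x * \tr (Jg x)) &
         normal_integrable theta (fun x => dotV (Dgamma x) (g x))]) :
  loss_dominates (fun x => x + g x)
    (fun x => unbiased_loss g Jg x - gamma x) (unbiased_loss g Jg).
Proof.
have tr0 x : \tr (Hxi x) != 0.
  by case: harmonicity => -[_ /(_ x)]; [move/gt_eqF->|move/lt_eqF->].
have [i0 _] : exists i : 'I_p, True.
  apply: contrapT => /forallNP no; move: (tr0 0); rewrite /mxtrace big1 ?eqxx//.
  by move=> i; have := no i.
have [K [Kgt0 HK]] := m_lower.
have m_gt0 x : 0 < m x.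
  apply: le_lt_trans (HK x).
  by rewrite mulr_ge0 ?(ltW Kgt0)// divr_ge0// exprn_ge0// ltW.
have m_neq0 x : m x != 0 by rewrite gt_eqF.
have [s [s2 sgE absE]] : exists s : R, [/\ s * s = 1,
    forall x, Num.sg (\tr (Hxi x)) = s & forall x, `|\tr (Hxi x)| = s * \tr (Hxi x)].
  case: harmonicity => -[_ H].
    by exists 1; split=> [|x|x]; [rewrite mulr1|exact: gtr0_sg|rewrite gtr0_norm// mul1r].
  by exists (-1); split=> [|x|x]; [rewrite mulrNN mulr1|exact: ltr0_sg|rewrite ltr0_norm// mulN1r].
have gammaE x : gamma x = - alpha * s * (xi x / m x) by rewrite gamma_def ?sgE.
have K0_gt0 : 0 < K0 by rewrite -(pmulr_rgt0 K0 (ltr0Sn R 1)); exact: lt_trans alpha_lt.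
have K0_le x : K0 <= m x * (`|\tr (Hxi x)| / xi x ^+ 2).
  rewrite K0_def; apply: ge_inf; last by exists x.
  by exists 0 => _ [y _ <-]; rewrite mulr_ge0// divr_ge0// exprn_ge0// ltW.
have Lm : loc_integrable m by have [] := m_diff i0.
have Lgam : loc_integrable gamma by have [] := gamma_diff.1 i0.
have Lxi : loc_integrable xi by have [] := xi_diff.1 i0.
have mgam := loc_integrable_measurable Lgam.
have mxi := loc_integrable_measurable Lxi.
have mg j : measurable_fun setT (fun x => g x 0 j).
  by have [/loc_integrable_measurable] := g_diff j j.
have mtrJ := measurable_mxtrace (weak_jacobian_measurable g_diff).
have mtrxi := measurable_mxtrace (weak_jacobian_measurable xi_diff.2).
have Dm_def x i : Dm x 0 i = m x * g x 0 i by rewrite g_def mxE mulVKf.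
have Lg2 : loc_integrable (fun x => sqnorm (g x)).
  have mg2 : measurable_fun setT (fun x => sqnorm (g x)) by exact: measurable_dotV.
  apply: normal_integrable_loc => //; apply: expectation_lty_itg => // x.
  exact: sqnorm_ge0.
have sign_ae : {ae lebesgue_rV p, forall x, s * (\tr (Jg x) + sqnorm (g x)) <= 0}.
  case: harmonicity => -[Hm Hx].
    have s1 : s = 1 by rewrite -(sgE 0) gtr0_sg.
    have := superharmonic_log_gradient m_gt0 m_diff g_diff Dm_def Lg2 Lm Hm.
    by apply: filterS => x; rewrite s1 mul1r.
  have s1 : s = -1 by rewrite -(sgE 0) ltr0_sg.
  have := subharmonic_log_gradient m_gt0 m_diff g_diff Dm_def Lg2 Lm Hm.
  by apply: filterS => x; rewrite s1 mulN1r oppr_le0.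
have gam_m x : gamma x * m x = - alpha * s * xi x by rewrite gammaE -[LHS]mulrA divfK.
have gamma2 x : gamma x ^+ 2 = alpha ^+ 2 * (xi x / m x) ^+ 2.
  transitivity (s * s * (alpha ^+ 2 * (xi x / m x) ^+ 2)); last by rewrite s2 mul1r.
  by rewrite gammaE; ring.
pose kappa := K0 / alpha.
have ineq : {ae lebesgue_rV p, forall x,
    \tr (Hgamma x) + 2 * dotV (Dgamma x) (g x) <= - kappa * gamma x ^+ 2}.
  have := quotient_laplacian_ae gamma_diff m_diff g_diff xi_diff Dm_def gam_m.
  apply: filterS2 sign_ae => x Hs Hq.
  set S := \tr (Jg x) + sqnorm (g x) in Hs Hq.
  have -> : \tr (Hgamma x) + 2 * dotV (Dgamma x) (g x) =
      - alpha * `|\tr (Hxi x)| / m x + alpha * (xi x / m x) * (s * S).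
    apply: (mulfI (m_neq0 x)); rewrite absE.
    have -> : m x * (\tr (Hgamma x) + 2 * dotV (Dgamma x) (g x)) =
      - alpha * s * \tr (Hxi x) - m x * (gamma x * S) by rewrite Hq; ring.
    by rewrite gammaE; field.
  have q0 : 0 <= alpha * (xi x / m x) by rewrite mulr_ge0 ?divr_ge0 ?ltW.
  have H1 : alpha * (xi x / m x) * (s * S) <= 0 by rewrite mulr_ge0_le0.
  have H2 : kappa * gamma x ^+ 2 <= alpha * `|\tr (Hxi x)| / m x.
    have -> : kappa * gamma x ^+ 2 = alpha / m x * (K0 * (xi x ^+ 2 / m x)).
      by rewrite gamma2 /kappa; field; rewrite m_neq0 gt_eqF.
    rewrite [leRHS]mulrAC ler_wpM2l ?divr_ge0 ?(ltW alpha_gt0) ?m_ge0//.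
    have x2 : 0 < xi x ^+ 2 by rewrite exprn_gt0.
    rewrite mulrA ler_pdivrMr// -ler_pdivlMr// (le_trans (K0_le x))//.
    by rewrite mulrA [m x * _]mulrC.
  by rewrite mulNr; move: H2; rewrite !mulNr; lra.
have main theta :
    (risk theta (fun x => (x + g x)%R) (fun x => (unbiased_loss g Jg x - gamma x)%R) <
     risk theta (fun x => (x + g x)%R) (unbiased_loss g Jg))%E.
  have [_ _ N1 N2 N3] := gamma_int theta.
  pose D0 x := p%:R - sqd theta x + 2 * \tr (Jg x) - 2 * dotV (x - theta) (g x).
  have mD0 : measurable_fun setT D0 by exact: measurable_D0.
  have R0 : risk theta (fun x => x + g x) (unbiased_loss g Jg) =
      ('E_(mvnormal_prob theta)[fun x => (D0 x ^+ 2)%R])%E.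
    by congr expectation; apply/funext => x; rewrite /= unbiased_loss_error.
  have R1 : risk theta (fun x => x + g x) (fun x => unbiased_loss g Jg x - gamma x) =
      ('E_(mvnormal_prob theta)[fun x => ((D0 x - gamma x) ^+ 2)%R])%E.
    by congr expectation; apply/funext => x; rewrite /= addrAC unbiased_loss_error.
  have mD02 : measurable_fun setT (fun x => D0 x ^+ 2) by exact: measurable_funX.
  have I5 : itg (lebesgue_rV p) (fun x => D0 x ^+ 2 * mvnormal_pdf theta x).
    apply: expectation_lty_itg => //; first by move=> x; exact: sqr_ge0.
    by rewrite -R0.
  have P0 := @mvnormal_pdf_ge0 R p theta.
  have I4 : itg (lebesgue_rV p) (fun x => gamma x ^+ 2 * mvnormal_pdf theta x).
    have mr : measurable_fun setT (fun x => (\tr (Hxi x) / xi x) ^+ 2).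
      by apply: measurable_funX; apply: measurable_funM => //; exact: measurable_invr.
    have Ir := expectation_lty_itg mr (fun x => sqr_ge0 _) (xi_moment theta).
    apply: (itg_le _ _ (itgZ ((alpha / K) ^+ 2) Ir)).
      by apply: measurable_funM; [exact: measurable_funX|exact: measurable_mvnormal_pdf].
    move=> x; rewrite normrM (ger0_norm (P0 x)) (ger0_norm (sqr_ge0 _)) mulrA ler_wpM2r//.
    have T0 : 0 < `|\tr (Hxi x)| by rewrite normr_gt0.
    have q1 : xi x / m x <= K^-1 * (`|\tr (Hxi x)| / xi x).
      have := ltW (HK x); rewrite mulrA ler_pdivrMr// => h.
      rewrite ler_pdivrMr// -(ler_pM2l Kgt0) -(ler_pM2r (xi_gt0 x)).
      rewrite (_ : K * (K^-1 * _ * m x) * xi x = m x * `|\tr (Hxi x)|); last first.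
        by field; rewrite !gt_eqF.
      by rewrite -mulrA -expr2.
    rewrite gamma2.
    rewrite [leRHS](_ : _ = alpha ^+ 2 * (K^-1 * (`|\tr (Hxi x)| / xi x)) ^+ 2); last first.
      by rewrite !exprMn real_normK ?num_real// !mulrA.
    rewrite ler_wpM2l ?sqr_ge0//.
    by rewrite lerXn2r ?nnegrE// ?mulr_ge0 ?divr_ge0 ?invr_ge0// ltW.
  have sg0 x : 0 <= - s * gamma x.
    rewrite gammaE [leRHS](_ : _ = (s * s) * (alpha * (xi x / m x))); last by ring.
    by rewrite s2 mul1r mulr_ge0 ?divr_ge0 ?ltW.
  have Ns2 : - s * - s = 1 by rewrite mulrNN.
  have J1 := normal_integrable_itg N1; have J2 := normal_integrable_itg N2.
  have J3 := normal_integrable_itg N3.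
  have cross := cross_term_ge gamma_diff g_diff Ns2 sg0 Lgam ineq J1 J2 J3 I4 I5.
  have IgD := itg_gam_D0 g_diff Lgam I4 I5.
  have A0 : 0 < rint (lebesgue_rV p) (fun x => gamma x ^+ 2 * mvnormal_pdf theta x).
    apply: (rint_gt0 theta) => // x; rewrite mulr_gt0//.
      by rewrite gamma2 mulr_gt0// exprn_gt0// divr_gt0.
    by rewrite mvnormal_pdfE; exact: gauss_gt0.
  have I6 : itg (lebesgue_rV p) (fun x => (D0 x - gamma x) ^+ 2 * mvnormal_pdf theta x).
    by apply: (eq_itg _ (itgD (itgB I5 (itgZ 2 IgD)) I4)) => x; rewrite /D0; ring.
  rewrite R0 R1 !expectation_rint//; try by move=> x; exact: sqr_ge0.
    rewrite lte_fin.
    have -> : rint (lebesgue_rV p) (fun x => (D0 x - gamma x) ^+ 2 * mvnormal_pdf theta x) =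
        rint (lebesgue_rV p) (fun x => D0 x ^+ 2 * mvnormal_pdf theta x)
        - 2 * rint (lebesgue_rV p) (fun x => gamma x * D0 x * mvnormal_pdf theta x)
        + rint (lebesgue_rV p) (fun x => gamma x ^+ 2 * mvnormal_pdf theta x).
      rewrite -rintZ// -rintB//; last exact: itgZ.
      rewrite -rintD//; last by apply: itgB => //; exact: itgZ.
      by apply: eq_rint => x; ring.
    have k1 : 1 < 2 * kappa by rewrite /kappa mulrA ltr_pdivlMr// mul1r.
    have := ltr_pM2r A0 1 (2 * kappa); rewrite k1 mul1r -mulrA => h.
    move: cross; rewrite -/D0; lra.
  by apply: measurable_funX; exact: measurable_funB.
split=> [theta|]; first exact: ltW.
by exists 0.
Qed.
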